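(* Let $(\mathcal{X},d,\mu)$ be a space of homogeneous type and let $\varphi$ be a growth function on $\mathcal{X}$. (1) When $\mu(\mathcal{X})=\infty$: for any $f\in T_\varphi(\mathcal{X}\times(0,\infty))$ there exist $\{\lambda_j\}_{j=1}^\infty\subset\mathbb{C}$ and a sequence $\{A_j\}_{j=1}^\infty$ of $(T_\varphi,\infty)$-atoms associated, respectively, with balls $\{B_j\}_{j=1}^\infty$ of $\mathcal{X}$ such that, for almost every $(x,t)\in\mathcal{X}\times(0,\infty)$, $f(x,t)=\sum_{j=1}^\infty\lambda_jA_j(x,t)$. Moreover, there exists a positive constant $C$ such that, for any $f\in T_\varphi(\mathcal{X}\times(0,\infty))$, $$\inf\left\{\lambda\in(0,\infty):\ \sum_{j=1}^\infty\varphi\left(B_j,\frac{|\lambda_j|}{\lambda\|\mathbf{1}_{B_j}\|_{L^\varphi(\mathcal{X})}}\right)\le1\right\}\le C\|f\|_{T_\varphi(\mathcal{X}\times(0,\infty))}.$$ (2) When $\mu(\mathcal{X})<\infty$: for any $f\in T_\varphi(\mathcal{X}\times(0,\infty))$ there exist $\{\lambda_0\}\cup\{\lambda_j\}_{j=1}^\infty\subset\mathbb{C}$, a $(T_\varphi,\infty)$-single-atom $A_0$ and a sequence $\{A_j\}_{j=1}^\infty$ of $(T_\varphi,\infty)$-atoms associated, respectively, with balls $\{B_j\}_{j=1}^\infty$ of $\mathcal{X}$ such that, for almost every $(x,t)\in\mathcal{X}\times(0,\infty)$, $f(x,t)=\lambda_0A_0(x,t)+\sum_{j=1}^\infty\lambda_jA_j(x,t)$,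 where $B_j\neq\mathcal{X}$ for any $j\in\mathbb{N}$. Moreover, there exists a positive constant $C$ such that, for any $f\in T_\varphi(\mathcal{X}\times(0,\infty))$, $$\inf\left\{\lambda\in(0,\infty):\ \varphi\left(\mathcal{X},\frac{|\lambda_0|}{\lambda\|\mathbf{1}_{\mathcal{X}}\|_{L^\varphi(\mathcal{X})}}\right)+\sum_{j=1}^\infty\varphi\left(B_j,\frac{|\lambda_j|}{\lambda\|\mathbf{1}_{B_j}\|_{L^\varphi(\mathcal{X})}}\right)\le1\right\}\le C\|f\|_{T_\varphi(\mathcal{X}\times(0,\infty))}.$$ In both parts the constant $C$ is independent of $f$ and the bound is for the decomposition of $f$ provided.
   Context: Space. $\mathcal{X}$ is a set with metric $d$ and non-negative Borel regular measure $\mu$; $B(x,r):=\{y:\ d(x,y)<r\}$, $V(x,r):=\mu(B(x,r))$, $V(B):=\mu(B)$ for a ball $B$. It is a space of homogeneous type: there is $C_1\in[1,\infty)$ with $V(x,2r)\le C_1V(x,r)<\infty$ for all $x\in\mathcal{X}$, $r\in(0,\infty)$. $\mathbf{1}_E$ is the characteristic function of $E$ and $E^\complement:=\mathcal{X}\setminus E$. Growth functions. An Orlicz function is a non-decreasing $\Phi:[0,\infty)\to[0,\infty)$ with $\Phi(0)=0$, $\Phi(t)>0$ for $t>0$ and $\lim_{t\to\infty}\Phi(t)=\infty$. A function $\varphi:\mathcal{X}\times[0,\infty)\to[0,\infty)$ with $\varphi(x,\cdot)$ Orlicz for every $x$ is of uniformly upper (resp. lower) type $p\in(0,\infty)$ if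 there is $C>0$ with $\varphi(x,st)\le Cs^p\varphi(x,t)$ for all $x\in\mathcal{X}$, $t\ge0$ and $s\in[1,\infty)$ (resp. $s\in[0,1]$). For $q\in(1,\infty)$ with conjugate exponent $q'$, $\varphi\in\mathbb{A}_q(\mathcal{X})$ means $\sup_{t>0}\sup_B\{\frac1{V(B)}\int_B\varphi(x,t)\,d\mu(x)\}\{\frac1{V(B)}\int_B[\varphi(y,t)]^{1-q'}\,d\mu(y)\}^{q-1}<\infty$, $B$ running over all balls; $\varphi\in\mathbb{A}_1(\mathcal{X})$ means $\sup_{t>0}\sup_B\{\frac1{V(B)}\int_B\varphi(x,t)\,d\mu(x)\}\{\operatorname{ess\,sup}_{y\in B}[\varphi(y,t)]^{-1}\}<\infty$; $\mathbb{A}_\infty(\mathcal{X}):=\bigcup_{q\in[1,\infty)}\mathbb{A}_q(\mathcal{X})$. $\varphi$ is a growth function if $\varphi(x,\cdot)$ is Orlicz for every $x$, $\varphi(\cdot,t)$ is measurable for every $t$, $\varphi\in\mathbb{A}_\infty(\mathcal{X})$, and $\varphi$ is of uniformly lower type $p$ for some $p\in(0,1]$ and of uniformly upper type $1$. $\varphi(E,t):=\int_E\varphi(x,t)\,d\mu(x)$. $L^\varphi(\mathcal{X})$ is the set of measurable $f$ with $\int_{\mathcal{X}}\varphi(x,|f(x)|)\,d\mu(x)<\infty$, with $\|f\|_{L^\varphi(\mathcal{X})}:=\inf\{\lambda>0:\int_{\mathcal{X}}\varphi(x,|f(x)|/\lambda)\,d\mu(x)\le1\}$. Tent spaces. For measurable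 $g$ on $\mathcal{X}\times(0,\infty)$ and $x\in\mathcal{X}$, $\mathcal{A}(g)(x):=\{\int_{\Gamma(x)}|g(y,t)|^2\frac{d\mu(y)}{V(x,t)}\frac{dt}{t}\}^{1/2}$, where $\Gamma(x):=\{(y,t)\in\mathcal{X}\times(0,\infty):d(x,y)<t\}$. For $p\in(0,\infty)$, $\|g\|_{T^p_2(\mathcal{X}\times(0,\infty))}:=\|\mathcal{A}(g)\|_{L^p(\mathcal{X})}$. $T_\varphi(\mathcal{X}\times(0,\infty))$ is the set of measurable $g$ with $\mathcal{A}(g)\in L^\varphi(\mathcal{X})$, with $\|g\|_{T_\varphi(\mathcal{X}\times(0,\infty))}:=\|\mathcal{A}(g)\|_{L^\varphi(\mathcal{X})}$. The tent over an open set $O\subset\mathcal{X}$ is $\widehat O:=\{(x,t)\in\mathcal{X}\times(0,\infty):d(x,O^\complement)\ge t\}$ ($\widehat{\mathcal{X}}=\mathcal{X}\times(0,\infty)$). Atoms. For $p\in(1,\infty)$, a function $A$ on $\mathcal{X}\times(0,\infty)$ is a $(T_\varphi,p)$-atom associated with a ball $B$ if $\operatorname{supp}(A)\subset\widehat B$ and $\|A\|_{T^p_2(\mathcal{X}\times(0,\infty))}\le[\mu(B)]^{1/p}\|\mathbf{1}_B\|^{-1}_{L^\varphi(\mathcal{X})}$. If $\mu(\mathcal{X})<\infty$, $A$ is a $(T_\varphi,p)$-single-atom if $\|A\|_{T^p_2(\mathcal{X}\times(0,\infty))}\le[\mu(\mathcal{X})]^{1/p}\|\mathbf{1}_{\mathcal{X}}\|^{-1}_{L^\varphi(\mathcal{X})}$.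 $A$ is a $(T_\varphi,\infty)$-atom (resp. $(T_\varphi,\infty)$-single-atom) if it is a $(T_\varphi,p)$-atom (resp. $(T_\varphi,p)$-single-atom) for every $p\in(1,\infty)$, with the same ball $B$ in the case of atoms.
   Formalization: In part (2), if X has only one point, every ball equals X, so balls B_j ≠ X cannot exist; in that case the sequence of atoms is read as void (all λ_j = 0 for j ≥ 1, f = λ_0 A_0 almost everywhere). *)

(* Defs.v *)
From HB Require Import structures.
From mathcomp Require Import all_boot all_order all_algebra.
From mathcomp Require Import all_classical all_reals all_analysis.
From mathcomp Require Import measurable_realfun ess_sup_inf complex.

Set Implicit Arguments.
Unset Strict Implicit.
Unset Printing Implicit Defensive.

Import Order.TTheory GRing.Theory Num.Theory.
Import numFieldNormedType.Exports.

Local Open Scope classical_set_scope.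
Local Open Scope ring_scope.

#[short(type="metricMeasurableType")]
HB.structure Definition MetricMeasurable (R : numDomainType)
    (d : measure_display) := {T of Metric R T & Measurable d T}.

Section Space.
Context {R : realType} {d : measure_display} {X : metricMeasurableType R d}.
Variable mu : {measure set X -> \bar R}.

(* The sigma-algebra of X may be any one lying between the Borel sets and the
   sets measurable for the outer measure induced by mu. *)
Definition borel_regular :=
  (forall U : set X, open U -> measurable U) /\
  (forall E : set X, measurable E ->
     exists2 G, <<s (@open X) >> G & E `<=` G /\ mu G = mu E).

Definition doubling :=
  exists2 C1 : R, 1 <= C1 & forall (x : X) (r : R), 0 < r ->
    (mu (ball x (2 * r)) <= C1%:E * mu (ball x r))%E /\
    (mu (ball x r) < +oo)%E.

Definition homogeneous_type := borel_regular /\ doubling.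

Definition metric_ball (B : set X) :=
  exists (x : X) (r : R), 0 < r /\ B = ball x r.

Definition avg (E : set X) (g : X -> \bar R) : \bar R :=
  ((mu E)^-1 * \int[mu]_(x in E) g x)%E.

End Space.

(* The infimum of an empty set of reals is +oo. *)
Definition luxemburg {R : realType} (M : R -> \bar R) : \bar R :=
  ereal_inf [set l%:E | l in [set l : R | 0 < l /\ (M l <= 1)%E]].

Section Growth.
Context {R : realType} {d : measure_display} {X : metricMeasurableType R d}.
Variable mu : {measure set X -> \bar R}.

Definition orlicz (Phi : R -> R) :=
  [/\ Phi 0 = 0,
      (forall s t, 0 <= s -> s <= t -> Phi s <= Phi t),
      (forall t, 0 < t -> 0 < Phi t) &
      Phi t @[t --> +oo%R] --> +oo%R].

(* Only the values phi x t with t >= 0 are relevant. *)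
Variable phi : X -> R -> R.

Definition upper_type (p : R) :=
  exists2 C : R, 0 < C & forall x t s, 0 <= t -> 1 <= s ->
    phi x (s * t) <= C * s `^ p * phi x t.

Definition lower_type (p : R) :=
  exists2 C : R, 0 < C & forall x t s, 0 <= t -> 0 <= s -> s <= 1 ->
    phi x (s * t) <= C * s `^ p * phi x t.

Definition muckenhoupt (q : R) :=
  let q' := q / (q - 1) in
  (ereal_sup
    [set avg mu Bt.1 (fun x => (phi x Bt.2)%:E) *
         (avg mu Bt.1 (fun y => (phi y Bt.2 `^ (1 - q'))%:E)) `^ (q - 1)
    | Bt in [set Bt : set X * R | metric_ball Bt.1 /\ (0 < Bt.2)%R]] < +oo)%E.

(* The function under the essential supremum is positive, so extending it by 0
   outside the ball gives the essential supremum over the ball. *)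
Definition muckenhoupt1 :=
  (ereal_sup
    [set avg mu Bt.1 (fun x => (phi x Bt.2)%:E) *
         ess_sup mu ((fun y => ((phi y Bt.2)^-1)%:E) \_ Bt.1)
    | Bt in [set Bt : set X * R | metric_ball Bt.1 /\ (0 < Bt.2)%R]] < +oo)%E.

Definition muckenhoupt_infty :=
  muckenhoupt1 \/ exists2 q : R, 1 < q & muckenhoupt q.

Definition growth_function :=
  [/\ (forall x, orlicz (phi x)),
      (forall t, 0 <= t -> measurable_fun setT (fun x => phi x t)),
      muckenhoupt_infty,
      (exists2 p : R, 0 < p <= 1 & lower_type p) &
      upper_type 1].

Definition phi_int (E : set X) (t : R) : \bar R :=
  \int[mu]_(x in E) (phi x t)%:E.

(* phi x extended to [0, +oo] by its limit at infinity. *)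
Definition phi_ext (x : X) (u : \bar R) : \bar R :=
  if u is r%:E then (phi x r)%:E else +oo%E.

Definition in_Lphi (f : X -> \bar R) :=
  measurable_fun setT f /\ (\int[mu]_x phi_ext x `|f x| < +oo)%E.

Definition Lphi_norm (f : X -> \bar R) : \bar R :=
  luxemburg (fun l => \int[mu]_x phi_ext x (`|f x| * (l^-1)%:E))%E.

Definition norm_ind (B : set X) : \bar R := Lphi_norm (EFin \o \1_B).

End Growth.

Section Tent.
Context {R : realType} {d : measure_display} {X : metricMeasurableType R d}.
Variable mu : {measure set X -> \bar R}.
Implicit Type g : X * R -> R[i].

(* Functions on X * ]0, +oo[ are represented by functions on X * R whose
   values outside of upper_half are irrelevant. *)
Definition upper_half : set (X * R) := [set z | 0 < z.2].

Definition measurable_upper g :=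
  measurable_fun upper_half (fun z => complex.Re (g z)) /\
  measurable_fun upper_half (fun z => complex.Im (g z)).

Definition cone (x : X) : set (X * R) :=
  [set z | 0 < z.2 /\ mdist x z.1 < z.2].

Definition area g (x : X) : \bar R :=
  ((\int[mu \x lebesgue_measure]_(z in cone x)
      ((Normc.normc (g z) ^+ 2)%:E * (mu (ball x z.2))^-1 * (z.2^-1)%:E))
   `^ 2^-1)%E.

Definition T2_norm (p : R) g : \bar R := Lnorm mu p%:E (area g).

(* The distance to the empty set is +oo. *)
Definition tent (O : set X) : set (X * R) :=
  [set z | 0 < z.2 /\
           (z.2%:E <= ereal_inf [set (mdist z.1 y)%:E | y in ~` O])%E].

Variable phi : X -> R -> R.

Definition in_Tphi g := measurable_upper g /\ in_Lphi mu phi (area g).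

Definition Tphi_norm g : \bar R := Lphi_norm mu phi (area g).

Definition atom_p (p : R) (B : set X) g :=
  [/\ measurable_upper g,
      (forall z, upper_half z -> g z != 0 -> tent B z) &
      (T2_norm p g <= (mu B) `^ p^-1 * (norm_ind mu phi B)^-1)%E].

Definition single_atom_p (p : R) g :=
  measurable_upper g /\
  (T2_norm p g <= (mu setT) `^ p^-1 * (norm_ind mu phi setT)^-1)%E.

Definition atom (B : set X) g := forall p : R, 1 < p -> atom_p p B g.

Definition single_atom g := forall p : R, 1 < p -> single_atom_p p g.

(* phi(B, |lam| / (l ||1_B||)); the norm of 1_B is a positive real number for
   balls B, and for X of finite measure, unless mu = 0. *)
Definition coef_term (B : set X) (lam : R[i]) (l : R) : \bar R :=
  phi_int mu phi B (Normc.normc lam / (l * fine (norm_ind mu phi B))).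

End Tent.

(* Main.v *)
(* For x in X let S x be the square of the area integral of f over the cone of
   aperture 9 at x, let O_k be the open set {S > 4^k}, and let tent3 O be the set
   of (x, t) such that B(x, 3 t) is contained in O.  A cone of aperture 1 meets
   the complement of tent3 O_k inside a cone of aperture 9 whose vertex lies
   outside O_k.  Hence f cut to that complement has an area integral that is
   bounded everywhere by a multiple of 2^k, which controls its T^p_2 norms for
   all p at once.  The atoms are the multiples of f cut to the parts of
   tent3 O_k \ tent3 O_(k+1) above disjoint pieces of a Whitney covering of O_k,
   with coefficients C1 2^(k+1) ||1_B||.

   The coefficients are controlled by the sum over k of phi(O_k, 2^k / l).  If
   most of a ball avoids P, then the A_infinity property compares the phi-masses
   of the ball and of its part outside P.  With a Vitali covering of the set where
   the maximal function of 1_P is large and Tonelli's theorem, this changes the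
   aperture: phi(O_k, t) is at most a multiple of the integral of
   phi(x, t) min(1, (A(f)(x) / 2^k)^2).  In the sum over k, the lower type p > 0
   handles the levels below A(f)(x), and the upper type 1 < 2 those above it.

   If mu(X) is infinite, then so is phi(X, t), by the A_infinity property, and no
   O_k is X.  If mu(X) is finite and some O_k is X, let k0 be the last such k; f
   cut to the complement of tent3 O_(k0+1) is a multiple of the single atom. *)
Require Import Defs.
From HB Require Import structures.
From mathcomp Require Import all_boot all_order all_algebra.
From mathcomp Require Import all_classical all_reals all_analysis complex.
From mathcomp Require Import measurable_realfun ess_sup_inf ring lra.

Set Implicit Arguments.
Unset Strict Implicit.
Unset Printing Implicit Defensive.

Import Order.TTheory GRing.Theory Num.Theory.
Import numFieldNormedType.Exports.

Local Open Scope classical_set_scope.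
Local Open Scope ring_scope.


(** * Integrals and measures *)

(** The weight changes with the level: at height [2 ^ k] it is [phi(., 2 ^ k / l)], so an inequality
    for one weighted measure is not enough. Every weighted estimate is therefore proved for a single
    weight with a constant independent of [t], and its right side is kept as an integral over X,
    inside which the sum over [k] can be taken pointwise.

    The steepness 3 of the tents is chosen for Whitney balls whose radius is the full distance to
    the complement. Over the half of such a ball, the points of the steep tent lie in the ordinary
    tent over the ball, and the ball itself still lies in [O_k]. Hence no such ball is X when [O_k]
    is not X.

    Sums over the integers and series over pairs (level, Whitney index) are handled through finite
    windows with bounds that do not depend on the window. Balls have positive measure unless the
    measure is zero, and that case is treated apart. *)

Section GeneralMeasure.
Context {R : realType} {d : measure_display} {T : measurableType d}.
Variable m : {measure set T -> \bar R}.
Local Open Scope ereal_scope.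

(* Neither function is required to be measurable. *)
Lemma le_integral_nonneg (D : set T) (f g : T -> \bar R) :
  (forall x, D x -> 0 <= f x) -> (forall x, D x -> f x <= g x) ->
  \int[m]_(x in D) f x <= \int[m]_(x in D) g x.
Proof.
move=> f0 fg.
have g0 x : D x -> 0 <= g x by move=> Dx; exact: le_trans (f0 x Dx) (fg x Dx).
rewrite !ge0_integralE//; apply: le_ereal_sup => _ /= [h hf <-].
exists h => // x; apply: le_trans (hf x) _.
by rewrite /patch; case: ifPn => // /set_mem /fg.
Qed.

(** More than [m B / e] disjoint sets of mass at least [e] would not fit into [B]. *)
Lemma trivIset_mass_finite (I : choiceType) (E : set I) (F : I -> set T)
    (B : set T) (e : R) :
  (forall i, measurable (F i)) -> measurable B -> m B < +oo ->
  (0 < e)%R -> trivIset E F ->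
  (forall i, E i -> F i `<=` B /\ e%:E <= m (F i)) -> finite_set E.
Proof.
move=> mF mB Bfin e0 tF hE; apply: contrapT => infE.
have [D DE Dn] := infinite_set_fset (Num.truncn (fine (m B) / e)).+1 infE.
have : (\sum_(i <- finmap.enum_fset D) e%:E <= m B).
  apply: (@le_trans _ _ (\sum_(i <- finmap.enum_fset D) m (F i))).
    rewrite big_seq [leRHS]big_seq; apply: lee_sum => i iD.
    by have [] := hE i (DE _ iD).
  rewrite -measure_fbigsetU//; last by apply: sub_trivIset tF.
  apply: le_measure; rewrite ?inE//.
    exact: bigsetU_measurable.
  by move=> x; rewrite -bigcup_fset => -[i iD Fx]; exact: (hE i (DE _ iD)).1 Fx.
have Bf : m B \is a fin_num by rewrite ge0_fin_numE.
rewrite sumEFin -(fineK Bf) lee_fin big_const_seq count_predT iter_addr addr0.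
rewrite -mulr_natr -ler_pdivlMl// mulrC => /le_lt_trans/(_ (truncnS_gt _)).
by rewrite ltr_nat ltnS leqNgt Dn.
Qed.

End GeneralMeasure.

(** * Doubling metric measure spaces *)

Section MetricSpace.
Context {R : realType} {d : measure_display} {X : metricMeasurableType R d}.
Implicit Types (x y z : X) (r : R).

Lemma in_mball x r y : ball x r y <-> mdist x y < r.
Proof. by rewrite ballEmdist. Qed.

Lemma mball_open x r : open (ball x r).
Proof.
rewrite openE => y /in_mball xy; apply/nbhs_ballP; exists (r - mdist x y).
  by rewrite /= subr_gt0.
move=> z /in_mball yz; apply/in_mball.
by have := metric_triangle x y z; lra.
Qed.

Lemma mball_subset x y r r' : mdist x y + r' <= r -> ball y r' `<=` ball x r.
Proof.
move=> h z /in_mball yz; apply/in_mball.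
by have := metric_triangle x y z; lra.
Qed.

Lemma mball_center x r : 0 < r -> ball x r x.
Proof. by move=> r0; apply/in_mball; rewrite mdistxx. Qed.

Lemma mball_bigcup x : \bigcup_n ball x n.+1%:R = setT.
Proof.
apply/seteqP; split => // y _; exists (Num.truncn (mdist x y)) => //.
by apply/in_mball; exact: truncnS_gt.
Qed.

Lemma openP_mball (U : set X) :
  (forall x, U x -> exists2 r, 0 < r & ball x r `<=` U) -> open U.
Proof.
by move=> h; rewrite openE => x /h[r r0 rU]; apply/nbhs_ballP; exists r.
Qed.

Definition dense_seq (s : nat -> X) :=
  forall x r, 0 < r -> exists i, mdist x (s i) < r.

End MetricSpace.

Section Doubling.
Context {R : realType} {d : measure_display} {X : metricMeasurableType R d}.
Variable mu : {measure set X -> \bar R}.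
Implicit Types (x y z : X) (r : R).

Definition doubling_with (C1 : R) := forall x r, 0 < r ->
  [/\ (0 < mu (ball x r))%E, (mu (ball x r) < +oo)%E &
      (mu (ball x (2 * r)) <= C1%:E * mu (ball x r))%E].

Definition vol x r : R := fine (mu (ball x r)).

Hypothesis open_meas : forall U : set X, open U -> measurable U.

Lemma measurable_mball x r : measurable (ball x r).
Proof. by apply: open_meas; exact: mball_open. Qed.

(** If one ball were null, doubling would make all its dilates by [2 ^+ n] null, and these exhaust
    X. *)
Lemma doubling_nondegenerate : doubling mu -> mu setT != 0%E ->
  exists2 C1 : R, 1 <= C1 & doubling_with C1.
Proof.
move=> [C1 C11 h] mu0; exists C1 => // x r r0.
have [h1 h2] := h x r r0; split => //.
rewrite lt_neqAle measure_ge0 andbT; apply: contra_neq mu0 => mB.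
have mBn n : mu (ball x (2 ^+ n * r)) = 0%E.
  elim: n => [|n IH]; first by rewrite expr0 mul1r.
  apply/eqP; rewrite eq_le measure_ge0 andbT.
  have [] := h x (2 ^+ n * r) _; first by rewrite mulr_gt0 ?exprn_gt0.
  by rewrite IH mule0 mulrA -exprS.
have sub : setT = \bigcup_n ball x (2 ^+ n * r).
  apply/seteqP; split => // y _; exists (Num.truncn (mdist x y / r)).+1 => //.
  apply/in_mball; rewrite -ltr_pdivrMr//; apply: lt_trans (truncnS_gt _) _.
  by rewrite -natrX ltr_nat; exact: ltn_expl.
apply: measure_negligible => //; rewrite sub.
apply: negligible_bigcup => n; apply/negligibleP; last exact: mBn.
exact: measurable_mball.
Qed.

Variable C1 : R.
Hypothesis dbl : doubling_with C1.

Lemma mu_mball x r : 0 < r -> mu (ball x r) = (vol x r)%:E.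
Proof. by move=> r0; have [? ? _] := dbl x r0; rewrite fineK// ge0_fin_numE. Qed.

Lemma vol_gt0 x r : 0 < r -> 0 < vol x r.
Proof. by move=> r0; have [? ? _] := dbl x r0; rewrite fine_gt0//; apply/andP. Qed.

Lemma doubling_with_ge1 : 1 <= C1.
Proof.
have := vol_gt0 point (ltr01 : 0 < 1 :> R); move=> v0.
rewrite -(ler_pM2r v0) mul1r -lee_fin EFinM -mu_mball//.
have [_ _] := dbl point (ltr01 : 0 < 1 :> R); apply: le_trans.
apply: le_measure; rewrite ?inE; try exact: measurable_mball.
by apply: mball_subset; rewrite mdistxx; lra.
Qed.

Lemma vol_dbl x r n : 0 < r -> vol x (2 ^+ n * r) <= C1 ^+ n * vol x r.
Proof.
move=> r0; elim: n => [|n IH]; first by rewrite !expr0 !mul1r.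
have r0' : 0 < 2 ^+ n * r by rewrite mulr_gt0// exprn_gt0.
have [_ _] := dbl x r0'; rewrite mulrA -exprS !mu_mball//; last first.
  by rewrite mulr_gt0// exprn_gt0.
rewrite -EFinM lee_fin => /le_trans; apply.
rewrite exprS -mulrA ler_wpM2l//.
by apply: le_trans doubling_with_ge1.
Qed.

Lemma le_vol x y r r' n : 0 < r -> 0 < r' ->
  mdist y x + r <= 2 ^+ n * r' -> vol x r <= C1 ^+ n * vol y r'.
Proof.
move=> r0 r0' h; apply: le_trans (vol_dbl y n r0').
rewrite -lee_fin -!mu_mball//; last by rewrite mulr_gt0// exprn_gt0.
apply: le_measure; rewrite ?inE; try exact: measurable_mball.
exact: mball_subset.
Qed.

Lemma doubling_sigma_finite : sigma_finite setT mu.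
Proof.
exists (fun n => ball point n.+1%:R); first by rewrite mball_bigcup.
by move=> n; split; [exact: measurable_mball|have [] := dbl point (ltr0Sn R n)].
Qed.

(** Sorted by distance to a base point and by a lower bound on the volume, the centres fall into
    countably many classes. Each class is finite, because its disjoint balls lie in one ball of
    finite measure. *)
Lemma mball_packing_countable r (E : set X) : 0 < r ->
  trivIset E (fun x => ball x r) -> countable E.
Proof.
move=> r0 tE.
pose F (nk : nat * nat) := E `&` [set x | mdist point x < nk.1%:R /\
  nk.2.+1%:R^-1 <= vol x r].
have -> : E = \bigcup_nk F nk.
  apply/seteqP; split => [x Ex|x [nk _ []]//].
  exists ((Num.truncn (mdist point x)).+1, Num.truncn (vol x r)^-1) => //.
  split => //=; split; first exact: truncnS_gt.
  have v0 := vol_gt0 x r0.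
  by rewrite -[leRHS]invrK lef_pV2 ?posrE ?invr_gt0// ltW// truncnS_gt.
apply: bigcup_countable => // -[n k] _; apply: finite_set_countable.
have n0 : 0 < n%:R + r by have := ler0n R n; lra.
apply: (@trivIset_mass_finite _ _ _ mu _ _ (fun x => ball x r)
  (ball point (n%:R + r)) k.+1%:R^-1) => //.
- by move=> i; exact: measurable_mball.
- exact: measurable_mball.
- by have [] := dbl point n0.
- by apply: sub_trivIset tE => x [].
- move=> x [_ /= [xn xk]]; split; last by rewrite mu_mball// lee_fin.
  by apply: mball_subset; lra.
Qed.

(** For each radius [r n] a maximal disjoint family of balls is countable, and maximality puts every
    point within [2 * r n] of one of its centres. *)
Lemma doubling_separable : exists s : nat -> X, dense_seq s.
Proof.
pose r n : R := n.+1%:R^-1.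
have r0 n : 0 < r n by rewrite invr_gt0.
pose E n := sval (ex_maximal_disjoint_subcollection (fun x => ball x (r n)) setT).
have hE n : maximal_disjoint_subcollection (fun x => ball x (r n)) (E n) setT.
  exact: svalP (ex_maximal_disjoint_subcollection (fun x => ball x (r n)) setT).
have cE : countable (\bigcup_n E n).
  apply: bigcup_countable => // n _; have [_ tE _] := hE n.
  exact: mball_packing_countable tE.
have near_E n x : exists2 y, E n y & mdist x y < 2 * r n.
  have [_ tE maxE] := hE n; apply: contrapT => h.
  have h' y : E n y -> 2 * r n <= mdist x y.
    by move=> Ey; rewrite leNgt; apply/negP => xy; apply: h; exists y.
  have Ex : ~ E n x by move=> /h'; rewrite mdistxx; have := r0 n; lra.
  have xE : E n `<` (E n `|` [set x]).
    split; first by left.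
    by move=> /(_ x) h2; apply: Ex; apply: h2; right.
  apply: (maxE (E n `|` [set x])) => //.
  have disj y : E n y -> ball y (r n) `&` ball x (r n) !=set0 -> y = x.
    move=> Ey [z [/in_mball yz /in_mball xz]]; have := h' y Ey.
    have := metric_triangle x z y; rewrite (metric_sym z y) => tri hy.
    by exfalso; move: xz yz tri hy; clear; lra.
  move=> i j [Ei|->] [Ej|->] //; first exact: tE.
    exact: disj.
  by rewrite setIC => /(disj _ Ej).
have /pcard_surjP[f fs] := cE; exists f => x e e0.
have [n nE] : exists n, 2 * r n < e.
  exists (Num.truncn (2 / e)).
  by rewrite /r ltr_pdivrMr// mulrC -ltr_pdivrMr// truncnS_gt.
have [y Ey xy] := near_E n x.
have [|i _ fi] := fs y; first by exists n.
by exists i; rewrite fi; lra.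
Qed.

End Doubling.

(** * Muckenhoupt weights *)

Section IntegralPositivity.
Context {R : realType} {d : measure_display} {T : measurableType d}.
Variable m : {measure set T -> \bar R}.
Local Open Scope ereal_scope.

Lemma integral_gt0 (D : set T) (f : T -> \bar R) : measurable D ->
  measurable_fun D f -> (forall x, D x -> 0 < f x) -> 0 < m D ->
  0 < \int[m]_(x in D) f x.
Proof.
move=> mD mf f0 mD0.
have f0' x : D x -> 0 <= f x by move=> /f0/ltW.
rewrite lt_neqAle integral_ge0// andbT eq_sym; apply/eqP => int0.
suff D0 : m D = 0 by rewrite D0 ltxx in mD0.
have : ae_eq m D f (cst 0).
  apply/ae_eq_integral_abs => //; rewrite -int0; apply: eq_integral => x.
  by rewrite inE => Dx; rewrite gee0_abs// f0'.
move=> fD; apply: measure_negligible => //; apply: negligibleS fD => x Dx /=.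
by move=> /(_ Dx) fx0; have := f0 x Dx; rewrite fx0 ltxx.
Qed.

(** Through this, the finite Muckenhoupt supremum also yields that the averages of the weight and of
    its dual power are finite. *)
Lemma mule_gt0_fin (a b : \bar R) (K : R) : 0 < a -> 0 < b ->
  a * b <= K%:E -> a \is a fin_num /\ b \is a fin_num.
Proof.
case: a => [a| |]//; case: b => [b| |]// a0 b0 //.
- by rewrite gt0_muley.
- by rewrite gt0_mulye.
Qed.

End IntegralPositivity.

Section Muckenhoupt.
Context {R : realType} {d : measure_display} {X : metricMeasurableType R d}.
Variable mu : {measure set X -> \bar R}.
Variable phi : X -> R -> R.
Variable C1 : R.
Hypothesis open_meas : forall U : set X, open U -> measurable U.
Hypothesis dbl : doubling_with mu C1.
Hypothesis phi_gt0 : forall x t, 0 < t -> 0 < phi x t.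
Hypothesis phi_meas : forall t, 0 <= t -> measurable_fun setT (fun x => phi x t).

Let mball x r : measurable (ball x r) := measurable_mball open_meas x r.

Let avg_mball x r (g : X -> \bar R) : 0 < r ->
  avg mu (ball x r) g = ((vol mu x r)^-1%:E * \int[mu]_(y in ball x r) g y)%E.
Proof.
move=> r0; rewrite /avg (mu_mball dbl)// inver gt_eqF//.
exact: (vol_gt0 dbl).
Qed.

Let avg_gt0 x r (g : X -> R) : 0 < r -> measurable_fun setT g ->
  (forall y, 0 < g y) -> (0 < avg mu (ball x r) (EFin \o g))%E.
Proof.
move=> r0 mg g0; rewrite avg_mball//.
rewrite mule_gt0 ?lte_fin ?invr_gt0 ?(vol_gt0 dbl)//.
apply: integral_gt0 => //.
- by apply/measurable_EFinP; exact: measurable_funTS.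
- by move=> y _; rewrite /= lte_fin.
- by rewrite (mu_mball dbl)// lte_fin (vol_gt0 dbl).
Qed.

(* Chebyshev-type split at height [th]: [1 <= a / th + a^(-p) th^p]. *)
Let le1_split (a th p : R) : 0 < a -> 0 < th -> 0 < p ->
  1 <= th^-1 * a + th `^ p * a `^ (- p).
Proof.
move=> a0 th0 p0; have [tha|/ltW ath] := leP th a.
  apply: (@le_trans _ _ (th^-1 * a)).
    by rewrite mulrC ler_pdivlMr// mul1r.
  by rewrite lerDl mulr_ge0 ?powR_ge0.
apply: (@le_trans _ _ (th `^ p * a `^ (- p))).
  rewrite powRN ler_pdivlMr ?powR_gt0// mul1r.
  by apply: ge0_ler_powR; rewrite ?nnegrE; lra.
by rewrite lerDr mulr_ge0 ?invr_ge0; lra.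
Qed.

(** Integrating [le1_split] over [E] replaces Hölder's inequality: [mu E] is at most [th^-1] times
    the weight of [E] plus a multiple of the dual weight. For a suitable height [th] the second part
    is absorbed, and the A_q condition compares [th] with the average of the weight. *)
Lemma muckenhoupt_comparable_gt1 q (c : R) : 1 < q -> 0 < c ->
  muckenhoupt mu phi q -> exists2 K : R, 0 < K & forall (t : R) (x : X) (r : R) (E : set X),
  0 < t -> 0 < r -> measurable E -> E `<=` ball x r ->
  (c%:E * mu (ball x r) <= mu E)%E ->
  (phi_int mu phi (ball x r) t <= K%:E * phi_int mu phi E t)%E.
Proof.
move=> q1 c0; rewrite /muckenhoupt /=; set q' := q / (q - 1) => supfin.
have [K0 K0p supK] : exists2 K : R, 0 < K & forall (x : X) (r t : R), 0 < r -> 0 < t ->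
    (avg mu (ball x r) (fun x => (phi x t)%:E) *
      (avg mu (ball x r) (fun y => (phi y t `^ (1 - q'))%:E)) `^ (q - 1)
     <= K%:E)%E.
  move: supfin; set S := ereal_sup _ => Sfin.
  exists (Num.max 1 (fine S)); first by rewrite lt_max ltr01.
  move=> x r t r0 t0; apply: (@le_trans _ _ S).
    apply: ereal_sup_ubound; exists (ball x r, t) => //; split => //=.
    by exists x, r.
  move: Sfin; case: S => [s _|//|]; last by rewrite leNye.
  by rewrite lee_fin le_max lexx orbT.
have q10 : 0 < q - 1 by lra.
have q'E : 1 - q' = - (q - 1)^-1.
  by rewrite /q'; field; lra.
pose p := (q - 1)^-1; have p0 : 0 < p by rewrite invr_gt0.
pose K := K0 * (c / 2) `^ (- (q - 1)) * (2 / c).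
have K_gt0 : 0 < K by rewrite !mulr_gt0 ?powR_gt0 ?invr_gt0 ?mulr_gt0 ?invr_gt0.
exists K => // t x r E t0 r0 mE Esub cE.
have mphi := phi_meas (ltW t0).
pose w y := phi y t; pose v y := w y `^ (- p).
have w0 y : 0 < w y by exact: phi_gt0.
have v0 y : 0 < v y by exact: powR_gt0.
have mv : measurable_fun setT v.
  by apply: (measurableT_comp (measurable_powR _)).
have := supK x r t r0 t0; rewrite q'E.
rewrite -/(EFin \o w) -/(EFin \o v).
set W := avg mu _ _; set J := avg mu _ _ => WJ.
have W0 : (0 < W)%E by apply: avg_gt0.
have J0 : (0 < J)%E by apply: avg_gt0.
have J0' := poweR_gt0 (q - 1) J0.
have [Wfin Jfin'] := mule_gt0_fin W0 J0' WJ.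
have Jfin : J \is a fin_num.
  rewrite ge0_fin_numE ?ltW// ltNge leye_eq; apply/negP => /eqP Joo.
  by move: Jfin'; rewrite Joo poweRyr// gt_eqF.
pose a := fine W; pose j := fine J.
have a0 : 0 < a by rewrite fine_gt0// W0 ltey_eq Wfin.
have j0 : 0 < j by rewrite fine_gt0// J0 ltey_eq Jfin.
have aj : a * j `^ (q - 1) <= K0.
  by rewrite -lee_fin EFinM -poweR_EFin !fineK.
pose V := vol mu x r; have V0 : 0 < V by exact: (vol_gt0 dbl).
have muB : mu (ball x r) = V%:E by exact: (mu_mball dbl).
have WE : (\int[mu]_(y in ball x r) (w y)%:E = (V * a)%:E)%E.
  rewrite EFinM (fineK Wfin) /W avg_mball// muleA -EFinM divff ?mul1e//.
  by rewrite gt_eqF.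
have JE : (\int[mu]_(y in ball x r) (v y)%:E = (V * j)%:E)%E.
  rewrite EFinM (fineK Jfin) /J avg_mball// muleA -EFinM divff ?mul1e//.
  by rewrite gt_eqF.
(* The height is chosen so that the dual term is at most [c / 2] times the volume of the ball, half
   of the lower bound assumed for [mu E]. *)
pose th := (c / (2 * j)) `^ (q - 1).
have th0 : 0 < th by rewrite powR_gt0// divr_gt0// mulr_gt0.
have thp : th `^ p * j = c / 2.
  rewrite /th -powRrM divff ?gt_eqF// powRr1; last by rewrite divr_ge0 ?mulr_ge0 ?ltW.
  by field; rewrite gt_eqF.
have mwE : measurable_fun E (EFin \o w).
  by apply/measurable_EFinP; exact: measurable_funTS.
have mvE : measurable_fun E (EFin \o v).
  by apply/measurable_EFinP; exact: measurable_funTS.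
have muE : (mu E <= th^-1%:E * \int[mu]_(y in E) (w y)%:E +
    (th `^ p)%:E * \int[mu]_(y in E) (v y)%:E)%E.
  rewrite -[mu E]mul1e -integral_cst//.
  rewrite -!ge0_integralZl_EFin ?invr_ge0 ?powR_ge0 ?(ltW th0)//; last 2 first.
  - by move=> y _; rewrite lee_fin ltW.
  - by move=> y _; rewrite lee_fin ltW.
  rewrite -ge0_integralD//; last 4 first.
  - by move=> y _; rewrite mule_ge0// lee_fin ?invr_ge0 ltW.
  - by apply: measurable_funeM.
  - by move=> y _; rewrite mule_ge0// lee_fin ?powR_ge0 ?ltW.
  - by apply: measurable_funeM.
  apply: le_integral_nonneg => y _ //=.
  by rewrite -!EFinM -EFinD lee_fin le1_split.
have vE : (\int[mu]_(y in E) (v y)%:E <= (V * j)%:E)%E.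
  rewrite -JE; apply: ge0_subset_integral => //.
    by apply/measurable_EFinP; exact: measurable_funTS.
  by move=> y _; rewrite lee_fin ltW.
rewrite /phi_int WE.
have : (0 <= \int[mu]_(y in E) (w y)%:E)%E.
  by apply: integral_ge0 => y _; rewrite lee_fin ltW.
rewrite -[X in (_ <= _ * X)%E]/(\int[mu]_(y in E) (w y)%:E)%E.
move: muE vE; set I1 := (\int[mu]_(y in E) (w y)%:E)%E.
set I2 := (\int[mu]_(y in E) (v y)%:E)%E => muE vE.
have := lee_wpmul2l (_ : 0 <= (th `^ p)%:E)%E vE; rewrite lee_fin powR_ge0.
move=> /(_ isT); rewrite -EFinM mulrCA thp => vE'.
have := le_trans cE (le_trans muE (leeD2l _ vE')); rewrite muB -EFinM.
case: I1 {muE} => [i| |//]; last by move=> _ _; rewrite gt0_muley ?lte_fin// leey.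
rewrite -!EFinM -EFinD !lee_fin => h _.
have hi : th * (c / 2) * V <= i.
  have : V * (c / 2) <= th^-1 * i by lra.
  by rewrite [th^-1 * _]mulrC ler_pdivlMr//; lra.
have thE : th = (c / 2) `^ (q - 1) * j `^ (- (q - 1)).
  rewrite /th -(mulN1r (q - 1)) powRrM powR_inv1 ?ltW//.
  rewrite -powRM ?invr_ge0 ?divr_ge0 ?ltW//; congr (_ `^ _).
  by field; rewrite gt_eqF.
have ha : a <= K0 * j `^ (- (q - 1)).
  by rewrite powRN ler_pdivlMr// powR_gt0.
apply: (@le_trans _ _ (K * (th * (c / 2) * V))); last by rewrite ler_pM2l.
have -> : K * (th * (c / 2) * V) = V * (K0 * j `^ (- (q - 1))).
  rewrite /K thE [(c / 2) `^ (- _)]powRN; field.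
  by rewrite gt_eqF// gt_eqF// powR_gt0// divr_gt0.
by rewrite ler_pM2l.
Qed.

(** Almost everywhere on the ball the reciprocal of the weight is at most its essential supremum, so
    [mu E] is at most that supremum times the weight of [E]. *)
Lemma muckenhoupt1_comparable (c : R) : 0 < c ->
  muckenhoupt1 mu phi -> exists2 K : R, 0 < K & forall (t : R) (x : X) (r : R) (E : set X),
  0 < t -> 0 < r -> measurable E -> E `<=` ball x r ->
  (c%:E * mu (ball x r) <= mu E)%E ->
  (phi_int mu phi (ball x r) t <= K%:E * phi_int mu phi E t)%E.
Proof.
move=> c0; rewrite /muckenhoupt1 /= => supfin.
have [K0 K0p supK] : exists2 K : R, 0 < K & forall (x : X) (r t : R), 0 < r -> 0 < t ->
    (avg mu (ball x r) (fun x => (phi x t)%:E) *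
      ess_sup mu ((fun y => ((phi y t)^-1)%:E) \_ (ball x r))
     <= K%:E)%E.
  move: supfin; set S := ereal_sup _ => Sfin.
  exists (Num.max 1 (fine S)); first by rewrite lt_max ltr01.
  move=> x r t r0 t0; apply: (@le_trans _ _ S).
    apply: ereal_sup_ubound; exists (ball x r, t) => //; split => //=.
    by exists x, r.
  move: Sfin; case: S => [s _|//|]; last by rewrite leNye.
  by rewrite lee_fin le_max lexx orbT.
exists (K0 / c); first by rewrite divr_gt0.
move=> t x r E t0 r0 mE Esub cE.
have mphi := phi_meas (ltW t0).
pose w y := phi y t.
have w0 y : 0 < w y by exact: phi_gt0.
have := supK x r t r0 t0; rewrite -/(EFin \o w).
set W := avg mu _ _; set S := ess_sup _ _ => WS.
have W0 : (0 < W)%E by apply: avg_gt0.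
pose V := vol mu x r; have V0 : 0 < V by exact: (vol_gt0 dbl).
have muB : mu (ball x r) = V%:E by exact: (mu_mball dbl).
have Sae : {ae mu, forall y, ball x r y -> ((w y)^-1%:E <= S)%E}.
  have := ess_sup_ge mu ((fun y => ((phi y t)^-1)%:E) \_ (ball x r)).
  apply: filterS => y; rewrite patchE; case: ifPn => [_ //|/negP h _ By].
  by exfalso; apply: h; exact: mem_set.
have S0 : (0 < S)%E.
  rewrite ltNge; apply/negP => S0.
  have : mu (ball x r) = 0%E.
    apply: measure_negligible => //; apply: negligibleS Sae => y By /=.
    move=> /(_ By) /le_trans/(_ S0); rewrite lee_fin leNgt invr_gt0.
    by rewrite w0.
  by rewrite muB => -[] V00; rewrite V00 ltxx in V0.
have [Wfin Sfin] := mule_gt0_fin W0 S0 WS.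
pose a := fine W; pose s := fine S.
have s0 : 0 < s by rewrite fine_gt0// S0 ltey_eq Sfin.
have aj : a * s <= K0.
  by rewrite -lee_fin EFinM !fineK.
have WE : (\int[mu]_(y in ball x r) (w y)%:E = (V * a)%:E)%E.
  rewrite EFinM (fineK Wfin) /W avg_mball// muleA -EFinM divff ?mul1e//.
  by rewrite gt_eqF.
have mwE : measurable_fun E (EFin \o w).
  by apply/measurable_EFinP; exact: measurable_funTS.
have muE : (mu E <= s%:E * \int[mu]_(y in E) (w y)%:E)%E.
  rewrite -[mu E]mul1e -integral_cst// -ge0_integralZl_EFin//; last 2 first.
  - by move=> y _; rewrite lee_fin ltW.
  - by rewrite ltW.
  apply: ae_ge0_le_integral => //.
  - by move=> y _; rewrite mule_ge0// lee_fin ltW.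
  - exact: measurable_funeM.
  apply: filterS Sae => y + /Esub By => /(_ By).
  rewrite -(fineK Sfin) -/s !lee_fin => h.
  by rewrite -ler_pdivrMr// div1r.
rewrite /phi_int WE.
rewrite -[X in (_ <= _ * X)%E]/(\int[mu]_(y in E) (w y)%:E)%E.
have := le_trans cE muE; rewrite muB.
have : (0 <= \int[mu]_(y in E) (w y)%:E)%E.
  by apply: integral_ge0 => y _; rewrite lee_fin ltW.
case: (integral _ _ _) => [i| |//]; last first.
  by move=> _ _; rewrite gt0_muley ?leey// lte_fin divr_gt0.
rewrite -!EFinM !lee_fin => _ h.
have ha : a <= K0 / s by rewrite ler_pdivlMr.
apply: (@le_trans _ _ (V * (K0 / s))); first by rewrite ler_pM2l.
have -> : V * (K0 / s) = K0 / c * (c * V / s) by field; rewrite !gt_eqF.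
rewrite ler_pM2l ?divr_gt0// ler_pdivrMr// mulrC; lra.
Qed.

(** All later uses of the Muckenhoupt condition go through this comparison; its constant depends on
    [c] but not on [t] or on the ball. *)
Lemma muckenhoupt_comparable (c : R) : 0 < c ->
  muckenhoupt_infty mu phi -> exists2 K : R, 0 < K & forall (t : R) (x : X) (r : R) (E : set X),
  0 < t -> 0 < r -> measurable E -> E `<=` ball x r ->
  (c%:E * mu (ball x r) <= mu E)%E ->
  (phi_int mu phi (ball x r) t <= K%:E * phi_int mu phi E t)%E.
Proof.
move=> c0 [|[q q1]]; first exact: muckenhoupt1_comparable.
exact: muckenhoupt_comparable_gt1.
Qed.

End Muckenhoupt.

(** * Vitali coverings and the maximal function for one weight *)

Section Weights.
Context {R : realType} {d : measure_display} {X : metricMeasurableType R d}.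
Variable mu : {measure set X -> \bar R}.
Variable C1 : R.
Hypothesis open_meas : forall U : set X, open U -> measurable U.
Hypothesis dbl : doubling_with mu C1.
Variable w : X -> R.
Hypothesis w_ge0 : forall x, 0 <= w x.
Hypothesis w_meas : measurable_fun setT w.

Definition wint (E : set X) : \bar R := \int[mu]_(x in E) (w x)%:E.

(** The A_infinity property at one density [c]. It is applied to the weights [phi ^~ t], with the
    same [K] for all [t > 0]. *)
Definition Ainf_cond (c K : R) :=
  forall (x : X) (r : R) (E : set X), 0 < r -> measurable E ->
  E `<=` ball x r -> (c%:E * mu (ball x r) <= mu E)%E ->
  (wint (ball x r) <= K%:E * wint E)%E.

Let mw E : measurable_fun E (fun x => (w x)%:E).
Proof. by apply/measurable_EFinP; exact: measurable_funTS. Qed.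

Let w0 (E : set X) x : E x -> (0 <= (w x)%:E)%E.
Proof. by rewrite lee_fin. Qed.

Lemma wint_ge0 E : (0 <= wint E)%E.
Proof. by apply: integral_ge0 => x _; rewrite lee_fin. Qed.

Lemma le_wint E F : measurable E -> measurable F -> E `<=` F ->
  (wint E <= wint F)%E.
Proof. by move=> mE mF EF; apply: ge0_subset_integral => //; exact: w0. Qed.

Lemma wintU_disj E F : measurable E -> measurable F -> E `&` F = set0 ->
  wint (E `|` F) = (wint E + wint F)%E.
Proof.
move=> mE mF EF; apply: ge0_integral_setU => //; first exact: w0.
by apply/disj_set2P.
Qed.

Lemma wintU_le E F : measurable E -> measurable F ->
  (wint (E `|` F) <= wint E + wint F)%E.
Proof.
move=> mE mF; have -> : E `|` F = E `|` (F `\` E) by rewrite setUDr setDv setD0.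
rewrite wintU_disj//; last 2 first.
- exact: measurableD.
- by rewrite setDIK.
by apply: leeD => //; apply: le_wint => //; exact: measurableD.
Qed.

Definition balls_cover (L : seq (X * R)) : set X :=
  [set x | exists2 b : X * R, b \in L & ball b.1 b.2 x].

Lemma balls_cover_meas L : measurable (balls_cover L).
Proof.
apply: open_meas; apply: openP_mball => x [b bL /in_mball bx].
exists (b.2 - mdist b.1 x); first by rewrite subr_gt0.
by move=> y xy; exists b => //; apply: mball_subset xy; lra.
Qed.

(** Greedy selection: the balls meeting a largest ball [b] lie in its triple and are dropped, [b]
    itself among them, so the list shrinks. The remaining balls are disjoint from [b], hence the
    weights inside [P] add up. *)
Lemma finite_vitali (P : set X) (K : R) (L : seq (X * R)) :
  measurable P -> 0 <= K ->
  (forall b : X * R, b \in L -> 0 < b.2 /\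
     (wint (ball b.1 (3 * b.2)) <= K%:E * wint (ball b.1 b.2 `&` P))%E) ->
  (wint (balls_cover L) <= K%:E * wint (balls_cover L `&` P))%E.
Proof.
move=> mP K0; have [n] := ubnP (size L); elim: n L => // n IH L Ln goodL.
have mballP (x : X) (r : R) : measurable (ball x r) by exact: measurable_mball.
have mcov := balls_cover_meas.
have [->|[b bL bmax]] : L = [::] \/
    exists2 b : X * R, b \in L & forall b' : X * R, b' \in L -> b'.2 <= b.2.
  case: L {Ln goodL} => [|b0 L]; [by left|right].
  elim: L => [|b1 L [b bL bmax]].
    by exists b0; rewrite ?mem_head// => b'; rewrite inE => /eqP ->.
  have [b1b|/ltW bb1] := leP b1.2 b.2.
    exists b => [|b']; first by move: bL; rewrite !inE => /orP[->//|->]; rewrite !orbT.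
    rewrite !inE => /or3P[b'0|/eqP->//|b'L]; apply: bmax.
      by rewrite inE b'0.
    by rewrite inE b'L orbT.
  exists b1 => [|b']; first by rewrite !inE eqxx orbT.
  rewrite !inE => /or3P[b'0|/eqP->//|b'L]; apply: le_trans bb1; apply: bmax.
    by rewrite inE b'0.
  by rewrite inE b'L orbT.
- have -> : balls_cover [::] = set0 by rewrite -subset0 => x [].
  by rewrite /wint set0I !integral_set0 mule0.
have [b0 bgood] := goodL b bL.
pose away b' := `[< ball b'.1 b'.2 `&` ball b.1 b.2 = set0 >].
pose L' := [seq b' <- L | away b'].
have L'n : (size L' < n)%N.
  apply: leq_trans (_ : size L <= n)%N; last by rewrite -ltnS.
  rewrite size_filter -(count_predC away L) -addn1 leq_add2l -has_count.
  apply/hasP; exists b => //=; apply/asboolPn => bb.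
  have : (ball b.1 b.2 `&` ball b.1 b.2) b.1 by split; exact: mball_center.
  by rewrite bb.
have IH' : (wint (balls_cover L') <= K%:E * wint (balls_cover L' `&` P))%E.
  by apply: IH => // b'; rewrite mem_filter => /andP[_]; exact: goodL.
have sub : balls_cover L `<=` ball b.1 (3 * b.2) `|` balls_cover L'.
  move=> x [b' b'L b'x]; have [ab|] := boolP (away b').
    by right; exists b' => //; rewrite mem_filter ab.
  move=> /asboolPn/eqP/set0P[y [/in_mball b'y /in_mball bby]]; left.
  move: b'x => /in_mball b'x; apply/in_mball.
  have b'b := bmax _ b'L.
  have h1 := metric_triangle b.1 y x; have h2 := metric_triangle y b'.1 x.
  by rewrite (metric_sym y b'.1) in h2; lra.
have disj : (ball b.1 b.2 `&` P) `&` (balls_cover L' `&` P) = set0.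
  rewrite -subset0 => x [[bx _] [[b']]].
  rewrite mem_filter => /andP[/asboolP ab _] b'x _.
  by rewrite -ab.
apply: le_trans (le_wint _ _ sub) _ => //; first exact: measurableU.
apply: le_trans (wintU_le _ _) _ => //.
apply: le_trans (leeD bgood IH') _.
rewrite -ge0_muleDr ?wint_ge0// -wintU_disj//; try exact: measurableI.
apply: lee_wpmul2l; first by rewrite lee_fin.
apply: le_wint; [apply: measurableU; exact: measurableI|exact: measurableI|].
move=> x [[bx Px]|[[b' b'L b'x] Px]]; split => //; first by exists b.
by exists b' => //; move: b'L; rewrite mem_filter => /andP[].
Qed.

(** Every finite subfamily has a largest ball, so the radii may be unbounded; the whole union is
    reached by monotone convergence. *)
Lemma countable_vitali (P : set X) (K : R) (b : nat -> X * R) (G : set nat) :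
  measurable P -> 0 <= K ->
  (forall n, G n -> 0 < (b n).2 /\
     (wint (ball (b n).1 (3 * (b n).2)) <=
      K%:E * wint (ball (b n).1 (b n).2 `&` P))%E) ->
  (wint (\bigcup_(n in G) ball (b n).1 (b n).2) <= K%:E * wint P)%E.
Proof.
move=> mP K0 good.
pose L N := [seq b n | n <- [seq n <- iota 0 N | `[< G n >]]].
have inL N b' : b' \in L N <-> exists n, [/\ (n < N)%N, G n & b' = b n].
  split=> [/mapP[n]|[n [nN Gn ->]]].
    rewrite mem_filter mem_iota add0n => /andP[/asboolP Gn /= nN] ->.
    by exists n.
  apply/mapP; exists n => //; rewrite mem_filter mem_iota/= add0n nN andbT.
  exact/asboolP.
have -> : \bigcup_(n in G) ball (b n).1 (b n).2 = \bigcup_N balls_cover (L N).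
  apply/seteqP; split => [x [n Gn bx]|x [N _ [b' /inL[n [nN Gn ->]] bx]]].
    by exists n.+1 => //; exists (b n) => //; apply/inL; exists n.
  by exists n.
have ndL : nondecreasing_seq (fun N => balls_cover (L N)).
  move=> m n mn; apply/subsetPset => x [b' /inL[k [km Gk b'k]] b'x].
  by exists b' => //; apply/inL; exists k; split => //; exact: leq_trans mn.
have cvgL := @ge0_nondecreasing_set_cvg_integral _ _ _ _
   (fun x => (w x)%:E) mu ndL (fun N => balls_cover_meas (L N)) (fun N => @mw _)
   (fun N => @w0 _).
rewrite /wint -(cvg_lim _ cvgL)//.
apply: lime_le; first by apply/cvg_ex; eexists; exact: cvgL.
apply: nearW => N; apply: le_trans (finite_vitali mP K0 _) _.
  by move=> b' /inL[n [_ Gn ->]]; exact: good.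
apply: lee_wpmul2l; first by rewrite lee_fin.
apply: le_wint => //; first by apply: measurableI => //; exact: balls_cover_meas.
Qed.

(* The set where the maximal function of [\1_P] over the balls [b n] exceeds [c]. *)
Definition dense_balls (c : R) (b : nat -> X * R) (P : set X) : set X :=
  \bigcup_(n in [set n | 0 < (b n).2 /\ (c%:E * mu (ball (b n).1 (b n).2) <
      mu (ball (b n).1 (b n).2 `&` P))%E]) ball (b n).1 (b n).2.

Lemma dense_balls_meas c b P : measurable (dense_balls c b P).
Proof.
by apply: bigcup_measurable => n _; exact: measurable_mball.
Qed.

(** Tripling a radius costs two doublings. The part of a selected ball inside [P] thus fills at
    least the fraction [c / C1 ^+ 2] of the triple, which is what the Vitali lemma asks for. *)
Lemma wint_dense_balls (c K : R) b P : 0 < c -> 0 <= K -> measurable P ->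
  Ainf_cond (c / C1 ^+ 2) K ->
  (wint (dense_balls c b P) <= K%:E * wint P)%E.
Proof.
move=> c0 K0 mP Aw; apply: countable_vitali => // n [bn0 bn]; split => //.
have b3 : 0 < 3 * (b n).2 by rewrite mulr_gt0.
have C10 : 0 < C1 by apply: lt_le_trans (doubling_with_ge1 open_meas dbl).
apply: Aw => //; first by apply: measurableI => //; exact: measurable_mball.
  apply: subset_trans (@subIsetl _ _ _) _; apply: mball_subset.
  by rewrite mdistxx; lra.
apply: le_trans (ltW bn); rewrite !(mu_mball dbl)// -!EFinM lee_fin.
rewrite -mulrA ler_pM2l// ler_pdivrMl ?exprn_gt0//.
by apply: (le_vol open_meas dbl); rewrite ?mdistxx// !expr2; lra.
Qed.

End Weights.

(** * Cones and the area integral *)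

Section Cones.
Context {R : realType} {d : measure_display} {X : metricMeasurableType R d}.
Variable mu : {sigma_finite_measure set X -> \bar R}.
Variable C1 : R.
Hypothesis open_meas : forall U : set X, open U -> measurable U.
Hypothesis dbl : doubling_with mu C1.
Variable s : nat -> X.
Hypothesis s_dense : dense_seq s.

Definition wide_cone (a : R) (x : X) : set (X * R) :=
  [set z | 0 < z.2 /\ mdist x z.1 < a * z.2].

Lemma cone_wide_cone x : cone x = wide_cone 1 x.
Proof. by apply/seteqP; split => z; rewrite /cone /wide_cone/= mul1r. Qed.

(** The sigma-algebra on [X * R] is the product one, so an open set is shown measurable as a
    countable union of boxes with centres in the dense sequence and rational heights. *)
Lemma measurable_box_union (U : set (X * R)) :
  (forall z, U z -> exists2 r, 0 < r & forall z', mdist z.1 z'.1 < r ->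
     `|z'.2 - z.2| < r -> U z') -> measurable U.
Proof.
move=> hU.
pose e (n : nat) : R := n.+1%:R^-1.
pose box (i : nat * nat * rat) : set (X * R) := ball (s i.1.1) (e i.1.2) `*`
  `](ratr i.2 - e i.1.2), (ratr i.2 + e i.1.2)[%classic.
pose F i := if `[< box i `<=` U >] then box i else set0.
have -> : U = \bigcup_i F i.
  apply/seteqP; split=> [z Uz|z [i _]]; last first.
    by rewrite /F; case: asboolP => // h /h.
  have [r r0 rU] := hU z Uz.
  have [n nr] : exists n, e n < r / 2.
    exists (Num.truncn (2 / r)); rewrite /e.
    by rewrite -[ltRHS]invrK ltf_pV2 ?posrE ?invr_gt0 ?divr_gt0// invf_div truncnS_gt.
  have n0 : 0 < e n by rewrite invr_gt0.
  have [i zi] := s_dense z.1 n0.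
  have [q] : exists q, ratr q \in `](z.2 - e n), (z.2 + e n)[.
    by apply: rat_in_itvoo; lra.
  rewrite in_itv/= => /andP[q1 q2].
  have boxU : box (i, n, q) `<=` U.
    move=> z' [/in_mball /= iz']; rewrite /= in_itv/= => /andP[q1' q2'].
    apply: rU; first by have := metric_triangle z.1 (s i) z'.1; lra.
    by rewrite ltr_norml; apply/andP; split; lra.
  exists (i, n, q) => //; rewrite /F asboolT//.
  split => /=; first by apply/in_mball; rewrite metric_sym.
  by rewrite in_itv/=; apply/andP; split; lra.
apply: countable_bigcupT_measurable; first exact: countableP.
move=> i; rewrite /F; case: ifP => // _; apply: measurableX => //.
exact: measurable_mball.
Qed.

(** The shift leaves room to move the vertex: for [e > 0] this set lies in the cone of aperture [a]
    at every point within [e] of [x]. *)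
Lemma measurable_shifted_cone (a e : R) x :
  measurable [set z : X * R | 0 < z.2 /\ mdist x z.1 + e < a * z.2].
Proof.
apply: measurable_box_union => z [z0 xz].
pose m := a * z.2 - (mdist x z.1 + e); have m0 : 0 < m by rewrite subr_gt0.
have a0 : 0 < 2 * (`|a| + 1) by rewrite mulr_gt0// ltr_wpDl.
exists (Num.min z.2 (Num.min (m / 2) (m / (2 * (`|a| + 1))))).
  by rewrite !lt_min z0 !divr_gt0.
move=> z'; rewrite !lt_min => /and3P[_ h1 _] /and3P[h2 _ h3]; split.
  by move: h2; rewrite ltr_norml => /andP[? ?]; lra.
have tri := metric_triangle x z.1 z'.1.
have : `|a * (z'.2 - z.2)| < m / 2.
  rewrite normrM; apply: (@le_lt_trans _ _ ((`|a| + 1) * `|z'.2 - z.2|)).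
    by rewrite ler_wpM2r//; lra.
  by move: h3; rewrite ltr_pdivlMr//; lra.
rewrite ltr_norml => /andP[h4 _]; rewrite /m in h1 h4; lra.
Qed.

Lemma measurable_wide_cone a x : measurable (wide_cone a x).
Proof.
rewrite (_ : wide_cone a x =
  [set z : X * R | 0 < z.2 /\ mdist x z.1 + 0 < a * z.2]).
  exact: measurable_shifted_cone.
by apply/seteqP; split => z; rewrite /wide_cone/= addr0.
Qed.

Lemma measurable_upper_half : measurable (@upper_half R d X).
Proof.
apply: measurable_box_union => z z0; exists z.2 => // z' _.
by rewrite /upper_half/= ltr_norml => /andP[? ?]; lra.
Qed.

Definition cone_graph (a : R) : set (X * (X * R)) :=
  [set p | wide_cone a p.1 p.2].

(** In each piece the vertex runs through a ball of rational radius, and the shift of the cone pays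
    for that radius. *)
Lemma measurable_cone_graph a : measurable (cone_graph a).
Proof.
pose F (i : nat * rat) : set (X * (X * R)) := ball (s i.1) (ratr i.2) `*`
  [set z : X * R | 0 < z.2 /\ mdist (s i.1) z.1 + ratr i.2 < a * z.2].
have -> : cone_graph a = \bigcup_i F i.
  apply/seteqP; split=> [[x z] [/= z0 xz]|[x z] [i _ [/= /in_mball ix [z0 iz]]]].
    pose m := (a * z.2 - mdist x z.1) / 2.
    have m0 : 0 < m by rewrite divr_gt0// subr_gt0.
    have [i ix] := s_dense x (divr_gt0 m0 (ltr0Sn _ 1)).
    have [q] : exists q, ratr q \in `](m / 2), m[ by apply: rat_in_itvoo; lra.
    rewrite in_itv/= => /andP[q1 q2].
    exists (i, q) => //; split => /=; first by apply/in_mball; rewrite metric_sym; lra.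
    split => //; have := metric_triangle (s i) x z.1; rewrite (metric_sym _ x).
    by rewrite /m in q1 q2 ix *; lra.
  split => //=; have := metric_triangle x (s i.1) z.1; rewrite (metric_sym x (s i.1)).
  lra.
apply: countable_bigcupT_measurable; first exact: countableP.
move=> i; apply: measurableX; last exact: measurable_shifted_cone.
exact: measurable_mball.
Qed.

(** These balls are the sections of the graph of the cones of aperture 1 at fixed [z]; both are
    empty when [z.2 <= 0]. *)
Lemma measurable_mu_ball : measurable_fun setT (fun z : X * R => mu (ball z.1 z.2)).
Proof.
have mA := measurable_fun_ysection mu (measurable_cone_graph 1).
rewrite (_ : (fun z => _) = mu \o ysection (cone_graph 1))//.
apply/funext => z /=; congr (mu _).
apply/seteqP; split => x; rewrite ysectionP /cone_graph/= /wide_cone/= mul1r.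
  move=> /in_mball zx; rewrite metric_sym zx; split => //.
  by apply: le_lt_trans zx; exact: mdist_ge0.
by move=> [_ xz]; apply/in_mball; rewrite metric_sym.
Qed.

End Cones.

(** * Tonelli's theorem with a product as second factor *)

Section ProductOfThree.
Context {R : realType} {d1 d2 d3 : measure_display} {T1 : measurableType d1}
  {T2 : measurableType d2} {T3 : measurableType d3}.
Variables (m1 : {sigma_finite_measure set T1 -> \bar R})
  (m2 : {sigma_finite_measure set T2 -> \bar R})
  (m3 : {sigma_finite_measure set T3 -> \bar R})
  (f : T1 * (T2 * T3) -> \bar R).

Lemma product_sigma_finite : sigma_finite setT (m2 \x m3)%E.
Proof.
have /sigma_finiteP[F [TF ndF Foo]] := sigma_finiteT m2.
have /sigma_finiteP[G [TG ndG Goo]] := sigma_finiteT m3.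
exists (fun n => F n `*` G n) => [|n].
  apply/seteqP; split=> // -[x y] _.
  have : setT x by []; have : setT y by [].
  rewrite TF TG => -[k _ Gky] [n _ Fnx]; exists (maxn n k) => //; split.
    by move: x Fnx; exact/subsetPset/ndF/leq_maxl.
  by move: y Gky; exact/subsetPset/ndG/leq_maxr.
have [? ?] := Foo n; have [? ?] := Goo n; split; first exact: measurableX.
by rewrite product_measure1E// lte_mul_pinfty// ge0_fin_numE.
Qed.

(* The canonical sigma-finite structure on [m2 \x m3] requires [m2] and [m3] to
   be subprobabilities. *)
Let m23 : {sigma_finite_measure set (T2 * T3)%type -> \bar R} :=
  HB.pack (m2 \x m3)%E
    (Measure_isSigmaFinite.Build _ _ _ (m2 \x m3)%E product_sigma_finite).

Hypothesis f_meas : measurable_fun setT f.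
Hypothesis f_ge0 : forall p, (0 <= f p)%E.

Lemma fubini_tonelli_prodr :
  (\int[m1]_x \int[m2 \x m3]_z f (x, z) = \int[m2 \x m3]_z \int[m1]_x f (x, z))%E.
Proof. exact: (@fubini_tonelli _ _ _ _ _ m1 m23 f f_meas f_ge0). Qed.

Lemma measurable_integral_prodr :
  measurable_fun setT (fun x => \int[m2 \x m3]_z f (x, z))%E.
Proof. exact: (@measurable_fun_fubini_tonelli_F _ _ _ _ _ m23 f f_meas f_ge0). Qed.

End ProductOfThree.

(** * The area integral as the mass of a cone *)

Section TentDensity.
Context {R : realType} {d : measure_display} {X : metricMeasurableType R d}.
Variable mu : {sigma_finite_measure set X -> \bar R}.
Variable C1 : R.
Hypothesis open_meas : forall U : set X, open U -> measurable U.
Hypothesis dbl : doubling_with mu C1.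
Variable s : nat -> X.
Hypothesis s_dense : dense_seq s.
Variable f : X * R -> R[i].
Hypothesis f_meas : measurable_upper f.

Local Notation XR := (X * measurableTypeR R)%type.

Lemma sqr_normc (z : R[i]) :
  Normc.normc z ^+ 2 = complex.Re z ^+ 2 + complex.Im z ^+ 2.
Proof. by case: z => a b /=; rewrite sqr_sqrtr// addr_ge0// sqr_ge0. Qed.

(* The density of the area integral, with [vol x t] replaced by the comparable
   [vol y t], which does not depend on the vertex [x] of the cone. *)
Definition tdens (z : X * R) : R :=
  if 0 < z.2 then Normc.normc (f z) ^+ 2 / (vol mu z.1 z.2 * z.2) else 0.

Lemma tdens_ge0 z : 0 <= tdens z.
Proof.
rewrite /tdens; case: ifP => // z0.
by rewrite divr_ge0 ?sqr_ge0// mulr_ge0 ?ltW// (vol_gt0 dbl).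
Qed.

Lemma tdens_meas : measurable_fun setT tdens.
Proof.
have mU := measurable_upper_half open_meas s_dense.
have m2 : measurable_fun setT (fun z : X * R => 0 < z.2).
  by apply: measurable_fun_ltr => //; exact: measurable_snd.
have UE : [set: X * R] `&` (fun z : X * R => 0 < z.2) @^-1` [set true] = upper_half.
  by rewrite setTI; apply/seteqP; split.
apply: measurable_fun_if => //; rewrite UE.
apply: measurable_funM.
  have -> : (fun z => Normc.normc (f z) ^+ 2) =
     (fun z => complex.Re (f z) ^+ 2 + complex.Im (f z) ^+ 2).
    by apply/funext => z; rewrite sqr_normc.
  by apply: measurable_funD; apply: measurable_funX; case: f_meas.
apply: (@eq_measurable_fun _ _ _ _ _ (fun z : X * R =>
   (vol mu z.1 z.2 * z.2) `^ (-1))).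
  move=> z; rewrite inE => z0; rewrite powR_inv1// mulr_ge0 ?ltW//.
  by rewrite (vol_gt0 dbl).
apply: (measurableT_comp (measurable_powR _)).
apply: measurable_funM.
  apply: measurable_funTS.
  apply: (measurableT_comp (@fine_measurable R setT measurableT)).
  exact: (measurable_mu_ball mu open_meas s_dense).
by apply: measurable_funTS; exact: measurable_snd.
Qed.

Let tdens_meas' : measurable_fun [set: XR] tdens.
Proof. exact: tdens_meas. Qed.

Let mtd (D : set XR) : measurable_fun D (EFin \o tdens).
Proof. by apply/measurable_EFinP; apply: measurable_funTS; exact: tdens_meas'. Qed.

Definition tmass (D : set (X * R)) : \bar R :=
  (\int[mu \x lebesgue_measure]_(z in D) (tdens z)%:E)%E.

Lemma tmass_ge0 D : (0 <= tmass D)%E.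
Proof. by apply: integral_ge0 => z _; rewrite lee_fin tdens_ge0. Qed.

Lemma le_tmass (D E : set XR) : measurable D -> measurable E -> D `<=` E ->
  (tmass D <= tmass E)%E.
Proof.
move=> mD mE DE; apply: (ge0_subset_integral _ mD mE _ _ DE); first exact: mtd.
by move=> z _; rewrite lee_fin tdens_ge0.
Qed.

Definition wide_area (a : R) (x : X) : \bar R := tmass (wide_cone a x).

Let cone_kernel (a : R) (u : X -> R) (p : X * XR) : \bar R :=
  (u p.1 * tdens p.2 * \1_(cone_graph a) p)%:E.

Let cone_kernel_meas a (u : X -> R) : measurable_fun setT u ->
  measurable_fun setT (cone_kernel a u).
Proof.
move=> mu_; apply/measurable_EFinP; apply: measurable_funM.
  apply: measurable_funM.
    by apply: (measurableT_comp mu_); exact: measurable_fst.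
  by apply: (measurableT_comp tdens_meas'); exact: measurable_snd.
exact: measurable_indic (measurable_cone_graph open_meas s_dense _).
Qed.

Let cone_kernelE a (u : X -> R) x : 0 <= u x ->
  (\int[mu \x lebesgue_measure]_z cone_kernel a u (x, z) =
   (u x)%:E * wide_area a x)%E.
Proof.
move=> u0.
have mW : @measurable _ XR (wide_cone a x).
  exact: (measurable_wide_cone open_meas s_dense).
rewrite /wide_area /tmass -(ge0_integralZl_EFin _ mW _ (@mtd _) u0); last first.
  by move=> z _; rewrite lee_fin tdens_ge0.
rewrite [RHS]integral_mkcond; apply: eq_integral => z _.
rewrite patchE /cone_kernel/= indicE.
have -> : ((x, z) \in cone_graph a) = (z \in wide_cone a x).
  by apply/idP/idP; rewrite !inE.
by case: (z \in wide_cone a x); rewrite ?mulr1 ?mulr0 ?EFinM.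
Qed.

Lemma wide_area_meas a : measurable_fun setT (wide_area a).
Proof.
have k0 p : (0 <= cone_kernel a (cst 1%R) p)%E.
  by rewrite lee_fin mulr_ge0 ?mulr_ge0 ?tdens_ge0.
have := measurable_integral_prodr mu (@lebesgue_measure R)
  (@cone_kernel_meas a (cst 1%R) (measurable_cst _)) k0.
apply: eq_measurable_fun => x _.
by rewrite cone_kernelE//= mul1e.
Qed.

(** The vertices whose cone contains [z] form the ball of radius [a * z.2] about [z.1]; exchanging
    the integrals replaces cones by these balls. *)
Lemma tonelli_cone a (u : X -> R) : measurable_fun setT u ->
  (forall x, 0 <= u x) ->
  (\int[mu]_x ((u x)%:E * wide_area a x) =
   \int[mu \x lebesgue_measure]_z
     ((tdens z)%:E * \int[mu]_(x in ball z.1 (a * z.2)) (u x)%:E))%E.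
Proof.
move=> mu_ u0.
have k0 p : (0 <= cone_kernel a u p)%E.
  by rewrite lee_fin mulr_ge0 ?mulr_ge0 ?tdens_ge0.
transitivity (\int[mu]_x \int[mu \x lebesgue_measure]_z cone_kernel a u (x, z))%E.
  by apply: eq_integral => x _; rewrite cone_kernelE.
rewrite (fubini_tonelli_prodr _ _ _ (cone_kernel_meas a mu_) k0).
apply: eq_integral => z _.
have [z0|z0] := ltP 0 z.2; last first.
  have t0 : tdens z = 0 by rewrite /tdens ltNge z0.
  by rewrite /cone_kernel/= t0; under eq_integral do rewrite mulr0 mul0r; rewrite integral0 mul0e.
rewrite -ge0_integralZl_EFin ?tdens_ge0//; last 3 first.
- exact: (measurable_mball open_meas).
- by move=> x _; rewrite lee_fin.
- by apply/measurable_EFinP; exact: measurable_funTS.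
rewrite [RHS]integral_mkcond; apply: eq_integral => x _.
rewrite patchE /cone_kernel/= indicE.
have -> : ((x, z) \in cone_graph a) = (x \in (ball z.1 (a * z.2) : set X)).
  apply/idP/idP; rewrite !inE /cone_graph /wide_cone/=.
    by move=> [_ xz]; apply/in_mball; rewrite metric_sym.
  by move=> /in_mball zx; rewrite metric_sym.
by case: (x \in _); rewrite ?mulr1 ?mulr0// -EFinM mulrC.
Qed.

(** The shifted cones exhaust the cone, so one of them already has mass above [c], and it is
    contained in the cones of all nearby vertices. *)
Lemma open_wide_area (a : R) (c : \bar R) : 0 < a ->
  open [set x | (c < wide_area a x)%E].
Proof.
move=> a0; apply: openP_mball => x /= cx.
pose F (n : nat) : set XR := [set z | 0 < z.2 /\ mdist x z.1 + n.+1%:R^-1 < a * z.2].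
have mF n : measurable (F n) by exact: (measurable_shifted_cone open_meas s_dense).
have ndF : nondecreasing_seq F.
  move=> m n mn; apply/subsetPset => z [z0 xz]; split => //.
  apply: le_lt_trans xz; rewrite lerD2l lef_pV2 ?posrE//.
  by rewrite ler_nat.
have FE : wide_cone a x = \bigcup_n F n.
  apply/seteqP; split=> [z [z0 xz]|z [n _ [z0 xz]]]; last first.
    by split => //; apply: le_lt_trans xz; rewrite lerDl.
  exists (Num.truncn (a * z.2 - mdist x z.1)^-1) => //; split => //.
  rewrite -ltrBrDl -[ltRHS]invrK ltf_pV2 ?posrE ?invr_gt0 ?subr_gt0//.
  exact: truncnS_gt.
have cvgF := @ge0_nondecreasing_set_cvg_integral _ _ _ F (EFin \o tdens)
  (mu \x lebesgue_measure)%E ndF mF (fun n => @mtd (F n)).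
have [n cn] : exists n, (c < tmass (F n))%E.
  apply: contrapT => h; move: cx; rewrite /wide_area FE ltNge => /negP; apply.
  rewrite /tmass -(cvg_lim _ (cvgF _))//; last first.
    by move=> n z _; rewrite lee_fin tdens_ge0.
  apply: lime_le.
    by apply/cvg_ex; eexists; apply: cvgF => n z _; rewrite lee_fin tdens_ge0.
  by apply: nearW => n; rewrite leNgt; apply/negP => cn; apply: h; exists n.
exists n.+1%:R^-1; first by rewrite invr_gt0.
move=> x' /in_mball xx' /=; apply: lt_le_trans cn _.
apply: le_tmass => //; first exact: (measurable_wide_cone open_meas s_dense).
move=> z [z0 xz]; split => //.
have := metric_triangle x' x z.1; rewrite (metric_sym x' x).
by set e := n.+1%:R^-1 in xz xx' *; lra.
Qed.

End TentDensity.

(** * Change of aperture *)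

Section ChangeOfAperture.
Context {R : realType} {d : measure_display} {X : metricMeasurableType R d}.
Variable mu : {sigma_finite_measure set X -> \bar R}.
Variable C1 : R.
Hypothesis open_meas : forall U : set X, open U -> measurable U.
Hypothesis dbl : doubling_with mu C1.
Variable s : nat -> X.
Hypothesis s_dense : dense_seq s.

(** A countable family that replaces all balls in the maximal function. Numbers that encode no pair
    get radius 0, which [dense_balls] discards along with the negative radii. *)
Definition rat_balls (n : nat) : X * R :=
  if unpickle n is Some iq then (s (iq : nat * rat).1, ratr iq.2) else (point, 0).

Let C10 : 0 < C1.
Proof. by apply: lt_le_trans (doubling_with_ge1 open_meas dbl). Qed.

(** [C1 ^+ 4] pays for enlarging a ball of radius [t] up to sixteenfold, and the factor 2 keeps half
    of that ball outside [P]. *)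
Let c := (2 * C1 ^+ 4)^-1.

Let c_gt0 : 0 < c.
Proof. by rewrite invr_gt0 mulr_gt0// exprn_gt0. Qed.

(** A ball of the family centred within [z.2] of [z.1], of radius between [10 * z.2] and [11 * z.2],
    contains both [x] and [ball z.1 z.2]. Since [x] is not covered, [P] fills at most the fraction
    [c] of it, hence at most half of [ball z.1 z.2]. *)
Lemma outside_dense_balls (P : set X) (x : X) (z : X * R) : measurable P ->
  0 < z.2 -> ball z.1 (9 * z.2) x -> ~ dense_balls mu c rat_balls P x ->
  (c%:E * mu (ball z.1 (9 * z.2)) <= mu (ball z.1 z.2 `&` ~` P))%E.
Proof.
move=> mP z0 /in_mball zx nOx.
have mb (y : X) (r : R) : measurable (ball y r) by exact: measurable_mball.
have [i zi] := s_dense z.1 z0.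
have [q] : exists q, ratr q \in `](10 * z.2), (11 * z.2)[.
  by apply: rat_in_itvoo; lra.
rewrite in_itv/= => /andP[q1 q2].
set r : R := ratr q in q1 q2.
have Bx : ball (s i) r x.
  apply/in_mball; have := metric_triangle (s i) z.1 x.
  by rewrite (metric_sym (s i) z.1); lra.
have r0 : 0 < r by lra.
have BP : (mu (ball (s i) r `&` P) <= c%:E * mu (ball (s i) r))%E.
  rewrite leNgt; apply/negP => h; apply: nOx.
  by exists (pickle (i, q)); rewrite /rat_balls /= pickleK.
have cE : c * (C1 ^+ 4 * vol mu z.1 z.2) = vol mu z.1 z.2 / 2.
  by rewrite /c; field; rewrite gt_eqF.
have volB : vol mu (s i) r <= C1 ^+ 4 * vol mu z.1 z.2.
  by apply: (le_vol open_meas dbl) => //; rewrite -natrX; lra.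
have vol9 : vol mu z.1 (9 * z.2) <= C1 ^+ 4 * vol mu z.1 z.2.
  apply: (le_vol open_meas dbl); rewrite ?mdistxx ?mulr_gt0// -natrX; lra.
have zP : (mu (ball z.1 z.2 `&` P) <= (vol mu z.1 z.2 / 2)%:E)%E.
  apply: (@le_trans _ _ (mu (ball (s i) r `&` P))).
    apply: le_measure; rewrite ?inE; try exact: measurableI.
    apply: setSI; apply: mball_subset; rewrite metric_sym; lra.
  apply: le_trans BP _; rewrite (mu_mball dbl)// -EFinM lee_fin.
  by rewrite -cE ler_pM2l.
have hsum : mu (ball z.1 z.2) =
    (mu (ball z.1 z.2 `&` ~` P) + mu (ball z.1 z.2 `&` P))%E.
  by rewrite -setDE; apply: measureDI.
rewrite (mu_mball dbl)// in hsum; rewrite (mu_mball dbl) ?mulr_gt0//.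
have : (mu (ball z.1 z.2 `&` P) \is a fin_num).
  rewrite ge0_fin_numE//; apply: le_lt_trans zP _; exact: ltry.
move: hsum zP; case: (mu (ball z.1 z.2 `&` P)) => // p + + _.
case: (mu (ball z.1 z.2 `&` ~` P)) => // e.
rewrite -EFinM -EFinD !lee_fin => -[hV] hp.
apply: (@le_trans _ _ (c * (C1 ^+ 4 * vol mu z.1 z.2))); first by rewrite ler_pM2l.
by rewrite cE; lra.
Qed.

Variable f : X * R -> R[i].
Hypothesis f_meas : measurable_upper f.
Variable w : X -> R.
Hypothesis w_ge0 : forall x, 0 <= w x.
Hypothesis w_meas : measurable_fun setT w.

Let w_ind (D : set X) (x : X) : R := w x * \1_D x.

Let w_ind_ge0 D x : 0 <= w_ind D x.
Proof. by rewrite mulr_ge0// indicE. Qed.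

Let w_ind_meas D : measurable D -> measurable_fun setT (w_ind D).
Proof. by move=> mD; apply: measurable_funM => //; exact: measurable_indic. Qed.

Let integral_w_ind (D E : set X) (g : X -> \bar R) :
  (\int[mu]_(x in E) ((w_ind D x)%:E * g x) =
   \int[mu]_(x in E `&` D) ((w x)%:E * g x))%E.
Proof.
rewrite [RHS]integral_mkcondr; apply: eq_integral => x _.
rewrite patchE /w_ind indicE.
by case: (x \in D); rewrite ?mulr1// mulr0 mul0e.
Qed.

(** After Tonelli the comparison is pointwise in [z], between the weights of the ball of radius
    [9 * z.2] off the dense balls and of the ball of radius [z.2] off [P]. If the former is
    nonempty, [outside_dense_balls] makes the A_infinity property applicable. *)
Lemma wide_area_outside (K : R) (P : set X) : 0 <= K -> measurable P ->
  Ainf_cond mu w c K ->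
  (\int[mu]_(x in ~` dense_balls mu c rat_balls P) ((w x)%:E * wide_area mu f 9 x)
   <= K%:E * \int[mu]_(x in ~` P) ((w x)%:E * wide_area mu f 1 x))%E.
Proof.
move=> K0 mP Aw; set O := dense_balls _ _ _ _.
have mO : measurable O by exact: dense_balls_meas.
have td0 := tdens_ge0 dbl f.
rewrite -[in leLHS](setTI (~` O)) -[in leRHS](setTI (~` P)) -!integral_w_ind.
have mOC : measurable (~` O) by exact: measurableC.
have mPC : measurable (~` P) by exact: measurableC.
have mwide a := wide_area_meas open_meas dbl s_dense f_meas a.
have wP0 x : setT x -> (0 <= (w_ind (~` P) x)%:E * wide_area mu f 1 x)%E.
  by move=> _; rewrite mule_ge0 ?lee_fin//; exact: (tmass_ge0 dbl).
have mwP : measurable_fun setT (fun x => (w_ind (~` P) x)%:E * wide_area mu f 1 x)%E.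
  by apply: emeasurable_funM => //; apply/measurable_EFinP; exact: w_ind_meas.
rewrite -(ge0_integralZl_EFin _ measurableT wP0 mwP K0).
under [leRHS]eq_integral do rewrite muleA -EFinM.
rewrite (tonelli_cone open_meas dbl s_dense f_meas)//; last exact: w_ind_meas.
rewrite (@tonelli_cone _ _ _ _ _ open_meas dbl _ s_dense _ f_meas 1
  (fun x => K * w_ind (~` P) x)); last 2 first.
- by apply: measurable_funM => //; exact: w_ind_meas.
- by move=> x; rewrite mulr_ge0.
apply: le_integral_nonneg => z _.
  by rewrite mule_ge0 ?lee_fin// integral_ge0// => x _; rewrite lee_fin.
have [z0|z0] := ltP 0 z.2; last by rewrite /tdens ltNge z0 !mul0e.
apply: lee_wpmul2l; first by rewrite lee_fin.
have mb (y : X) (r : R) : measurable (ball y r) by exact: measurable_mball.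
under [leRHS]eq_integral do rewrite EFinM.
rewrite ge0_integralZl_EFin//; last 2 first.
- by move=> x _; rewrite lee_fin.
- by apply/measurable_EFinP; apply: measurable_funTS; exact: w_ind_meas.
have wE (D E : set X) : (\int[mu]_(x in E) (w_ind D x)%:E = wint mu w (E `&` D))%E.
  have := integral_w_ind D E (cst 1%E).
  by under eq_integral do rewrite mule1; under [RHS]eq_integral do rewrite mule1.
rewrite !wE mul1r.
have [[x zx nOx]|noint] := pselect (exists2 x, ball z.1 (9 * z.2) x & ~ O x); last first.
  have -> : ball z.1 (9 * z.2) `&` ~` O = set0.
    by rewrite -subset0 => x [zx nOx]; apply: noint; exists x.
  by rewrite /wint integral_set0 mule_ge0 ?lee_fin// wint_ge0.
apply: (@le_trans _ _ (wint mu w (ball z.1 (9 * z.2)))).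
  by apply: le_wint => //; exact: measurableI.
apply: Aw; rewrite ?mulr_gt0//; first exact: measurableI.
  by apply: subset_trans (@subIsetl _ _ _) _; apply: mball_subset; rewrite mdistxx; lra.
exact: outside_dense_balls zx nOx.
Qed.

Lemma Ainf_cond_le (c1 c2 K : R) : c1 <= c2 ->
  Ainf_cond mu w c1 K -> Ainf_cond mu w c2 K.
Proof.
move=> c12 A x r E r0 mE Esub cE; apply: A => //; apply: le_trans cE.
by rewrite lee_wpmul2r.
Qed.

(* The truncation min(1, a / lev). *)
Definition cap (a : \bar R) (lev : R) : R :=
  if (lev%:E < a)%E then 1 else fine a / lev.

Lemma cap_ge0 a lev : (0 <= a)%E -> 0 < lev -> 0 <= cap a lev.
Proof.
by move=> a0 l0; rewrite /cap; case: ifP => // _; rewrite divr_ge0 ?fine_ge0 ?(ltW l0).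
Qed.

Lemma cap_meas (a : X -> \bar R) lev : measurable_fun setT a ->
  measurable_fun setT (fun x => cap (a x) lev).
Proof.
move=> ma; apply: measurable_fun_ifT => //.
  apply: (measurable_fun_bool true).
  by have := emeasurable_fun_o_infty measurableT ma lev%:E; rewrite !setTI.
apply: measurable_funM => //.
by apply: (measurableT_comp (@fine_measurable R setT measurableT)).
Qed.

(** With [P] the set where [a] exceeds [lev], the level set is split along the dense balls of [P].
    Inside them the maximal estimate gives the weight of [P]; outside, Chebyshev and the change of
    aperture give the integral of [a / lev] off [P]. The two add up to the integral of [cap]. *)
Lemma wint_wide_area (K : R) (a : X -> \bar R) (lev : R) : 0 <= K -> 0 < lev ->
  Ainf_cond mu w (c / C1 ^+ 2) K ->
  measurable_fun setT a -> (forall x, (0 <= a x)%E) ->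
  (forall x, (wide_area mu f 1 x <= C1%:E * a x)%E) ->
  (wint mu w [set x | (lev%:E < wide_area mu f 9 x)%E] <=
   (K * C1)%:E * \int[mu]_x (w x * cap (a x) lev)%:E)%E.
Proof.
move=> K0 lev0 Aw ma a0 area_a.
have C11 := doubling_with_ge1 open_meas dbl.
have Aw' : Ainf_cond mu w c K.
  apply: Ainf_cond_le Aw; rewrite ler_pdivrMr ?exprn_gt0//.
  by rewrite ler_pMr// exprn_ege1.
set P := [set x | (lev%:E < a x)%E].
have mP : measurable P.
  by have := emeasurable_fun_o_infty measurableT ma lev%:E; rewrite setTI.
have mPC : measurable (~` P) by exact: measurableC.
set O := [set x | _]; set O' := dense_balls mu c rat_balls P.
have mO : measurable O.
  by apply: open_meas; exact: (open_wide_area open_meas dbl s_dense f_meas).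
have mO' : measurable O' by exact: dense_balls_meas.
have mOC' : measurable (~` O') by exact: measurableC.
have mwide b := wide_area_meas open_meas dbl s_dense f_meas b.
have wide0 b x : (0 <= wide_area mu f b x)%E by exact: (tmass_ge0 dbl).
have mw D : measurable_fun D (fun x => (w x)%:E).
  by apply/measurable_EFinP; exact: measurable_funTS.
have w0 (D : set X) x : D x -> (0 <= (w x)%:E)%E by rewrite lee_fin.
have mfa (D : set X) : measurable_fun D (fun x => (w x * fine (a x))%:E).
  apply/measurable_EFinP; apply: measurable_funM; first exact: measurable_funTS.
  by apply: measurable_funTS; apply: (measurableT_comp (@fine_measurable R setT measurableT)).
have fa0 (D : set X) x : D x -> (0 <= (w x * fine (a x))%:E)%E.
  by move=> _; rewrite lee_fin mulr_ge0// fine_ge0.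
have mI1 : measurable (O `&` O') by exact: measurableI.
have mI2 : measurable (O `&` ~` O') by exact: measurableI.
have step1 : (wint mu w (O `&` O') <= K%:E * wint mu w P)%E.
  apply: le_trans (wint_dense_balls open_meas dbl w_ge0 w_meas rat_balls c_gt0 K0 mP Aw).
  by apply: le_wint => //; exact: measurableI.
have step2 : (lev%:E * wint mu w (O `&` ~` O') <=
    (K * C1)%:E * \int[mu]_(x in ~` P) (w x * fine (a x))%:E)%E.
  rewrite -(ge0_integralZl_EFin _ mI2 (@w0 _) (@mw _) (ltW lev0)).
  apply: (@le_trans _ _ (\int[mu]_(x in O `&` ~` O') ((w x)%:E * wide_area mu f 9 x))%E).
    apply: le_integral_nonneg => x [Ox _]; first by rewrite mule_ge0 ?lee_fin// ltW.
    by rewrite muleC lee_wpmul2l ?lee_fin// ltW.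
  apply: (@le_trans _ _ (\int[mu]_(x in ~` O') ((w x)%:E * wide_area mu f 9 x))%E).
    apply: (ge0_subset_integral _ mI2 mOC') => //.
      by apply: emeasurable_funM => //; exact: measurable_funTS.
    by move=> x _; rewrite mule_ge0 ?lee_fin.
  apply: le_trans (wide_area_outside K0 mP Aw') _.
  rewrite EFinM -muleA; apply: lee_wpmul2l; first by rewrite lee_fin.
  rewrite -(ge0_integralZl_EFin _ mPC (@fa0 _) (@mfa _) (ltW C10)).
  apply: le_integral_nonneg => x Px; first by rewrite mule_ge0 ?lee_fin.
  have afin : a x \is a fin_num.
    rewrite ge0_fin_numE//; apply: le_lt_trans (ltry lev).
    by rewrite leNgt; apply/negP.
  rewrite EFinM fineK// muleCA; apply: lee_wpmul2l; first by rewrite lee_fin.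
  exact: area_a.
have capE : (\int[mu]_x (w x * cap (a x) lev)%:E = wint mu w P +
   (lev^-1)%:E * \int[mu]_(x in ~` P) (w x * fine (a x))%:E)%E.
  have mcap := cap_meas lev ma.
  rewrite -(setUv P) ge0_integral_setU//; last 3 first.
  - by apply/measurable_EFinP; apply: measurable_funTS; exact: measurable_funM.
  - by move=> x _; rewrite lee_fin mulr_ge0// cap_ge0.
  - by apply/disj_set2P; exact: setICr.
  congr (_ + _)%E.
    by apply: eq_integral => x; rewrite inE /P/= /cap => ->; rewrite mulr1.
  rewrite -(ge0_integralZl_EFin _ mPC (@fa0 _) (@mfa _)) ?invr_ge0 ?(ltW lev0)//.
  apply: eq_integral => x; rewrite inE /P/= /cap => /negP/negbTE ->.
  by rewrite -EFinM mulrA mulrC.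
have -> : O = (O `&` O') `|` (O `&` ~` O') by rewrite -setIUr setUv setIT.
apply: le_trans (wintU_le mu w_ge0 w_meas mI1 mI2) _.
rewrite capE ge0_muleDr ?wint_ge0//; last first.
  rewrite mule_ge0 ?lee_fin ?invr_ge0 ?(ltW lev0)// integral_ge0// => x _.
  by rewrite lee_fin mulr_ge0// fine_ge0.
apply: leeD.
  apply: le_trans step1 _; apply: lee_wpmul2r; first exact: wint_ge0.
  by rewrite lee_fin ler_peMr.
rewrite muleCA -[leLHS]mul1e -[1%E](_ : (lev^-1 * lev)%:E = 1%E); last first.
  by rewrite mulVf ?gt_eqF.
rewrite EFinM -muleA; apply: lee_wpmul2l => //.
by rewrite lee_fin invr_ge0 ltW.
Qed.

End ChangeOfAperture.

(** * Sums over the level sets *)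

Section DyadicSums.
Context {R : realType}.

(* Telescoping against [v / (1 + v)], which is increasing in [v]. *)
Lemma geometric_peak_le (B v : R) : 1 < B -> B <= 2 -> 0 < v ->
  Num.min v v^-1 <= 6 / (B - 1) * (B * v / (1 + B * v) - v / (1 + v)).
Proof.
move=> B1 B2 v0.
have -> : 6 / (B - 1) * (B * v / (1 + B * v) - v / (1 + v)) =
    6 * v / ((1 + B * v) * (1 + v)).
  by field; rewrite !gt_eqF//; nra.
have Bv : 0 < B * v by rewrite mulr_gt0//; lra.
rewrite ler_pdivlMr ?mulr_gt0//; try lra.
have vv : v^-1 * v = 1 by rewrite mulVf ?gt_eqF.
(* As [B <= 2], the product [(1 + B * v) * (1 + v)] is at most 6 for [v <= 1] and at most
   [6 * v ^+ 2] for [v > 1]. *)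
have [v1|v1] := leP v 1.
  apply: (@le_trans _ _ (v * ((1 + B * v) * (1 + v)))).
    by rewrite ler_wpM2r ?ge_min ?lexx// mulr_ge0; lra.
  by rewrite mulrC ler_wpM2r//; [lra|nra].
apply: (@le_trans _ _ (v^-1 * ((1 + B * v) * (1 + v)))).
  by rewrite ler_wpM2r ?ge_min ?lexx ?orbT// mulr_ge0; lra.
rewrite ler_pdivrMl//; nra.
Qed.

Lemma powR2_gt1 (p : R) : 0 < p -> 1 < 2 `^ p :> R.
Proof.
move=> p0; have := @gt0_ltr_powR R p p0 1 2; rewrite !nnegrE ler01 ler0n powR1.
by apply; rewrite ?ltr1n.
Qed.

(** The values [v m] form a geometric progression of ratio [2 ^ p], so the bounds of
    [geometric_peak_le] telescope to a difference of values in [0, 1], whatever [a], [n] and [N]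
    are. *)
Lemma dyadic_sum_le (p a : R) (n N : nat) (F : int -> R) :
  0 < p <= 1 -> 0 < a ->
  (forall k : int, F k <= Num.min ((2 ^ k / a) `^ p) ((2 ^ k / a) `^ p)^-1) ->
  \sum_(0 <= m < N) F (m%:Z - n%:Z) <= 6 / (2 `^ p - 1).
Proof.
move=> /andP[p0 p1] a0 hF.
pose v (m : nat) := (2 ^ (m%:Z - n%:Z) / a) `^ p.
have v0 m : 0 < v m by rewrite powR_gt0// divr_gt0// exprz_gt0.
have vS m : v m.+1 = 2 `^ p * v m.
  rewrite /v -powRM; try by rewrite ?divr_ge0 ?exprz_ge0// ltW.
  by rewrite mulrA -(add1n m) PoszD -addrA expfzDr// expr1z.
have B1 := powR2_gt1 p0.
have B2 : 2 `^ p <= 2 :> R.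
  by rewrite -[leRHS](powRr1 (ler0n _ 2)) ler_powR// ler1n.
pose g m := v m / (1 + v m).
apply: (@le_trans _ _ (6 / (2 `^ p - 1) * (g N - g 0%N))).
  rewrite -telescope_sumr// mulr_sumr; apply: ler_sum_nat => m _.
  apply: le_trans (hF _) _; rewrite /g vS; exact: (geometric_peak_le B1 B2 (v0 m)).
rewrite ler_piMr ?divr_ge0//; first lra.
have : 0 <= g 0%N by rewrite divr_ge0 ?addr_ge0 ?ltW.
have : g N <= 1 by rewrite ler_pdivrMr ?mul1r ?ltr_wpDl// lerDr.
lra.
Qed.

End DyadicSums.

Section LevelSums.
Context {R : realType} {d : measure_display} {X : metricMeasurableType R d}.
Variable mu : {sigma_finite_measure set X -> \bar R}.
Variable C1 : R.
Hypothesis open_meas : forall U : set X, open U -> measurable U.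
Hypothesis dbl : doubling_with mu C1.
Variable s : nat -> X.
Hypothesis s_dense : dense_seq s.
Variable phi : X -> R -> R.
Hypothesis phi_orlicz : forall x, orlicz (phi x).
Hypothesis phi_meas : forall t, 0 <= t -> measurable_fun setT (fun x => phi x t).
Variables (p Cl Cu : R).
Hypothesis p01 : 0 < p <= 1.
Hypothesis Cl0 : 0 < Cl.
Hypothesis Cu0 : 0 < Cu.
Hypothesis phi_lower : forall x t r, 0 <= t -> 0 <= r -> r <= 1 ->
  phi x (r * t) <= Cl * r `^ p * phi x t.
Hypothesis phi_upper : forall x t r, 0 <= t -> 1 <= r ->
  phi x (r * t) <= Cu * r `^ 1 * phi x t.

Lemma phi_ge0 x t : 0 <= t -> 0 <= phi x t.
Proof. by have [h0 mon _ _] := phi_orlicz x => t0; rewrite -h0; exact: mon. Qed.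

Lemma phi_gt0 x t : 0 < t -> 0 < phi x t.
Proof. by have [_ _ + _] := phi_orlicz x; apply. Qed.

Lemma phi_level_le (a l : R) (k : int) x : 0 < a -> 0 < l ->
  phi x (2 ^ k / l) * cap (a ^+ 2)%:E ((2 ^ k) ^+ 2) <=
  (Cl + Cu) * phi x (a / l) *
    Num.min ((2 ^ k / a) `^ p) ((2 ^ k / a) `^ p)^-1.
Proof.
move=> a0 l0; have /andP[p0 p1] := p01.
pose u := 2 ^ k / a; rewrite -/u.
have k0 : 0 < 2 ^ k :> R by rewrite exprz_gt0.
have u0 : 0 < u by rewrite divr_gt0.
have up0 : 0 < u `^ p by exact: powR_gt0.
have al0 : 0 <= a / l by rewrite divr_ge0 ?ltW.
have kE : 2 ^ k / l = u * (a / l) by rewrite /u mulrA divfK ?gt_eqF.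
have pal := phi_gt0 x (divr_gt0 a0 l0).
rewrite /cap lte_fin ltr_sqr ?nnegrE ?(ltW k0) ?(ltW a0)//.
have -> : (2 ^ k < a) = (u < 1) by rewrite /u ltr_pdivrMr// mul1r.
have mono (y z : R) : 0 <= y -> 0 <= z -> y <= z -> y `^ p <= z `^ p.
  by move=> y0 z0; apply: (ge0_ler_powR (ltW p0)); rewrite nnegrE.
have [u1|u1] := ltP u 1.
  have up1 : u `^ p <= 1.
    by have := mono u 1 (ltW u0) ler01 (ltW u1); rewrite powR1.
  have -> : Num.min (u `^ p) (u `^ p)^-1 = u `^ p.
    by apply/min_idPl; apply: (le_trans up1); rewrite -[leLHS]invr1 lef_pV2 ?posrE.
  rewrite mulr1 kE; apply: le_trans (phi_lower x al0 (ltW u0) (ltW u1)) _.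
  by rewrite mulrAC ler_wpM2r ?(ltW up0)// ler_wpM2r ?(ltW pal)// lerDl ltW.
have up1 : 1 <= u `^ p.
  by have := mono 1 u ler01 (ltW u0) u1; rewrite powR1.
(* Above the level, upper type 1 and the truncation leave [u * u ^- 2]; this inequality, due to
   [p <= 1], brings the result to the form [(u ^ p)^-1] that is summed. *)
have upu : u `^ p <= u.
  by rewrite -[leRHS](powRr1 (ltW u0)) ler_powR.
have -> : Num.min (u `^ p) (u `^ p)^-1 = (u `^ p)^-1.
  by apply/min_idPr; apply: (le_trans _ up1); rewrite invf_le1.
have -> : a ^+ 2 / (2 ^ k) ^+ 2 = u ^- 2.
  by rewrite /u expr_div_n invf_div.
apply: (@le_trans _ _ (Cu * u * phi x (a / l) * u ^- 2)).
  rewrite ler_wpM2r ?invr_ge0 ?exprn_ge0 ?(ltW u0)// kE.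
  by apply: le_trans (phi_upper x al0 u1) _; rewrite powRr1// ltW.
have -> : Cu * u * phi x (a / l) * u ^- 2 = Cu * phi x (a / l) * u^-1.
  by field; rewrite gt_eqF.
apply: ler_pM.
- by rewrite mulr_ge0// ltW.
- by rewrite invr_ge0 ltW.
- by rewrite ler_wpM2r ?(ltW pal)// lerDr ltW.
- by rewrite lef_pV2 ?posrE.
Qed.

Let M0 := (Cl + Cu) * (6 / (2 `^ p - 1)).

Let M0_gt0 : 0 < M0.
Proof.
have /andP[p0 _] := p01.
rewrite mulr_gt0 ?addr_gt0// divr_gt0// subr_gt0.
have := gt0_ltr_powR p0 (ler01 : (1 : R) \is Num.nneg)
  (ler0n _ 2 : (2 : R) \is Num.nneg).
by rewrite powR1; apply; rewrite ltr1n.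
Qed.

Lemma phi_level_sum_le (a : \bar R) (l : R) (n N : nat) x : (0 <= a)%E -> 0 < l ->
  ((\sum_(0 <= m < N) phi x (2 ^ (m%:Z - n%:Z) / l) *
      cap a ((2 ^ (m%:Z - n%:Z)) ^+ 2))%:E <=
  M0%:E * phi_ext phi x (`|a `^ 2^-1| * (l^-1)%:E))%E.
Proof.
move=> a0 l0; have /andP[p0 p1] := p01.
case: a a0 => [a| |//] a0; last first.
  rewrite poweRyr; last by rewrite invr_eq0 pnatr_eq0.
  by rewrite gt0_mulye ?lte_fin ?invr_gt0//= gt0_muley ?leey// lte_fin.
rewrite lee_fin in a0; move: a0; rewrite le_eqVlt => /predU1P[<-|a0].
  rewrite big1 => [|m _]; last first.
    by rewrite /cap lte_fin ltNge sqr_ge0/= mul0r mulr0.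
  rewrite poweR_EFin powR0 ?invr_eq0 ?pnatr_eq0// abse0 mul0e.
  by rewrite mule_ge0 ?lee_fin ?(ltW M0_gt0)//; exact: phi_ge0.
pose b := Num.sqrt a; have b0 : 0 < b by rewrite sqrtr_gt0.
have aE : a = b ^+ 2 by rewrite sqr_sqrtr// ltW.
have -> : (a%:E `^ 2^-1 = b%:E)%E by rewrite poweR_EFin powR12_sqrt// ltW.
rewrite gee0_abs; last by rewrite lee_fin ltW.
rewrite -EFinM /= lee_fin.
have pbl := phi_gt0 x (divr_gt0 b0 l0).
set c := (Cl + Cu) * phi x (b / l).
have c0 : 0 < c by rewrite mulr_gt0 ?addr_gt0.
have := @dyadic_sum_le _ p b n N (fun k : int => c^-1 * (phi x (2 ^ k / l) *
   cap a%:E ((2 ^ k) ^+ 2))) p01 b0.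
rewrite -mulr_sumr ler_pdivrMl//.
have -> : c * (6 / (2 `^ p - 1)) = M0 * phi x (b / l) by rewrite /c /M0; ring.
apply=> k; rewrite ler_pdivrMl// aE; exact: phi_level_le.
Qed.

Variable f : X * R -> R[i].
Hypothesis f_meas : measurable_upper f.

Definition area2 (x : X) : \bar R :=
  (\int[mu \x lebesgue_measure]_(z in cone x)
    ((Normc.normc (f z) ^+ 2)%:E * (mu (ball x z.2))^-1 * (z.2^-1)%:E))%E.

Lemma areaE x : area mu f x = (area2 x `^ 2^-1)%E.
Proof. by []. Qed.

Let integrand_ge0 x z : cone x z ->
  (0 <= (Normc.normc (f z) ^+ 2)%:E * (mu (ball x z.2))^-1 * (z.2^-1)%:E)%E.
Proof.
move=> [z0 _]; rewrite !mule_ge0 ?inve_ge0// lee_fin ?sqr_ge0// invr_ge0 ltW//.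
Qed.

Lemma area2_ge0 x : (0 <= area2 x)%E.
Proof. by apply: integral_ge0 => z; exact: integrand_ge0. Qed.

Lemma area2_meas : measurable_fun setT (area mu f) -> measurable_fun setT area2.
Proof.
move=> ma; have -> : area2 = (fun x => area mu f x `^ 2)%E.
  apply/funext => x; rewrite areaE -poweRrM mulVf ?pnatr_eq0//.
  by rewrite poweRe1// area2_ge0.
by apply: (measurableT_comp (measurable_poweR _)).
Qed.

Lemma area_integrandE x z : 0 < z.2 ->
  ((Normc.normc (f z) ^+ 2)%:E * (mu (ball x z.2))^-1 * (z.2^-1)%:E =
   (Normc.normc (f z) ^+ 2 / (vol mu x z.2 * z.2))%:E)%E.
Proof.
move=> z0; have v0 := vol_gt0 dbl x z0.
rewrite (mu_mball dbl)// inver gt_eqF// -!EFinM invfM mulrA.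
by congr (_%:E); rewrite -!mulrA.
Qed.

Local Notation XR := (X * measurableTypeR R)%type.

(** For [z] in the cone at [x], [ball x z.2] lies in [ball z.1 (2 * z.2)], so the two normalisations
    differ by one doubling. *)
Lemma wide_area1_le x : (wide_area mu f 1 x <= C1%:E * area2 x)%E.
Proof.
have C11 := doubling_with_ge1 open_meas dbl.
have C10 : 0 < C1 by lra.
have mW : @measurable _ XR (wide_cone 1 x).
  exact: (measurable_wide_cone open_meas s_dense).
have mt := tdens_meas open_meas dbl s_dense f_meas.
have mtd : @measurable_fun _ _ XR _ (wide_cone 1 x) (EFin \o tdens mu f).
  by apply/measurable_EFinP; apply: measurable_funTS; exact: mt.
have td0 z : wide_cone 1 x z -> (0 <= (tdens mu f z)%:E)%E.
  by rewrite lee_fin (tdens_ge0 dbl).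
rewrite -lee_pdivrMl// /wide_area /tmass.
rewrite -(ge0_integralZl_EFin _ mW td0 mtd) ?invr_ge0 ?(ltW C10)//.
rewrite /area2 cone_wide_cone; apply: le_integral_nonneg => z [z0 xz].
  by rewrite mule_ge0 ?td0// lee_fin invr_ge0 ltW.
rewrite area_integrandE// /tdens z0 -EFinM lee_fin.
rewrite mulrCA ler_wpM2l ?sqr_ge0// -invfM lef_pV2 ?posrE ?mulr_gt0 ?(vol_gt0 dbl)//.
rewrite mulrA ler_pM2r//; rewrite -[C1]expr1; apply: (le_vol open_meas dbl) => //.
by rewrite expr1 metric_sym; rewrite mul1r in xz; lra.
Qed.

Definition level (k : int) : set X :=
  [set x | (((2 ^ k) ^+ 2)%:E < wide_area mu f 9 x)%E].

(** The integers enter through windows [m - n]; the bound does not depend on the window. The change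
    of aperture is applied to each weight, and the sum is then estimated under one integral. *)
Lemma level_sum_le (K l : R) (n N : nat) : 0 <= K -> 0 < l ->
  (forall t, 0 < t -> Ainf_cond mu (phi ^~ t) ((2 * C1 ^+ 4)^-1 / C1 ^+ 2) K) ->
  measurable_fun setT (area mu f) ->
  (\sum_(0 <= m < N) phi_int mu phi (level (m%:Z - n%:Z)) (2 ^ (m%:Z - n%:Z) / l) <=
   (K * C1 * M0)%:E * \int[mu]_x phi_ext phi x (`|area mu f x| * (l^-1)%:E))%E.
Proof.
move=> K0 l0 HK ma.
have C11 := doubling_with_ge1 open_meas dbl.
have KC0 : 0 <= K * C1 by rewrite mulr_ge0//; lra.
pose kk (m : nat) : int := m%:Z - n%:Z.
have t0 m : 0 < 2 ^ kk m / l by rewrite divr_gt0// exprz_gt0.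
have lev0 m : 0 < (2 ^ kk m : R) ^+ 2 by rewrite exprn_gt0// exprz_gt0.
pose G m x := phi x (2 ^ kk m / l) * cap (area2 x) ((2 ^ kk m) ^+ 2).
have G0 m x : 0 <= G m x.
  by rewrite mulr_ge0 ?cap_ge0 ?area2_ge0 ?phi_ge0 ?ltW.
have mG m : measurable_fun setT (G m).
  by apply: measurable_funM; [exact/phi_meas/ltW|exact/cap_meas/area2_meas].
have intG0 m : (0 <= \int[mu]_x (G m x)%:E)%E.
  by apply: integral_ge0 => x _; rewrite lee_fin.
apply: (@le_trans _ _ (\sum_(0 <= m < N) ((K * C1)%:E * \int[mu]_x (G m x)%:E))%E).
  apply: lee_sum => m _.
  apply: (wint_wide_area open_meas dbl s_dense f_meas _ _ K0 (lev0 m)).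
  - by move=> x; apply: phi_ge0; exact: ltW (t0 m).
  - exact: phi_meas (ltW (t0 m)).
  - exact: HK (t0 m).
  - exact: area2_meas.
  - exact: area2_ge0.
  - exact: wide_area1_le.
rewrite -ge0_sume_distrr// (EFinM (K * C1) M0) -muleA; apply: lee_wpmul2l; first by rewrite lee_fin.
rewrite -ge0_integral_sum//; last 2 first.
- by move=> m; apply/measurable_EFinP.
- by move=> m x _; rewrite lee_fin.
rewrite muleC -lee_pdivrMr// muleC.
have mS : measurable_fun setT (fun x => \sum_(0 <= m < N) (G m x)%:E)%E.
  by apply: emeasurable_sum => m; apply/measurable_EFinP.
have S0 x : setT x -> (0 <= \sum_(0 <= m < N) (G m x)%:E)%E.
  by move=> _; apply: sume_ge0 => m _; rewrite lee_fin.
rewrite -(ge0_integralZl_EFin _ measurableT S0 mS) ?invr_ge0 ?(ltW M0_gt0)//.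
apply: le_integral_nonneg => x _.
  by rewrite mule_ge0 ?S0// lee_fin invr_ge0 ltW.
rewrite lee_pdivrMl// sumEFin areaE.
by apply: phi_level_sum_le => //; exact: area2_ge0.
Qed.

End LevelSums.

(** * Tents and Whitney coverings *)

Section DistanceToComplement.
Context {R : realType} {d : measure_display} {X : metricMeasurableType R d}.
Variable O : set X.
Hypothesis OnT : exists w, ~ O w.
Implicit Types (x y : X).

(** Real-valued, so that it can serve as a radius; it is the distance only when the complement is
    nonempty. *)
Definition codist x : R := inf [set mdist x w | w in ~` O].

Let has_inf_dist x : has_inf [set mdist x w | w in ~` O].
Proof.
split; first by have [w nOw] := OnT; exists (mdist x w), w.
by exists 0 => _ [w _ <-]; exact: mdist_ge0.
Qed.

Lemma codist_le x w : ~ O w -> codist x <= mdist x w.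
Proof. by move=> nOw; apply: ge_inf; [have [] := has_inf_dist x|exists w]. Qed.

Lemma le_codist x (c : R) : (forall w, ~ O w -> c <= mdist x w) -> c <= codist x.
Proof.
move=> h; apply: lb_le_inf; first by have [] := has_inf_dist x.
by move=> _ [w nOw <-]; exact: h.
Qed.

Lemma codist_lip x y : codist x <= codist y + mdist x y.
Proof.
rewrite -lerBlDr; apply: le_codist => w nOw.
by have := metric_triangle x y w; have := codist_le x nOw; lra.
Qed.

Lemma codist_gt0 x : open O -> O x -> 0 < codist x.
Proof.
move=> oO Ox; have /nbhs_ballP[r /= r0 rO] := open_nbhs_nbhs (conj oO Ox).
apply: lt_le_trans r0 _; apply: le_codist => w nOw.
by rewrite leNgt; apply/negP => xw; apply/nOw/rO/in_mball.
Qed.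

Lemma codist_attained x : 0 < codist x ->
  exists2 w, ~ O w & mdist x w < 2 * codist x.
Proof.
move=> x0; have [_ [w nOw <-] h] := inf_adherent x0 (has_inf_dist x).
by exists w => //; apply: lt_le_trans h _; rewrite -/(codist x); lra.
Qed.

Lemma codist_ball x : ball x (codist x) `<=` O.
Proof.
move=> y /in_mball xy; apply: contrapT => /(codist_le x); lra.
Qed.

End DistanceToComplement.

Section SteepTents.
Context {R : realType} {d : measure_display} {X : metricMeasurableType R d}.

(** Expressed by balls, this needs no convention for the distance to an empty set: over the whole
    space it is the upper half. *)
Definition tent3 (O : set X) : set (X * R) :=
  [set z | 0 < z.2 /\ ball z.1 (3 * z.2) `<=` O].

Lemma notin_tent3 (O : set X) (z : X * R) : 0 < z.2 -> ~ tent3 O z ->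
  exists2 w, ~ O w & mdist z.1 w < 3 * z.2.
Proof.
move=> z0 nz; apply: contrapT => h; apply: nz; split => // w /in_mball zw.
by apply: contrapT => nOw; apply: h; exists w.
Qed.

Lemma tent3_codist (O : set X) (z : X * R) : (exists w, ~ O w) ->
  tent3 O z -> 3 * z.2 <= codist O z.1.
Proof.
move=> OnT [z0 zO]; apply: le_codist => // w nOw; rewrite leNgt; apply/negP => zw.
by apply: nOw; apply: zO; exact/in_mball.
Qed.

Lemma tent3S (O O' : set X) : O `<=` O' -> tent3 O `<=` tent3 O'.
Proof. by move=> OO' z [z0 zO]; split => //; exact: subset_trans OO'. Qed.

(** The distance to the complement is 1-Lipschitz, so [3 * z.2] is at most 3/2 of its value at [x].
    Hence [z.2] is at most half that value, which is the room left between [z.1] and the outside of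
    the ball. *)
Lemma tent3_tent_ball (O : set X) (x : X) (z : X * R) : (exists w, ~ O w) ->
  tent3 O z -> ball x (codist O x / 2) z.1 -> tent (ball x (codist O x)) z.
Proof.
move=> OnT zO /in_mball xz; have z3 := tent3_codist OnT zO.
have lip := codist_lip OnT z.1 x; rewrite metric_sym in lip.
split; first by case: zO.
apply: le_ereal_inf_tmp => _ [y nBy <-]; rewrite lee_fin.
have : codist O x <= mdist x y by rewrite leNgt; apply/negP => /in_mball.
by have := metric_triangle x z.1 y; lra.
Qed.

Variable s : nat -> X.
Hypothesis s_dense : dense_seq s.
Hypothesis open_meas : forall U : set X, open U -> measurable U.

Lemma measurable_tent3 (O : set X) : measurable (tent3 O).
Proof.
have mU := measurable_upper_half open_meas s_dense.
pose N : set (X * R) := [set z | 0 < z.2 /\ exists2 w, ~ O w & mdist z.1 w < 3 * z.2].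
have -> : tent3 O = upper_half `\` N.
  apply/seteqP; split=> [z [z0 zO]|z [z0 nN]].
    split => // -[_ [w nOw zw]]; apply/nOw/zO/in_mball => //.
  apply: contrapT => /(notin_tent3 z0) h; exact: nN.
apply: measurableD => //.
apply: (measurable_box_union open_meas s_dense) => z [z0 [w nOw zw]].
pose m := (3 * z.2 - mdist z.1 w) / 4; have m0 : 0 < m by rewrite divr_gt0// subr_gt0.
exists (Num.min z.2 m); first by rewrite lt_min z0.
move=> z'; rewrite !lt_min !ltr_norml => /andP[_ h1] /andP[/andP[h2 _] /andP[h3 _]].
split; first lra.
exists w => //; have := metric_triangle z'.1 z.1 w; rewrite (metric_sym z'.1 z.1).
by rewrite /m in h1 h3; lra.
Qed.

(** Centres come from the dense sequence, so the index set consists of naturals. Near [x] there is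
    some [s j], and by maximality its eighth-ball meets that of a chosen [s i]. By the Lipschitz
    bound [codist] grows by at most 8/7 from [s j] to [x] and 9/7 from [s i] to [s j], which keeps
    [x] in the half-ball at [s i]. *)
Lemma whitney (O : set X) : open O -> (exists w, ~ O w) ->
  exists D : set nat,
  [/\ (forall i, D i -> O (s i)),
      trivIset D (fun i => ball (s i) (codist O (s i) / 8)) &
      (forall x, O x -> exists2 i, D i & ball (s i) (codist O (s i) / 2) x)].
Proof.
move=> oO OnT; pose B i := ball (s i) (codist O (s i) / 8).
have [D [DO tD maxD]] := ex_maximal_disjoint_subcollection B [set i | O (s i)].
exists D; split => // x Ox.
have x0 := codist_gt0 OnT oO Ox.
have [j xj] := s_dense x (divr_gt0 x0 (ltr0Sn R 7)).
have lipxj := codist_lip OnT x (s j).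
have lipjx := codist_lip OnT (s j) x; rewrite (metric_sym (s j) x) in lipjx.
have Oj : O (s j).
  by apply: (@codist_ball _ _ _ _ OnT x); apply/in_mball; lra.
have j0 := codist_gt0 OnT oO Oj.
have [i Di [y [/in_mball jy /in_mball iy]]] : exists2 i, D i & B j `&` B i !=set0.
  apply: contrapT => h.
  have Dj : ~ D j.
    by move=> Dj; apply: h; exists j => //; exists (s j); split; apply: mball_center; lra.
  apply: (maxD (D `|` [set j])).
  - by split=> [i Di|/(_ j) Dj']; [left|apply: Dj; apply: Dj'; right].
  - by move=> i [/DO//|->].
  - move=> i i' [Di|->] [Di'|->] //; first exact: tD.
      by rewrite setIC => ne; exfalso; apply: h; exists i.
    by move=> ne; exfalso; apply: h; exists i'.
exists i => //; apply/in_mball.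
have lipji := codist_lip OnT (s j) (s i).
have tri := metric_triangle (s j) y (s i); rewrite (metric_sym y (s i)) in tri.
have := metric_triangle (s i) (s j) x.
by rewrite (metric_sym (s i) (s j)) (metric_sym (s j) x); lra.
Qed.

End SteepTents.

Section OutsideTent.
Context {R : realType} {d : measure_display} {X : metricMeasurableType R d}.
Variable mu : {sigma_finite_measure set X -> \bar R}.
Variable C1 : R.
Hypothesis open_meas : forall U : set X, open U -> measurable U.
Hypothesis dbl : doubling_with mu C1.
Variable s : nat -> X.
Hypothesis s_dense : dense_seq s.
Variable f : X * R -> R[i].
Hypothesis f_meas : measurable_upper f.

Local Notation XR := (X * measurableTypeR R)%type.

(** A point of the cone at height [t] outside the tent has a point of the complement within [3 t],
    so [codist x] is below [4 t]. A fixed [z0] within [2 * codist x] of [x] is then within [8 t + t]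
    of it, whence the aperture 9. *)
Lemma cone_outside_tent3 (O : set X) (x : X) : open O -> (exists w, ~ O w) ->
  exists2 z0, ~ O z0 &
  forall z, cone x z -> ~ tent3 O z -> wide_cone 9 z0 z.
Proof.
move=> oO OnT; have [Ox|nOx] := pselect (O x); last first.
  by exists x => // z [z0 xz] _; split => //; lra.
have [z0 nOz0 xz0] := codist_attained OnT (codist_gt0 OnT oO Ox).
exists z0 => // z [zt xz] /(notin_tent3 zt)[w nOw zw]; split => //.
have := codist_le OnT x nOw.
have := metric_triangle x z.1 w; have := metric_triangle z0 x z.1.
by rewrite (metric_sym z0 x); lra.
Qed.

(** One vertex outside [O] dominates the whole cone at [x]. The factor [C1] exchanges the volume at
    [x] for the one at [z.1]. *)
Lemma area2_outside_tent3 (O : set X) (g : X * R -> R[i]) (c : R) (L : \bar R)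
    (x : X) : 0 <= c ->
  open O -> (exists w, ~ O w) -> (0 <= L)%E ->
  (forall z0, ~ O z0 -> (wide_area mu f 9 z0 <= L)%E) ->
  (forall z, 0 < z.2 -> Normc.normc (g z) <= c * Normc.normc (f z)) ->
  (forall z, tent3 O z -> g z = 0) ->
  (area2 mu g x <= (c ^+ 2 * C1)%:E * L)%E.
Proof.
move=> c0 oO OnT L0 fL gf gO.
have C11 := doubling_with_ge1 open_meas dbl.
have C10 : 0 < C1 by lra.
have cC0 : 0 <= c ^+ 2 * C1 by rewrite mulr_ge0 ?sqr_ge0// ltW.
have [z0 nOz0 coneO] := cone_outside_tent3 x oO OnT.
have mW : @measurable _ XR (wide_cone 9 z0).
  exact: (measurable_wide_cone open_meas s_dense).
have mt := tdens_meas open_meas dbl s_dense f_meas.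
have mtd : @measurable_fun _ _ XR _ (wide_cone 9 z0) (EFin \o tdens mu f).
  by apply/measurable_EFinP; apply: measurable_funTS; exact: mt.
have td0 z : wide_cone 9 z0 z -> (0 <= (tdens mu f z)%:E)%E.
  by rewrite lee_fin (tdens_ge0 dbl).
apply: le_trans (lee_wpmul2l _ (fL _ nOz0)); last by rewrite lee_fin.
rewrite /wide_area /tmass -(ge0_integralZl_EFin _ mW td0 mtd cC0).
rewrite /area2 [leLHS]integral_mkcond [leRHS]integral_mkcond.
have n0 (u : R[i]) : 0 <= Normc.normc u by case: u => a b; exact: sqrtr_ge0.
apply: le_integral_nonneg => z _.
  rewrite patchE; case: ifPn => // /set_mem[zt _].
  by rewrite (area_integrandE dbl)// lee_fin divr_ge0 ?sqr_ge0// mulr_ge0 ?ltW ?(vol_gt0 dbl).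
rewrite patchE; case: ifPn => [/set_mem cz|_]; last first.
  rewrite patchE; case: ifPn => // /set_mem Wz.
  by rewrite mule_ge0 ?td0// lee_fin.
have [zt xz] := cz.
have [zO|nzO] := pselect (tent3 O z).
  rewrite gO// /Normc.normc/= expr0n/= addr0 sqrtr0 expr0n/= !mul0e patchE.
  case: ifPn => // /set_mem Wz; by rewrite mule_ge0 ?td0// lee_fin.
rewrite patchE mem_set; last exact: coneO.
rewrite (area_integrandE dbl)// /tdens zt -EFinM lee_fin.
have vx := vol_gt0 dbl x zt; have vz := vol_gt0 dbl z.1 zt.
have -> : c ^+ 2 * C1 * (Normc.normc (f z) ^+ 2 / (vol mu z.1 z.2 * z.2)) =
    (c * Normc.normc (f z)) ^+ 2 * (C1 / (vol mu z.1 z.2 * z.2)).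
  by rewrite exprMn; ring.
apply: ler_pM.
- exact: sqr_ge0.
- by rewrite invr_ge0 mulr_ge0 ?ltW.
- by rewrite ler_sqr ?nnegrE ?mulr_ge0 ?n0 ?gf.
rewrite -[leRHS]invrK lef_pV2 ?posrE ?invr_gt0 ?mulr_gt0 ?invr_gt0 ?mulr_gt0//.
rewrite invfM invrK mulrA ler_pM2r// ler_pdivrMl//.
rewrite -[C1]expr1; apply: (le_vol open_meas dbl) => //.
by rewrite expr1; lra.
Qed.

End OutsideTent.

(** * Norms of indicators *)

Section GlobalMass.
Context {R : realType} {d : measure_display} {X : metricMeasurableType R d}.
Variable mu : {measure set X -> \bar R}.
Variable C1 : R.
Hypothesis open_meas : forall U : set X, open U -> measurable U.
Hypothesis dbl : doubling_with mu C1.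
Variable w : X -> R.
Hypothesis w_gt0 : forall x, 0 < w x.
Hypothesis w_meas : measurable_fun setT w.
Variable K : R.
Hypothesis K_gt0 : 0 < K.
Hypothesis w_Ainf : Ainf_cond mu w 2^-1 K.

Let w_ge0 x : 0 <= w x. Proof. exact: ltW. Qed.

Let mb (x : X) (r : R) : measurable (ball x r).
Proof. exact: measurable_mball. Qed.

Let Bn (n : nat) : set X := ball point n.+1%:R.

Let Bn0 n : 0 < (n.+1%:R : R). Proof. by []. Qed.

Let mBn n : measurable (Bn n). Proof. exact: mb. Qed.

Let ndB : nondecreasing_seq Bn.
Proof.
move=> m n mn; apply/subsetPset; apply: mball_subset.
by rewrite mdistxx add0r ler_nat.
Qed.

Let BnT : \bigcup_n Bn n = setT. Proof. exact: mball_bigcup. Qed.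

Let cvg_wint_setT : wint mu w (Bn n) @[n --> \oo] --> wint mu w setT.
Proof.
rewrite -BnT; apply: ge0_nondecreasing_set_cvg_integral => //.
- by move=> n; apply/measurable_EFinP; exact: measurable_funTS.
- by move=> n x _; rewrite lee_fin.
Qed.

Let wint_setT_le (c : \bar R) :
  (forall n, (wint mu w (Bn n) <= c)%E) -> (wint mu w setT <= c)%E.
Proof.
move=> h; rewrite -(cvg_lim _ cvg_wint_setT)//; apply: lime_le.
  by apply/cvg_ex; eexists; exact: cvg_wint_setT.
exact: nearW.
Qed.

Let cvg_mu_setT : mu (Bn n) @[n --> \oo] --> mu setT.
Proof.
rewrite -[in mu setT]BnT; apply: nondecreasing_cvg_mu => //.
by rewrite BnT.
Qed.

Let exists_mu_gt (c : \bar R) : (c < mu setT)%E -> exists n, (c < mu (Bn n))%E.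
Proof.
move=> cT; apply: contrapT => h; move: cT; rewrite ltNge => /negP; apply.
rewrite -(cvg_lim _ cvg_mu_setT)//; apply: lime_le.
  by apply/cvg_ex; eexists; exact: cvg_mu_setT.
by apply: nearW => n; rewrite leNgt; apply/negP => ?; apply: h; exists n.
Qed.

Lemma wint_ball_gt0 x r : 0 < r -> (0 < wint mu w (ball x r))%E.
Proof.
move=> r0; apply: integral_gt0 => //.
- by apply/measurable_EFinP; exact: measurable_funTS.
- by move=> y _; rewrite lte_fin.
- by have [] := dbl x r0.
Qed.

(** Some sublevel set of [w] fills half of the ball. Its weight is finite, and the A_infinity
    property carries this to the ball. *)
Lemma wint_ball_fin x r : 0 < r -> (wint mu w (ball x r) < +oo)%E.
Proof.
move=> r0; pose E (n : nat) := ball x r `&` [set y | w y <= n%:R].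
have mE n : measurable (E n).
  apply: measurableI => //.
  have -> : [set y | w y <= n%:R] = w @^-1` `]-oo, n%:R]%classic.
    by apply/seteqP; split=> y; rewrite /= in_itv.
  by rewrite -[X in measurable X]setTI; exact: w_meas.
have ndE : nondecreasing_seq E.
  move=> m n mn; apply/subsetPset => y [xy ym]; split => //.
  by apply: le_trans ym _; rewrite ler_nat.
have ET : \bigcup_n E n = ball x r.
  apply/seteqP; split=> [y [n _ []]//|y xy].
  exists (Num.truncn (w y)).+1 => //; split => //.
  exact/ltW/truncnS_gt.
have cvgE : mu (E n) @[n --> \oo] --> mu (ball x r).
  by rewrite -ET; apply: nondecreasing_cvg_mu => //; rewrite ET.
have v0 := vol_gt0 dbl x r0.
have [n nE] : exists n, (2^-1%:E * mu (ball x r) <= mu (E n))%E.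
  apply: contrapT => h.
  have : (mu (ball x r) <= 2^-1%:E * mu (ball x r))%E.
    rewrite -[leLHS](cvg_lim _ cvgE)//; apply: lime_le.
      by apply/cvg_ex; eexists; exact: cvgE.
    by apply: nearW => n; rewrite leNgt; apply/negP => /ltW ?; apply: h; exists n.
  by rewrite (mu_mball dbl)// -EFinM lee_fin; lra.
apply: le_lt_trans (w_Ainf r0 (mE n) (@subIsetl _ _ _) nE) _.
rewrite lte_mul_pinfty ?lee_fin ?ltW//.
apply: (@le_lt_trans _ _ (\int[mu]_(y in E n) (n%:R%:E))%E).
  by apply: le_integral_nonneg => y [_ /= yn]; rewrite lee_fin.
rewrite integral_cst// lte_mul_pinfty ?lee_fin//.
apply: (@le_lt_trans _ _ (mu (ball x r))); last by have [] := dbl x r0.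
by apply: le_measure; rewrite ?inE// => y [].
Qed.

(** A ball with more than half of the total measure controls, up to the factor [K], the weight of
    every larger ball. *)
Lemma wint_setT_fin : (mu setT < +oo)%E -> (wint mu w setT < +oo)%E.
Proof.
move=> muT.
have muT0 : (0 < mu setT)%E.
  apply: lt_le_trans (_ : mu (Bn 0) <= _)%E; first by have [] := dbl point (Bn0 0).
  by apply: le_measure; rewrite ?inE.
have [n nT] : exists n, (2^-1%:E * mu setT < mu (Bn n))%E.
  apply: exists_mu_gt; move: muT0 muT; case: (mu setT) => // m.
  by rewrite -EFinM !lte_fin; lra.
apply: (@le_lt_trans _ _ (K%:E * wint mu w (Bn n))%E); last first.
  by rewrite lte_mul_pinfty ?lee_fin ?(ltW K_gt0)//; exact: wint_ball_fin.
apply: wint_setT_le => m.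
have [nm|/ltnW mn] := leqP n m.
  apply: w_Ainf => //; first by apply/subsetPset/ndB.
  apply: le_trans (ltW nT); apply: lee_wpmul2l; first by rewrite lee_fin.
  by apply: le_measure; rewrite ?inE.
apply: (@le_trans _ _ (wint mu w (Bn n))).
  by apply: le_wint => //; exact/subsetPset/ndB.
apply: w_Ainf => //; rewrite -[leRHS]mul1e; apply: lee_wpmul2r => //.
by rewrite lee_fin; lra.
Qed.

(** Each ball sits in one of at least twice its measure, and the difference carries at least [K^-1]
    times the weight of the larger ball. If the total weight [W] were finite, every ball would weigh
    at most [W / (1 + K^-1)], and so would X. *)
Lemma wint_setT_infty : mu setT = +oo%E -> wint mu w setT = +oo%E.
Proof.
move=> muT; apply/eqP; rewrite -leye_eq leNgt; apply/negP => wT.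
pose W := fine (wint mu w setT).
have WE : wint mu w setT = W%:E by rewrite fineK// ge0_fin_numE// wint_ge0.
have wB n : wint mu w (Bn n) = (fine (wint mu w (Bn n)))%:E.
  by rewrite fineK// ge0_fin_numE ?wint_ge0//; exact: wint_ball_fin.
have grow n : (wint mu w (Bn n) <= (W / (1 + K^-1))%:E)%E.
  have [m nm] : exists m, (2%:E * mu (Bn n) < mu (Bn m))%E.
    apply: exists_mu_gt; rewrite muT lte_mul_pinfty ?lee_fin//.
    by have [] := dbl point (Bn0 n).
  have nm' : (n <= m)%N.
    rewrite leqNgt; apply/negP => /ltnW mn.
    have : (mu (Bn m) <= mu (Bn n))%E.
      by apply: le_measure; rewrite ?inE//; exact/subsetPset/ndB.
    rewrite leNgt => /negP; apply; apply: le_lt_trans nm.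
    rewrite -[leLHS]mul1e; apply: lee_wpmul2r => //.
    by rewrite lee_fin; lra.
  pose E := Bn m `\` Bn n.
  have mE : measurable E by exact: measurableD.
  have muE : (2^-1%:E * mu (Bn m) <= mu E)%E.
    have : mu (Bn m) = (mu E + mu (Bn m `&` Bn n))%E by exact: measureDI.
    rewrite setIidr; last exact/subsetPset/ndB.
    have [_ h1 _] := dbl point (Bn0 n); have [_ h2 _] := dbl point (Bn0 m).
    move: nm; rewrite /Bn !(mu_mball dbl)//.
    case: (mu E) => [e| |]//; rewrite ?leey// -!EFinM -?EFinD lte_fin => h [h3].
    by rewrite lee_fin; lra.
  have h1 := w_Ainf (Bn0 m) mE (@subDsetl _ _ _) muE.
  have h2 : wint mu w (Bn m) = (wint mu w (Bn n) + wint mu w E)%E.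
    rewrite -wintU_disj//; last by rewrite /E setDIK.
    by rewrite /E setDUK//; exact/subsetPset/ndB.
  have h3 : (wint mu w (Bn m) <= W%:E)%E.
    by rewrite -WE; apply: le_wint.
  have h4 : (wint mu w (Bn n) <= wint mu w (Bn m))%E.
    by apply: le_wint => //; exact/subsetPset/ndB.
  have e0 := wint_ge0 mu w_ge0 E.
  move: h1 h2 h3 h4 e0; rewrite -/(Bn m) (wB n) (wB m).
  case: (wint mu w E) => // e.
  rewrite -EFinD -EFinM !lee_fin => h1 -[h2] h3 h4 e0.
  rewrite ler_pdivlMr ?addr_gt0 ?invr_gt0//.
  have : K^-1 * fine (wint mu w (Bn m)) <= e by rewrite ler_pdivrMl.
  have : K^-1 * fine (wint mu w (Bn n)) <= K^-1 * fine (wint mu w (Bn m)).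
    by rewrite ler_wpM2l ?invr_ge0 ?(ltW K_gt0).
  lra.
have := wint_setT_le grow; rewrite WE lee_fin ler_pdivlMr ?addr_gt0 ?invr_gt0//.
have W0 : 0 < W.
  rewrite -lte_fin -WE; apply: lt_le_trans (wint_ball_gt0 point (Bn0 0)) _.
  by apply: le_wint.
by rewrite mulrDr mulr1 gerDl leNgt mulr_gt0 ?invr_gt0.
Qed.

End GlobalMass.

Section NormOfIndicator.
Context {R : realType} {d : measure_display} {X : metricMeasurableType R d}.
Variable mu : {measure set X -> \bar R}.
Variable phi : X -> R -> R.
Hypothesis phi_orlicz : forall x, orlicz (phi x).
Hypothesis phi_meas : forall t : R, 0 <= t -> measurable_fun setT (fun x => phi x t).
Variables (p Cl : R).
Hypothesis p01 : 0 < p <= 1.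
Hypothesis Cl0 : 0 < Cl.
Hypothesis phi_lower : forall (x : X) (t r : R), 0 <= t -> 0 <= r -> r <= 1 ->
  phi x (r * t) <= Cl * r `^ p * phi x t.

Let mphi (E : set X) (t : R) : 0 <= t -> measurable_fun E (fun x => (phi x t)%:E).
Proof. by move=> t0; apply/measurable_EFinP; exact: measurable_funTS (phi_meas t0). Qed.

Lemma phi_int_ge0 (E : set X) (t : R) : 0 <= t -> (0 <= phi_int mu phi E t)%E.
Proof. by move=> t0; apply: integral_ge0 => x _; rewrite lee_fin phi_ge0. Qed.

Lemma phi_int_lower (E : set X) (t r : R) : measurable E -> 0 <= t -> 0 <= r -> r <= 1 ->
  (phi_int mu phi E (r * t) <= (Cl * r `^ p)%:E * phi_int mu phi E t)%E.
Proof.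
move=> mE t0 r0 r1; have c0 : 0 <= Cl * r `^ p by rewrite mulr_ge0 ?powR_ge0 ?ltW.
rewrite /phi_int -(ge0_integralZl_EFin _ mE _ (mphi t0) c0); last first.
  by move=> x _; rewrite lee_fin phi_ge0.
apply: le_integral_nonneg => x _; first by rewrite lee_fin phi_ge0// mulr_ge0.
by rewrite -EFinM lee_fin; exact: phi_lower.
Qed.

Lemma norm_indE (E : set X) (l : R) : 0 < l ->
  (\int[mu]_x phi_ext phi x (`|(EFin \o \1_E) x| * (l^-1)%:E) =
   phi_int mu phi E l^-1)%E.
Proof.
move=> l0; rewrite /phi_int [RHS]integral_mkcond; apply: eq_integral => x _.
rewrite patchE /= indicE; case: (x \in E) => /=.
  by rewrite normr1 mul1r.
by rewrite normr0 mul0r; have [-> _ _ _] := phi_orlicz x.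
Qed.

(** Lower type compares the modular at [l] with that at 1 up to a power [p] of [l], which bounds the
    admissible [l] from below and exhibits one of them. *)
Lemma norm_ind_gt0_fin (E : set X) : measurable E ->
  (0 < phi_int mu phi E 1)%E -> (phi_int mu phi E 1 < +oo)%E ->
  exists2 N : R, 0 < N & norm_ind mu phi E = N%:E.
Proof.
move=> mE I0 Ioo; have /andP[p0 p1] := p01.
pose J := fine (phi_int mu phi E 1).
have JE : phi_int mu phi E 1 = J%:E by rewrite fineK// ge0_fin_numE ?ltW.
have J0 : 0 < J by rewrite -lte_fin -JE.
set N := norm_ind mu phi E.
(* For [l <= 1], a modular at most 1 at [l] forces [J <= Cl * l ^ p]; this is the resulting
   threshold. *)
pose l0 := Num.min 1 ((J / Cl) `^ p^-1).
have l00 : 0 < l0 by rewrite lt_min ltr01 powR_gt0 ?divr_gt0.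
have lower : (l0%:E <= N)%E.
  apply: le_ereal_inf_tmp => _ [l [l_gt0 lE] <-]; rewrite lee_fin.
  have [l1|/ltW l1] := leP 1 l; first by rewrite ge_min l1.
  rewrite ge_min; apply/orP; right.
  move: lE; rewrite norm_indE// => lE.
  have := @phi_int_lower E l^-1 l mE _ _ l1; rewrite invr_ge0 (ltW l_gt0) => /(_ isT isT).
  rewrite mulfV ?gt_eqF// JE => /le_trans/(_ (lee_wpmul2l _ lE)).
  have c0 : 0 <= Cl * l `^ p by rewrite mulr_ge0 ?powR_ge0 ?ltW.
  rewrite lee_fin c0 mule1 lee_fin => /(_ isT) h.
  have {}h : J / Cl <= l `^ p by rewrite ler_pdivrMr// mulrC.
  have -> : l = (l `^ p) `^ p^-1 by rewrite -powRrM divff ?gt_eqF// powRr1// ltW.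
  apply: ge0_ler_powR => //; rewrite ?nnegrE ?powR_ge0 ?invr_ge0 ?(ltW p0)//.
  by rewrite divr_ge0// ltW.
have upper : (N < +oo)%E.
  pose l := Num.max 1 ((Cl * J) `^ p^-1).
  have l1 : 1 <= l by rewrite le_max lexx.
  have l_gt0 : 0 < l by exact: lt_le_trans l1.
  apply: (@le_lt_trans _ _ l%:E); last exact: ltry.
  apply: ereal_inf_lbound; exists l => //; split => //.
  rewrite norm_indE//.
  have := @phi_int_lower E 1 l^-1 mE ler01; rewrite invr_ge0 (ltW l_gt0) invf_le1// l1.
  rewrite mulr1 => /(_ isT isT) /le_trans; apply.
  rewrite JE -EFinM lee_fin.
  have -> : l^-1 `^ p = (l `^ p)^-1.
    have h : l^-1 `^ p * l `^ p = 1.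
      by rewrite -powRM ?invr_ge0 ?(ltW l_gt0)// mulVf ?gt_eqF// powR1.
    by rewrite -[RHS]mul1r -h mulfK ?gt_eqF ?powR_gt0.
  rewrite mulrAC ler_pdivrMr ?powR_gt0// mul1r.
  have -> : Cl * J = ((Cl * J) `^ p^-1) `^ p.
    by rewrite -powRrM mulVf ?gt_eqF// powRr1// mulr_ge0// ltW.
  apply: ge0_ler_powR; rewrite ?nnegrE ?powR_ge0 ?(ltW p0) ?(ltW l_gt0)//.
  by rewrite le_max lexx orbT.
exists (fine N); last by rewrite fineK// ge0_fin_numE// (le_trans _ lower)// lee_fin ltW.
by rewrite fine_gt0// upper andbT (lt_le_trans _ lower).
Qed.

End NormOfIndicator.

Section TentNorm.
Context {R : realType} {d : measure_display} {X : metricMeasurableType R d}.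
Variable mu : {sigma_finite_measure set X -> \bar R}.

Lemma T2_norm_le (p c : R) (E : set X) (g : X * R -> R[i]) :
  1 < p -> 0 <= c -> measurable E ->
  (forall x, E x -> (area2 mu g x <= (c ^+ 2)%:E)%E) ->
  (forall x, ~ E x -> area2 mu g x = 0%E) ->
  (T2_norm mu p g <= mu E `^ p^-1 * c%:E)%E.
Proof.
move=> p1 c0 mE gE gnE; have p0 : 0 < p by lra.
rewrite /T2_norm unlock.
have areaE x : (`|area mu g x| `^ p <= (cst (c `^ p)%:E \_ E) x)%E.
  rewrite patchE; case: ifPn => [/set_mem Ex|nEx]; last first.
    have -> : area mu g x = 0%E.
      rewrite areaE gnE ?poweR0r ?invr_eq0 ?pnatr_eq0//.
      by move=> Ex; move: nEx; rewrite mem_set.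
    by rewrite abse0 poweR0r ?gt_eqF.
  rewrite gee0_abs ?poweR_ge0// -poweR_EFin.
  apply: gt0_ler_poweR; rewrite ?(ltW p0)//.
  - by rewrite in_itv/= poweR_ge0 leey.
  - by rewrite in_itv/= lee_fin c0 leey.
  rewrite areaE; have -> : (c%:E = (c ^+ 2)%:E `^ 2^-1)%E.
    by rewrite poweR_EFin powR12_sqrt ?sqr_ge0// sqrtr_sqr ger0_norm.
  apply: gt0_ler_poweR; rewrite ?invr_ge0//; last exact: gE.
  - by rewrite in_itv/= area2_ge0 leey.
  - by rewrite in_itv/= lee_fin sqr_ge0 leey.
have intE : (\int[mu]_x `|area mu g x| `^ p <= (c `^ p)%:E * mu E)%E.
  rewrite -integral_cst// [leRHS]integral_mkcond.
  by apply: le_integral_nonneg => x _; [exact: poweR_ge0|exact: areaE].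
have i0 : (0 <= \int[mu]_x `|area mu g x| `^ p)%E.
  by apply: integral_ge0 => x _; exact: poweR_ge0.
have := @gt0_ler_poweR R p^-1 _ (\int[mu]_x `|area mu g x| `^ p)%E ((c `^ p)%:E * mu E)%E.
rewrite invr_ge0 (ltW p0) => /(_ isT) h.
apply: le_trans (h _ _ intE) _.
- by rewrite in_itv/= i0 leey.
- by rewrite in_itv/= leey andbT mule_ge0// lee_fin powR_ge0.
rewrite poweRM ?lee_fin ?powR_ge0//.
by rewrite poweR_EFin -powRrM divff ?gt_eqF// powRr1// muleC.
Qed.

Lemma area2_eq0 (g : X * R -> R[i]) x : (forall z, cone x z -> g z = 0) ->
  area2 mu g x = 0%E.
Proof.
move=> g0; apply: integral0_eq => z cz.
by rewrite g0// /Normc.normc/= expr0n/= addr0 sqrtr0 expr0n/= !mul0e.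
Qed.

(** A cone with vertex outside [B] misses the tent over [B]. *)
Lemma area2_tent_eq0 (B : set X) (g : X * R -> R[i]) x :
  (forall z, upper_half z -> g z != 0 -> tent B z) -> ~ B x -> area2 mu g x = 0%E.
Proof.
move=> gB nBx; apply: area2_eq0 => z [z0 xz]; apply: contrapT => /eqP gz.
have [_ zB] := gB z z0 gz.
have : (z.2%:E <= (mdist z.1 x)%:E)%E.
  by apply: le_trans zB _; apply: ereal_inf_lbound; exists x.
by rewrite lee_fin metric_sym leNgt xz.
Qed.

End TentNorm.

(** * Properties of the levels *)

Section PickledSums.
Context {R : realType}.
Local Open Scope ereal_scope.

Lemma sum_uniq_subset_le (T : eqType) (c : T -> \bar R) (L L' : seq T) :
  (forall q, 0 <= c q) -> uniq L -> uniq L' -> {subset L <= L'} ->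
  \sum_(q <- L) c q <= \sum_(q <- L') c q.
Proof.
move=> c0 uL uL' LL'; rewrite [leRHS](bigID (mem L))/=.
have -> : \sum_(q <- L' | q \in L) c q = \sum_(q <- L) c q.
  rewrite -big_filter; apply: perm_big; apply: uniq_perm => //.
    exact: filter_uniq.
  by move=> q; rewrite mem_filter; apply: andb_idr; exact: LL'.
by rewrite leeDl// sume_ge0.
Qed.

(** Passes from the encoded pairs that index the atoms to a rectangle of levels and Whitney indices.
    The window is made to contain [k0], because the slot of that level will hold the term of the
    single atom. *)
Lemma sum_pickle_le (c : int * nat -> \bar R) (k0 : int) (J : nat) :
  (forall q, 0 <= c q) -> exists n : nat, (`|k0| <= n)%N /\
  \sum_(0 <= j < J) (if pickle_inv j is Some q then c q else 0) <=
  \sum_(0 <= m < (n + n).+1) \sum_(0 <= i < n.+1) c ((m%:Z - n%:Z)%R, i).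
Proof.
move=> c0; pose L := pmap (@pickle_inv (int * nat)%type) (iota 0 J).
have uL : uniq L.
  by apply: (pmap_uniq (@pickle_invK _)); exact: iota_uniq.
pose n := (`|k0| + \sum_(q <- L) (`|q.1| + q.2))%N.
exists n; split; first exact: leq_addr.
have Ln q : q \in L -> (`|q.1| <= n)%N /\ (q.2 <= n)%N.
  move=> qL; have : (`|q.1| + q.2 <= n)%N.
    by rewrite /n (big_rem q)//= addnA [(`|k0| + _)%N]addnC -addnA leq_addr.
  by move=> h; split; apply: leq_trans h; rewrite ?leq_addr ?leq_addl.
have -> : \sum_(0 <= j < J) (if pickle_inv j is Some q then c q else 0) =
    \sum_(q <- L) c q.
  rewrite /L /index_iota subn0; elim: (iota 0 J) => [|j l IH]; first by rewrite !big_nil.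
  by rewrite big_cons IH /=; case: pickle_inv => [q|] /=; rewrite ?big_cons ?add0e.
pose L' := [seq ((m%:Z - n%:Z)%R, i) | m <- index_iota 0 (n + n).+1,
  i <- index_iota 0 n.+1].
have -> : \sum_(0 <= m < (n + n).+1) \sum_(0 <= i < n.+1) c ((m%:Z - n%:Z)%R, i) =
    \sum_(q <- L') c q by rewrite big_allpairs_dep.
apply: sum_uniq_subset_le => //.
  apply: allpairs_uniq; rewrite ?iota_uniq//.
  by move=> [m i] [m' i'] _ _ /= [/addIr[->] ->].
move=> [k i] /Ln/= [kn iN].
apply/allpairsP; exists (`|(k + n%:Z)%R|%N, i) => /=.
have kn0 : (0 <= k + n%:Z)%R.
  by rewrite -lerBlDr sub0r lerNl; apply: le_trans (ler_norm _) _; rewrite normrN -abszE lez_nat.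
have knE : (`|(k + n%:Z)%R|%N%:Z = k + n%:Z)%R by rewrite gez0_abs.
split.
- rewrite mem_index_iota/= ltnS -lez_nat knE PoszD lerD2r.
  by apply: le_trans (ler_norm _) _; rewrite -abszE lez_nat.
- by rewrite mem_index_iota/= ltnS.
- by rewrite knE addrK.
Qed.

End PickledSums.

Section LevelFacts.
Context {R : realType} {d : measure_display} {X : metricMeasurableType R d}.
Variable mu : {sigma_finite_measure set X -> \bar R}.
Variable C1 : R.
Hypothesis open_meas : forall U : set X, open U -> measurable U.
Hypothesis dbl : doubling_with mu C1.
Variable s : nat -> X.
Hypothesis s_dense : dense_seq s.
Variable phi : X -> R -> R.
Hypothesis phi_orlicz : forall x, orlicz (phi x).
Hypothesis phi_meas : forall t : R, 0 <= t -> measurable_fun setT (fun x => phi x t).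

(** The balls may overlap, but their eighths are disjoint inside [O]; three doublings and the
    A_infinity property pay for the enlargement. *)
Lemma whitney_sum_le (Kw : R) (O : set X) (D : set nat) (t : R) (I : nat) :
  0 <= Kw -> 0 < t -> open O -> (exists w, ~ O w) ->
  Ainf_cond mu (phi ^~ t) (C1 ^+ 3)^-1 Kw ->
  (forall i, D i -> O (s i)) ->
  trivIset D (fun i => ball (s i) (codist O (s i) / 8)) ->
  (\sum_(0 <= i < I) (if `[< D i >] then
      phi_int mu phi (ball (s i) (codist O (s i))) t else 0) <=
   Kw%:E * phi_int mu phi O t)%E.
Proof.
move=> Kw0 t0 oO OnT HA DO tD.
have C10 : 0 < C1 by apply: lt_le_trans (doubling_with_ge1 open_meas dbl).
have mb (x : X) (r : R) : measurable (ball x r) by exact: measurable_mball.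
have pos (x : X) : 0 <= phi x t by apply: phi_ge0 => //; exact: ltW.
have mt := phi_meas (ltW t0).
pose F i := ball (s i) (codist O (s i) / 8).
apply: (@le_trans _ _ (\sum_(0 <= i < I | `[< D i >]) (Kw%:E * phi_int mu phi (F i) t))%E).
  rewrite -big_mkcond/=; apply: lee_sum => i /asboolP Di.
  have i0 := codist_gt0 OnT oO (DO _ Di).
  apply: HA => //; first exact: mb.
    by apply: mball_subset; rewrite mdistxx; lra.
  rewrite !(mu_mball dbl) ?divr_gt0// -EFinM lee_fin ler_pdivrMl ?exprn_gt0//.
  by apply: (le_vol open_meas dbl); rewrite ?divr_gt0// mdistxx !exprS expr0; lra.
rewrite -ge0_sume_distrr; last by move=> i _; exact: (wint_ge0 mu pos).
apply: lee_wpmul2l; first by rewrite lee_fin.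
rewrite -big_filter.
have uF : uniq [seq i <- index_iota 0 I | `[< D i >]] by rewrite filter_uniq ?iota_uniq.
have mU : measurable (\big[setU/set0]_(i <- [seq i <- index_iota 0 I | `[< D i >]]) F i).
  by apply: bigsetU_measurable => i _; exact: mb.
rewrite /phi_int -(@ge0_integral_bigsetU _ _ _ mu _ F (fun x => (phi x t)%:E))//.
- apply: (le_wint mu pos mt) => //; first exact: open_meas.
  move=> x; rewrite -bigcup_seq => -[i /=]; rewrite mem_filter => /andP[/asboolP Di _].
  move=> /in_mball ix; apply: (codist_ball OnT (x := s i)); apply/in_mball.
  by have := codist_gt0 OnT oO (DO _ Di); lra.
- by move=> i; exact: mb.
- apply: sub_trivIset tD => i /=; rewrite mem_filter => /andP[/asboolP Di _] //.
- by apply/measurable_EFinP; exact: measurable_funTS.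
- by move=> x _; rewrite lee_fin.
Qed.

Variable f : X * R -> R[i].
Hypothesis f_meas : measurable_upper f.

Local Notation lev := (level mu f).

Lemma level_open k : open (lev k).
Proof. exact: (open_wide_area open_meas dbl s_dense f_meas). Qed.

Lemma levelS (k k' : int) : (k <= k')%R -> lev k' `<=` lev k.
Proof.
move=> kk' x; apply: le_lt_trans; rewrite lee_fin ler_sqr ?nnegrE ?exprz_ge0//.
by rewrite ler_weXz2l// ler1n.
Qed.

Lemma notin_level k x : ~ lev k x -> (wide_area mu f 9 x <= ((2 ^ k) ^+ 2)%:E)%E.
Proof. by move=> nk; rewrite leNgt; apply/negP. Qed.

Local Notation XR := (X * measurableTypeR R)%type.

(** At a point outside every tent, a fixed rational box around it lies, for every [k], in a cone of
    aperture 9 whose vertex is outside [lev k], so its mass is at most [4 ^ k]. Letting [k]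
    decrease, the box has mass zero and [f] vanishes almost everywhere on it; there are countably
    many boxes. *)
Lemma negligible_below_levels :
  (mu \x lebesgue_measure)%E.-negligible
    [set z : XR | [/\ 0 < z.2, (forall k, ~ tent3 (lev k) z) & f z != 0]].
Proof.
pose N (iq : nat * rat) : set XR := ball (s iq.1) (ratr iq.2) `*` `](ratr iq.2), +oo[%classic.
have mN iq : measurable (N iq).
  apply: measurableX; first exact: measurable_mball.
  exact: measurable_itv.
pose bad (j : nat) : set XR := if unpickle j is Some iq then
  [set z | N iq z /\ tmass mu f (N iq) = 0%E /\ tdens mu f z != 0] else set0.
apply: (@negligibleS _ _ _ _ (\bigcup_j bad j)); last first.
  apply: negligible_bigcup => j; rewrite /bad.
  case: unpickle => [iq|]; last exact: negligible_set0.
  have [N0|Nn0] := pselect (tmass mu f (N iq) = 0%E); last first.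
    by apply: (@negligibleS _ _ _ _ set0); [move=> z [_ []]|exact: negligible_set0].
  have mtd : measurable_fun (N iq) (EFin \o tdens mu f).
    have mt : @measurable_fun _ _ XR _ setT (tdens mu f).
      exact: (tdens_meas open_meas dbl s_dense f_meas).
    by apply/measurable_EFinP; exact: measurable_funTS.
  have : ae_eq (mu \x lebesgue_measure)%E (N iq) (EFin \o tdens mu f) (cst 0%E).
    apply/ae_eq_integral_abs => //; rewrite -[RHS]N0 /tmass; apply: eq_integral => z _.
    by rewrite gee0_abs// lee_fin (tdens_ge0 dbl).
  apply: negligibleS => z [Nz [_ zn0]] /= /(_ Nz) [z0].
  by rewrite z0 eqxx in zn0.
move=> z [zt nz fz].
have z20 : 0 < z.2 / 2 by rewrite divr_gt0.
have [i zi] := s_dense z.1 z20.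
have [q] : exists q, ratr q \in `](z.2 / 2), z.2[ by apply: rat_in_itvoo; lra.
rewrite in_itv/= => /andP[q1 q2].
have tdz : tdens mu f z != 0.
  have n0 : 0 < Normc.normc (f z).
    rewrite lt_neqAle eq_sym; apply/andP; split.
      by apply: contra fz => /eqP/Normc.eq0_normc ->.
    by case: (f z) => a b; exact: sqrtr_ge0.
  by rewrite /tdens zt; apply: lt0r_neq0; rewrite divr_gt0 ?exprn_gt0 ?mulr_gt0 ?(vol_gt0 dbl).
exists (pickle (i, q)) => //; rewrite /bad pickleK; split; last split => //.
  split => /=; first by apply/in_mball; rewrite metric_sym; lra.
  by rewrite in_itv/= q2.
apply/eqP; rewrite eq_le (tmass_ge0 dbl) andbT; apply/lee_addgt0Pr => e e0.
rewrite add0e.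
pose m := Num.truncn e^-1.
have [w nw zw] := notin_tent3 zt (nz (- (m.+1)%:Z)).
apply: (@le_trans _ _ (wide_area mu f 9 w)).
  apply: (le_tmass open_meas dbl s_dense f_meas) => //.
    exact: (measurable_wide_cone open_meas s_dense).
  (* The distance from [w] to [z'.1] is below [3 * z.2 + z.2 / 2 + q], which is below [8 * q] since
     [z.2 < 2 * q], and [q < z'.2]. *)
  move=> z' [/= /in_mball iz']; rewrite in_itv/= andbT => qz'; split; first lra.
  have := metric_triangle w z.1 z'.1; have := metric_triangle z.1 (s i) z'.1.
  by rewrite (metric_sym w z.1); lra.
apply: le_trans (notin_level nw) _; rewrite lee_fin.
have p1 : 1 <= (2 : R) ^+ m.+1 by rewrite exprn_ege1// ler1n.
rewrite -exprnN exprVn -exprM; apply: (@le_trans _ _ ((2 : R) ^+ m.+1)^-1).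
  rewrite lef_pV2 ?posrE ?exprn_gt0//.
  by apply: ler_weXn2l; rewrite ?ler1n// leq_pmulr.
rewrite -[leRHS]invrK lef_pV2 ?posrE ?invr_gt0 ?exprn_gt0//.
apply: le_trans (ltW (truncnS_gt _)) _; rewrite -/m -natrX ler_nat.
exact/ltnW/ltn_expl.
Qed.

Section FiniteEnergy.
Variables (KL : R).
Hypothesis KL0 : 0 < KL.
Hypothesis level_sum : forall (l : R) (n N : nat), 0 < l ->
  (\sum_(0 <= m < N) phi_int mu phi (lev (m%:Z - n%:Z)) (2 ^ (m%:Z - n%:Z) / l) <=
   KL%:E * \int[mu]_x phi_ext phi x (`|area mu f x| * (l^-1)%:E))%E.
Hypothesis f_Lphi : (\int[mu]_x phi_ext phi x `|area mu f x| < +oo)%E.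

Let energy := (\int[mu]_x phi_ext phi x `|area mu f x|)%E.

Let phi_ext_ge0 x u : (0 <= u)%E -> (0 <= phi_ext phi x u)%E.
Proof. by case: u => [r| |]//; rewrite !lee_fin => r0; exact: phi_ge0. Qed.

Let energy_ge0 : (0 <= energy)%E.
Proof. by apply: integral_ge0 => x _; exact: phi_ext_ge0. Qed.

Let level_sum1 (n N : nat) :
  (\sum_(0 <= m < N) phi_int mu phi (lev (m%:Z - n%:Z)) (2 ^ (m%:Z - n%:Z)) <=
   KL%:E * energy)%E.
Proof.
have := @level_sum 1 n N ltr01; rewrite invr1.
by under eq_bigr do rewrite mulr1; under eq_integral do rewrite mule1.
Qed.

Lemma level_mass_fin (k : int) : (phi_int mu phi (lev k) (2 ^ k) < +oo)%E.
Proof.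
have [m [n ->]] : exists m n : nat, k = m%:Z - n%:Z.
  case: k => m; first by exists m, 0%N; rewrite subr0.
  by exists 0%N, m.+1; rewrite NegzE sub0r.
apply: (@le_lt_trans _ _ (KL%:E * energy)%E); last first.
  by rewrite lte_mul_pinfty ?lee_fin ?(ltW KL0).
apply: le_trans (level_sum1 n m.+1).
rewrite big_nat_recr//= leeDr// sume_ge0// => i _.
by apply: phi_int_ge0 => //; exact: exprz_ge0.
Qed.

(** Otherwise one ball lies in all levels [k >= 0], and each of them contributes at least the same
    positive mass to a sum whose bound is finite. *)
Lemma tent3_level_bounded (z : X * R) : 0 < z.2 ->
  exists k : nat, ~ tent3 (lev k%:Z) z.
Proof.
move=> z0; apply: contrapT => h.
have z3 : 0 < 3 * z.2 by rewrite mulr_gt0.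
have sub (k : nat) : ball z.1 (3 * z.2) `<=` lev k%:Z.
  have [] : tent3 (lev k%:Z) z by apply: contrapT => nk; apply: h; exists k.
  by [].
set b := phi_int mu phi (ball z.1 (3 * z.2)) 1.
have mb : measurable (ball z.1 (3 * z.2)) by exact: measurable_mball.
have b0 : (0 < b)%E.
  apply: integral_gt0 => //.
  - by apply/measurable_EFinP; apply: measurable_funTS; exact: phi_meas.
  - by move=> x _; rewrite lte_fin; apply: phi_gt0.
  - by have [] := dbl z.1 z3.
have le_b (k : nat) : (b <= phi_int mu phi (lev k%:Z) (2 ^ k%:Z))%E.
  have k0 : 0 <= (2 : R) ^ k%:Z by exact: exprz_ge0.
  apply: (@le_trans _ _ (phi_int mu phi (lev k%:Z) 1)).
    apply: (@le_wint _ _ _ mu (phi ^~ 1)) => //; last exact: open_meas (level_open k%:Z).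
    - by move=> x; exact: phi_ge0.
    - exact: phi_meas.
  apply: le_integral_nonneg => x _; first by rewrite lee_fin phi_ge0.
  rewrite lee_fin; have [_ mon _ _] := phi_orlicz x; apply: mon => //.
  by rewrite exprn_ege1// ler1n.
have bE : b = (fine b)%:E.
  by rewrite fineK// ge0_fin_numE ?ltW//; exact: le_lt_trans (le_b 0%N) (level_mass_fin _).
have eE : energy = (fine energy)%:E by rewrite fineK// ge0_fin_numE.
have bN (N : nat) : N%:R * fine b <= KL * fine energy.
  rewrite -lee_fin (EFinM KL) -eE; apply: le_trans (level_sum1 0 N).
  rewrite mulr_natl -[X in (fine b *+ X)%R]subn0 -sumr_const_nat -sumEFin -bE.
  by apply: lee_sum => m _; rewrite subr0.
have {}b0 : 0 < fine b by rewrite -lte_fin -bE.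
have := bN (Num.truncn (KL * fine energy / fine b)).+1.
by rewrite leNgt -ltr_pdivrMr// truncnS_gt.
Qed.

End FiniteEnergy.

End LevelFacts.

(** * Cut functions as atoms *)

Section CutAtoms.
Context {R : realType} {d : measure_display} {X : metricMeasurableType R d}.
Variable mu : {sigma_finite_measure set X -> \bar R}.
Variable C1 : R.
Hypothesis open_meas : forall U : set X, open U -> measurable U.
Hypothesis dbl : doubling_with mu C1.
Variable s : nat -> X.
Hypothesis s_dense : dense_seq s.
Variable phi : X -> R -> R.
Variable f : X * R -> R[i].
Hypothesis f_meas : measurable_upper f.

Definition cut (r : R) (S : set (X * R)) (z : X * R) : R[i] :=
  if `[< S z >] then (r^-1)%:C%C * f z else 0.

Lemma normc_real (r : R) (u : R[i]) :
  Normc.normc (r%:C%C * u) = `|r| * Normc.normc u.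
Proof. by rewrite Normc.normcM /= expr0n/= addr0 sqrtr_sqr. Qed.

Lemma cut_meas r S : measurable S -> measurable_upper (cut r S).
Proof.
move=> mS; have mU := measurable_upper_half open_meas s_dense.
have mS' : measurable_fun setT (fun z : X * R => `[< S z >]).
  apply: (measurable_fun_bool true).
  rewrite setTI (_ : _ @^-1` _ = S)//.
  by apply/seteqP; split=> z; rewrite /= => /asboolP.
have ReE (z : X * R) : complex.Re (cut r S z) =
    if `[< S z >] then r^-1 * complex.Re (f z) else 0.
  by rewrite /cut; case: ifP => // _; case: (f z) => a b /=; rewrite mul0r subr0.
have ImE (z : X * R) : complex.Im (cut r S z) =
    if `[< S z >] then r^-1 * complex.Im (f z) else 0.
  by rewrite /cut; case: ifP => // _; case: (f z) => a b /=; rewrite mul0r addr0.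
have [mRe mIm] := f_meas.
split; [under eq_fun do rewrite ReE|under eq_fun do rewrite ImE].
  apply: (measurable_fun_if mU); first exact: measurable_funTS.
    by apply: measurable_funM => //; apply: measurable_funS mRe.
  exact: measurable_cst.
apply: (measurable_fun_if mU); first exact: measurable_funTS.
  by apply: measurable_funM => //; apply: measurable_funS mIm.
exact: measurable_cst.
Qed.

Lemma cutK r S z : r != 0 -> S z -> r%:C%C * cut r S z = f z.
Proof.
move=> r0 Sz; rewrite /cut asboolT// mulrA.
by rewrite -rmorphM /= mulfV// rmorph1 mul1r.
Qed.

Lemma cut0 r S z : ~ S z -> cut r S z = 0.
Proof. by move=> nSz; rewrite /cut asboolF. Qed.

Lemma area2_cut_le (k : int) (N : R) (S : set (X * R)) x : 0 < N ->
  (exists w, ~ level mu f k w) -> (forall z, S z -> ~ tent3 (level mu f k) z) ->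
  (area2 mu (cut (C1 * 2 ^ k * N) S) x <= (N^-1 ^+ 2)%:E)%E.
Proof.
move=> N0 lnT Sout; set r := C1 * 2 ^ k * N.
have C11 := doubling_with_ge1 open_meas dbl.
have C10 : 0 < C1 by lra.
have k0 : 0 < (2 : R) ^ k by rewrite exprz_gt0.
have r0 : 0 < r by rewrite !mulr_gt0.
have ri0 : 0 <= r^-1 by rewrite invr_ge0 ltW.
have oL := level_open open_meas dbl s_dense f_meas k.
have L0 : (0 <= ((2 ^ k) ^+ 2)%:E :> \bar R)%E by rewrite lee_fin sqr_ge0.
have gle (z : X * R) : 0 < z.2 ->
    Normc.normc (cut r S z) <= r^-1 * Normc.normc (f z).
  move=> _; rewrite /cut; case: ifP => _.
    by rewrite normc_real ger0_norm.
  rewrite /Normc.normc/= expr0n/= addr0 sqrtr0 mulr_ge0//.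
  by case: (f z) => a b; exact: sqrtr_ge0.
have g0 z : tent3 (level mu f k) z -> cut r S z = 0.
  by move=> tz; apply: cut0 => Sz; exact: Sout Sz tz.
have fL z0 := @notin_level _ _ _ mu f k z0.
apply: le_trans (area2_outside_tent3 open_meas dbl s_dense f_meas x ri0 oL lnT L0
  fL gle g0) _.
rewrite -EFinM lee_fin.
(* The scale contains [C1] rather than its square root; the excess is the harmless factor
   [C1^-1]. *)
have -> : r^-1 ^+ 2 * C1 * (2 ^ k) ^+ 2 = C1^-1 * N^-1 ^+ 2.
  by rewrite /r; field; rewrite !gt_eqF.
by rewrite ler_piMl ?sqr_ge0// invf_le1.
Qed.

Lemma cut_atom (k : int) (N : R) (S : set (X * R)) (B : set X) : measurable B ->
  0 < N -> norm_ind mu phi B = N%:E -> measurable S ->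
  (exists w, ~ level mu f k w) -> (forall z, S z -> ~ tent3 (level mu f k) z) ->
  (forall z, S z -> tent B z) ->
  atom mu phi B (cut (C1 * 2 ^ k * N) S).
Proof.
move=> mB N0 NE mS lnT Sout SB p p1; have sup z : upper_half z ->
    cut (C1 * 2 ^ k * N) S z != 0 -> tent B z.
  move=> _ cz; apply: SB; apply: contrapT => nSz.
  by rewrite cut0// eqxx in cz.
split => //; first exact: cut_meas.
rewrite NE inver gt_eqF//; apply: T2_norm_le => //.
- by rewrite invr_ge0 ltW.
- by move=> x _; exact: area2_cut_le.
- by move=> x; exact: area2_tent_eq0.
Qed.

Lemma cut_single_atom (k : int) (N : R) (S : set (X * R)) :
  0 < N -> norm_ind mu phi setT = N%:E -> measurable S ->
  (exists w, ~ level mu f k w) -> (forall z, S z -> ~ tent3 (level mu f k) z) ->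
  single_atom mu phi (cut (C1 * 2 ^ k * N) S).
Proof.
move=> N0 NE mS lnT Sout p p1; split; first exact: cut_meas.
rewrite NE inver gt_eqF//; apply: T2_norm_le => //.
- by rewrite invr_ge0 ltW.
- by move=> x _; exact: area2_cut_le.
- by move=> x nTx; exfalso; exact: nTx.
Qed.

End CutAtoms.

Section ZeroAtoms.
Context {R : realType} {d : measure_display} {X : metricMeasurableType R d}.
Variable mu : {sigma_finite_measure set X -> \bar R}.
Variable phi : X -> R -> R.

Let zero_fun : X * R -> R[i] := fun=> 0.

Lemma norm_ind_ge0 (B : set X) : (0 <= norm_ind mu phi B)%E.
Proof. by apply: le_ereal_inf_tmp => _ [l [l0 _] <-]; rewrite lee_fin ltW. Qed.

Let T2_zero (p : R) : 1 < p -> (T2_norm mu p zero_fun <= 0)%E.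
Proof.
move=> p1; have := @T2_norm_le _ _ _ mu p 0 set0 zero_fun p1 (lexx _) measurable0.
rewrite mule0; apply => // x _; exact: area2_eq0.
Qed.

(** Fills the indices of the sequence that encode no cell. *)
Lemma zero_atom (B : set X) : atom mu phi B zero_fun.
Proof.
move=> p p1; split.
- by split; exact: measurable_cst.
- by move=> z _; rewrite eqxx.
- apply: le_trans (T2_zero p1) _.
  by rewrite mule_ge0 ?poweR_ge0// inve_ge0 norm_ind_ge0.
Qed.

Lemma zero_single_atom : single_atom mu phi zero_fun.
Proof.
move=> p p1; split; first by split; exact: measurable_cst.
apply: le_trans (T2_zero p1) _.
by rewrite mule_ge0 ?poweR_ge0// inve_ge0 norm_ind_ge0.
Qed.

End ZeroAtoms.

(** * The decomposition *)

Lemma int_threshold (T : int -> Prop) (k1 k2 : int) :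
  (forall k k', (k <= k')%R -> T k' -> T k) -> T k1 -> ~ T k2 ->
  exists k, T k /\ ~ T (k + 1).
Proof.
move=> Tdown T1 nT2; apply: contrapT => h.
have step k : T k -> T (k + 1).
  by move=> Tk; apply: contrapT => nTk; apply: h; exists k.
have up (n : nat) : T (k1 + n%:Z).
  elim: n => [|n IH]; first by rewrite addr0.
  by rewrite -addn1 PoszD addrA; exact: step.
apply: nT2; apply: (Tdown _ (k1 + `|k2 - k1|%N%:Z)) => //.
by rewrite -lerBlDl; apply: le_trans (ler_norm _) _; rewrite abszE.
Qed.

Section Decomposition.
Context {R : realType} {d : measure_display} {X : metricMeasurableType R d}.
Variable mu : {sigma_finite_measure set X -> \bar R}.
Variable C1 : R.
Hypothesis open_meas : forall U : set X, open U -> measurable U.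
Hypothesis dbl : doubling_with mu C1.
Variable s : nat -> X.
Hypothesis s_dense : dense_seq s.
Variable phi : X -> R -> R.
Hypothesis phi_orlicz : forall x, orlicz (phi x).
Hypothesis phi_meas : forall t : R, 0 <= t -> measurable_fun setT (fun x => phi x t).
Variable Kw : R.
Hypothesis Kw0 : 0 <= Kw.
Hypothesis phi_Ainf : forall t : R, 0 < t -> Ainf_cond mu (phi ^~ t) (C1 ^+ 3)^-1 Kw.
Hypothesis norm_ball : forall (x : X) (r : R), 0 < r ->
  exists2 N : R, 0 < N & norm_ind mu phi (ball x r) = N%:E.
Variable f : X * R -> R[i].
Hypothesis f_meas : measurable_upper f.

Local Notation lev := (level mu f).

Definition proper_level (k : int) := exists w, ~ lev k w.

(* The region carried by the atoms of the levels other than the whole space. *)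
Definition level_core (z : X * R) := exists k : int,
  [/\ proper_level k, tent3 (lev k) z & ~ tent3 (lev (k + 1)) z].

Lemma proper_levelS (k k' : int) : (k <= k')%R -> proper_level k -> proper_level k'.
Proof. by move=> kk' [w nw]; exists w => /(levelS kk'). Qed.

Lemma tent3_levelS (k k' : int) : (k <= k')%R -> tent3 (lev k') `<=` tent3 (lev k).
Proof. by move=> kk'; apply: tent3S; exact: levelS. Qed.

Section Cells.
Variable D : int -> set nat.
Hypothesis D_in : forall k, proper_level k -> forall i, D k i -> lev k (s i).
Hypothesis D_triv : forall k, proper_level k ->
  trivIset (D k) (fun i => ball (s i) (codist (lev k) (s i) / 8)).
Hypothesis D_cover : forall k, proper_level k -> forall x, lev k x ->
  exists2 i, D k i & ball (s i) (codist (lev k) (s i) / 2) x.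

Definition active (q : int * nat) := proper_level q.1 /\ D q.1 q.2.

Definition cell_ball (q : int * nat) : set X :=
  ball (s q.2) (codist (lev q.1) (s q.2)).

Definition half_ball (q : int * nat) : set X :=
  ball (s q.2) (codist (lev q.1) (s q.2) / 2).

(** Half-balls of one level may overlap; the last condition assigns a point to the one of least
    index, which makes the cells disjoint. *)
Definition cell (q : int * nat) : set (X * R) :=
  [set z | [/\ tent3 (lev q.1) z, ~ tent3 (lev (q.1 + 1)) z, half_ball q z.1 &
     forall j, (j < q.2)%N -> D q.1 j -> ~ half_ball (q.1, j) z.1]].

Lemma cell_core q z : active q -> cell q z -> level_core z.
Proof. by move=> [pq _] [? ? _ _]; exists q.1. Qed.

Lemma cell_meas q : measurable (cell q).
Proof.
have mh q' : measurable (half_ball q') by exact: measurable_mball.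
pose E : set X := half_ball q `\`
  \bigcup_(j in [set j | (j < q.2)%N /\ D q.1 j]) half_ball (q.1, j).
have mE : measurable E.
  by apply: measurableD => //; apply: bigcup_measurable.
have -> : cell q = (tent3 (lev q.1) `\` tent3 (lev (q.1 + 1))) `&` (E `*` setT).
  apply/seteqP; split=> [z [h1 h2 h3 h4]|z [[h1 h2] [[h3 h4] _]]].
    by split; [split|split => //; split => //; move=> [j [jq Dj] hj]; exact: h4 hj].
  by split => // j jq Dj hj; apply: h4; exists j.
apply: measurableI; first by apply: measurableD; exact: (measurable_tent3 s_dense open_meas).
by apply: measurableX.
Qed.

Lemma cell_inj q q' z : active q -> active q' -> cell q z -> cell q' z -> q = q'.
Proof.
case: q => k i; case: q' => k' i' [pk Di] [pk' Di'] [/= h1 h2 h3 h4] [/= h1' h2' h3' h4'].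
have kk (a b : int) : tent3 (lev a) z -> ~ tent3 (lev (b + 1)) z -> (a <= b)%R.
  move=> ta nb; rewrite leNgt; apply/negP => ba; apply: nb.
  by apply: (tent3_levelS (k' := a)) ta; rewrite lezD1.
have ekk : k = k' by apply/eqP; rewrite eq_le !kk.
case: k' / ekk pk' Di' h1' h2' h3' h4' => _ Di' _ _ h3' h4'.
have [ii|ii|->//] := ltngtP i i'.
  by exfalso; exact: (h4' i ii Di h3).
by exfalso; exact: (h4 i' ii Di' h3').
Qed.

Lemma core_cell z : level_core z -> exists2 q, active q & cell q z.
Proof.
move=> [k [pk tz ntz]].
have zl : lev k z.1.
  case: tz => z0; apply; apply: mball_center; lra.
have [i Di zi] := D_cover pk zl.
pose P j := `[< D k j /\ half_ball (k, j) z.1 >].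
have exP : exists j, P j by exists i; apply/asboolP.
case: (ex_minnP exP) => j /asboolP[Dj zj] jmin.
exists (k, j) => //; split => // j' /= jj' Dj' zj'.
have := jmin j'; rewrite leqNgt jj' => h.
by have : false by apply: h; apply/asboolP.
Qed.

Lemma active_codist q : active q -> 0 < codist (lev q.1) (s q.2).
Proof.
move=> [pq Dq]; apply: codist_gt0 => //; last exact: D_in.
exact: (level_open open_meas dbl s_dense f_meas).
Qed.

Variable B0 : set X.
Hypothesis B0_ball : metric_ball B0.

(** The exponent belongs to the next level, since it is the tent of that level which the cell
    avoids. *)
Definition cell_scale (q : int * nat) : R :=
  C1 * 2 ^ (q.1 + 1) * fine (norm_ind mu phi (cell_ball q)).

(** With [pickle_inv], unlike [unpickle], only the code of a pair returns it, so every cell occurs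
    at exactly one index. *)
Definition dec_index (j : nat) : option (int * nat) :=
  if pickle_inv j is Some q then if `[< active q >] then Some q else None else None.

Definition dec_coef (j : nat) : R[i] :=
  if dec_index j is Some q then ((cell_scale q)%:C)%C else 0.

Definition dec_atom (j : nat) : X * R -> R[i] :=
  if dec_index j is Some q then cut f (cell_scale q) (cell q) else fun=> 0.

Definition dec_ball (j : nat) : set X :=
  if dec_index j is Some q then cell_ball q else B0.

Lemma dec_index_active j q : dec_index j = Some q -> active q.
Proof.
rewrite /dec_index; case: pickle_inv => // q'; case: asboolP => // aq [<-]//.
Qed.

Lemma dec_index_pickle q : active q -> dec_index (pickle q) = Some q.
Proof. by move=> aq; rewrite /dec_index pickleK_inv asboolT. Qed.

Lemma dec_index_inj j j' q : dec_index j = Some q -> dec_index j' = Some q -> j = j'.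
Proof.
have pk i : dec_index i = Some q -> pickle q = i.
  rewrite /dec_index; case E : pickle_inv => [q'|//]; case: asboolP => // _ [<-].
  by have := pickle_invK (T := (int * nat)%type) i; rewrite /oapp E.
by move=> /pk <- /pk <-.
Qed.

Let C10 : 0 < C1.
Proof. by apply: lt_le_trans (doubling_with_ge1 open_meas dbl). Qed.

Lemma cell_norm q : active q -> exists2 N : R, 0 < N &
  norm_ind mu phi (cell_ball q) = N%:E /\ cell_scale q = C1 * 2 ^ (q.1 + 1) * N.
Proof.
move=> aq; have [N N0 NE] := norm_ball (s q.2) (active_codist aq).
by exists N => //; split => //; rewrite /cell_scale NE.
Qed.

Lemma cell_scale_gt0 q : active q -> 0 < cell_scale q.
Proof.
by move=> /cell_norm[N N0 [_ ->]]; rewrite !mulr_gt0// exprz_gt0.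
Qed.

Lemma dec_ball_atom j : metric_ball (dec_ball j) /\ atom mu phi (dec_ball j) (dec_atom j).
Proof.
rewrite /dec_ball /dec_atom; case E : dec_index => [q|]; last first.
  by split => //; exact: zero_atom.
have aq := dec_index_active E; have q0 := active_codist aq.
split; first by exists (s q.2), (codist (lev q.1) (s q.2)).
have [N N0 [NE ->]] := cell_norm aq; have [pq Dq] := aq.
apply: (cut_atom open_meas dbl s_dense f_meas) => //.
- exact: measurable_mball.
- exact: cell_meas.
- by apply: proper_levelS pq; rewrite lerDl.
- by move=> z [].
- by move=> z [tz _ hz _]; exact: tent3_tent_ball.
Qed.

(** A cell ball lies in its level, which is not the whole space; only the placeholder [B0] can be
    X. *)
Lemma dec_ball_proper j : dec_ball j <> setT \/ dec_ball j = B0 /\ dec_coef j = 0.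
Proof.
rewrite /dec_ball /dec_coef; case E : dec_index => [q|]; last by right.
have [pq Dq] := dec_index_active E; left => BT.
have [w nw] := pq; apply: nw.
apply: (codist_ball pq (x := s q.2)).
by rewrite -/(cell_ball q) BT.
Qed.

(** By disjointness of the cells exactly one term is nonzero at [z], so the partial sums are
    eventually constant. *)
Lemma dec_series_core z : level_core z ->
  series (fun j => dec_coef j * dec_atom j z : R[i]^o) @ \oo --> (f z : R[i]^o).
Proof.
move=> /core_cell[q aq cz]; apply: cvg_near_cst.
near=> n; rewrite /series/= (bigD1_seq (pickle q)) ?iota_uniq//=; last first.
  rewrite mem_index_iota/=; near: n; exact: nbhs_infty_gt.
rewrite big1 ?addr0 => [|j /eqP jq].
  rewrite /dec_coef /dec_atom dec_index_pickle// cutK// gt_eqF//.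
  exact: cell_scale_gt0.
rewrite /dec_coef /dec_atom; case E : dec_index => [q'|]; last by rewrite mul0r.
rewrite cut0 ?mulr0// => cz'; apply: jq; apply: (dec_index_inj E).
have <- := cell_inj aq (dec_index_active E) cz cz'.
exact: dec_index_pickle.
Unshelve. all: by end_near.
Qed.

Lemma dec_series_out z : ~ level_core z ->
  series (fun j => dec_coef j * dec_atom j z : R[i]^o) @ \oo --> (0 : R[i]^o).
Proof.
move=> nz; apply: cvg_near_cst; apply: nearW => n; rewrite /series/=.
apply: big1 => j _; rewrite /dec_coef /dec_atom.
case E : dec_index => [q|]; last by rewrite mul0r.
rewrite cut0 ?mulr0// => cz; apply: nz.
exact: cell_core (dec_index_active E) cz.
Qed.

(** The norm of the indicator cancels between coefficient and term, leaving
    [phi(B, 2 * C1 * 2 ^ k / l)], where the 2 comes from the exponent [k + 1]. For a fixed level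
    these terms are summed by the Whitney estimate. *)
Lemma dec_coef_sum (l : R) (k0 : int) (J : nat) : 0 < l ->
  exists n : nat, (`|k0| <= n)%N /\
  (\sum_(0 <= j < J) coef_term mu phi (dec_ball j) (dec_coef j) l <=
   \sum_(0 <= m < (n + n).+1) (if `[< proper_level (m%:Z - n%:Z) >] then
      Kw%:E * phi_int mu phi (lev (m%:Z - n%:Z)) (2 * C1 * 2 ^ (m%:Z - n%:Z) / l)
      else 0))%E.
Proof.
move=> l0.
have t0 (k : int) : 0 < 2 * C1 * 2 ^ k / l.
  by rewrite divr_gt0// !mulr_gt0// exprz_gt0.
pose c (q : int * nat) : \bar R := if `[< active q >] then
  phi_int mu phi (cell_ball q) (2 * C1 * 2 ^ q.1 / l) else 0%E.
have c0 q : (0 <= c q)%E.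
  by rewrite /c; case: ifP => // _; apply: phi_int_ge0 => //; exact/ltW.
have [n [k0n cn]] := sum_pickle_le k0 J c0.
exists n; split => //; apply: le_trans (le_trans _ cn) _.
  apply: lee_sum => j _; rewrite /dec_ball /dec_coef /dec_index.
  case: pickle_inv => [q|]; last first.
    rewrite /coef_term /Normc.normc/= expr0n/= addr0 sqrtr0 mul0r /phi_int.
    by rewrite integral0_eq// => x _; have [-> _ _ _] := phi_orlicz x.
  rewrite /c; case: asboolP => aq; last first.
    rewrite /coef_term /Normc.normc/= expr0n/= addr0 sqrtr0 mul0r /phi_int.
    by rewrite integral0_eq// => x _; have [-> _ _ _] := phi_orlicz x.
  have [N N0 [NE sE]] := cell_norm aq.
  have sc0 := cell_scale_gt0 aq.
  rewrite /coef_term NE/= expr0n/= addr0 sqrtr_sqr gtr0_norm// sE.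
  have -> : C1 * 2 ^ (q.1 + 1) * N / (l * N) = 2 * C1 * 2 ^ q.1 / l.
    by rewrite expfzDr// expr1z; field; rewrite !gt_eqF.
  by [].
apply: lee_sum => m _; set k := (m%:Z - n%:Z)%R.
case: asboolP => pk; last first.
  rewrite big1// => i _; rewrite /c asboolF//; by case.
apply: le_trans (whitney_sum_le open_meas dbl phi_orlicz phi_meas n.+1 Kw0 (t0 k)
  (level_open open_meas dbl s_dense f_meas k) pk (phi_Ainf (t0 k)) (D_in pk) (D_triv pk)).
apply: lee_sum => i _; rewrite /c.
case: asboolP => [[_ Di]|na]; first by rewrite asboolT.
by rewrite asboolF// => Di; apply: na.
Qed.

End Cells.

(** The limit off the core is stated separately: there [f] either vanishes almost everywhere or is
    carried by the single atom. *)
Lemma atomic_decomposition (B0 : set X) : metric_ball B0 ->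
  exists (lam : nat -> R[i]) (A : nat -> X * R -> R[i]) (B : nat -> set X),
  [/\ forall j, [/\ metric_ball (B j), atom mu phi (B j) (A j) &
        B j <> setT \/ B j = B0 /\ lam j = 0],
      forall z, level_core z ->
        series (fun j => lam j * A j z : R[i]^o) @ \oo --> (f z : R[i]^o),
      forall z, ~ level_core z ->
        series (fun j => lam j * A j z : R[i]^o) @ \oo --> (0 : R[i]^o) &
      forall (l : R) (k0 : int) (J : nat), 0 < l ->
        exists n : nat, (`|k0| <= n)%N /\
        (\sum_(0 <= j < J) coef_term mu phi (B j) (lam j) l <=
         \sum_(0 <= m < (n + n).+1) (if `[< proper_level (m%:Z - n%:Z) >] then
            Kw%:E * phi_int mu phi (lev (m%:Z - n%:Z)) (2 * C1 * 2 ^ (m%:Z - n%:Z) / l)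
            else 0))%E].
Proof.
move=> hB0.
have exD (k : int) : exists Dk : set nat, proper_level k ->
  [/\ (forall i, Dk i -> lev k (s i)),
      trivIset Dk (fun i => ball (s i) (codist (lev k) (s i) / 8)) &
      (forall x, lev k x -> exists2 i, Dk i & ball (s i) (codist (lev k) (s i) / 2) x)].
  have [pk|npk] := pselect (proper_level k); last by exists set0.
  have [Dk hDk] := whitney s_dense (level_open open_meas dbl s_dense f_meas k) pk.
  by exists Dk.
have [D hD] := choice exD.
have D1 k (pk : proper_level k) := let: And3 h _ _ := hD k pk in h.
have D2 k (pk : proper_level k) := let: And3 _ h _ := hD k pk in h.
have D3 k (pk : proper_level k) := let: And3 _ _ h := hD k pk in h.
exists (dec_coef D), (dec_atom D), (dec_ball D B0); split.
- move=> j; have [hb ha] := dec_ball_atom D1 hB0 j; split => //.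
  exact: dec_ball_proper.
- by move=> z; exact: dec_series_core.
- by move=> z; exact: dec_series_out.
- by move=> l k0 J; exact: dec_coef_sum.
Qed.

End Decomposition.

Lemma luxemburg_le (R : realType) (M1 M2 : R -> \bar R) (C : R) : 0 < C ->
  (forall l, 0 < l -> (M2 l <= 1)%E -> (M1 (C * l)%R <= 1)%E) ->
  (luxemburg M1 <= C%:E * luxemburg M2)%E.
Proof.
move=> C0 h; rewrite -lee_pdivrMl//; apply: le_ereal_inf_tmp => _ [l [l0 Ml] <-].
rewrite lee_pdivrMl// -EFinM; apply: ereal_inf_lbound.
by exists (C * l) => //; split; [rewrite /= mulr_gt0|exact: h].
Qed.

Lemma nneseries_le (R : realType) (u : nat -> \bar R) (c : \bar R) :
  (forall j, (0 <= u j)%E) -> (forall J, (\sum_(0 <= j < J) u j <= c)%E) ->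
  (\sum_(0 <= j <oo) u j <= c)%E.
Proof.
move=> u0 h; apply: lime_le; first by apply: is_cvg_nneseries => j _ _.
exact: nearW.
Qed.

(** Enlarging the scale by [C] gains only [C^-1 ^ p] from the lower type; this [C] absorbs the
    constant [a]. *)
Lemma exists_powR_scale (R : realType) (p a : R) : 0 < p -> 0 < a ->
  exists2 C : R, 1 <= C & C^-1 `^ p * a <= 1.
Proof.
move=> p0 a0; exists (Num.max 1 (a `^ p^-1)); first by rewrite le_max lexx.
set C := Num.max _ _; have C1 : 1 <= C by rewrite le_max lexx.
have C0 : 0 < C by lra.
have CE : C^-1 `^ p * C `^ p = 1.
  by rewrite -powRM ?invr_ge0 ?(ltW C0)// mulVf ?gt_eqF// powR1.
rewrite -CE ler_wpM2l ?powR_ge0//.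
have -> : a = (a `^ p^-1) `^ p by rewrite -powRrM mulVf ?gt_eqF// powRr1// ltW.
apply: ge0_ler_powR; rewrite ?nnegrE ?powR_ge0 ?(ltW p0) ?(ltW C0)//.
by rewrite le_max lexx orbT.
Qed.

(** * Assembly for a measure with positive balls *)

Section NonDegenerate.
Context {R : realType} {d : measure_display} {X : metricMeasurableType R d}.
Variable mu : {sigma_finite_measure set X -> \bar R}.
Variable phi : X -> R -> R.
Variable C1 : R.
Hypothesis open_meas : forall U : set X, open U -> measurable U.
Hypothesis dbl : doubling_with mu C1.
Variable s : nat -> X.
Hypothesis s_dense : dense_seq s.
Hypothesis phi_orlicz : forall x, orlicz (phi x).
Hypothesis phi_meas : forall t : R, 0 <= t -> measurable_fun setT (fun x => phi x t).
Variables (p Cl K2 Kw KL : R).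
Hypothesis p01 : 0 < p <= 1.
Hypothesis Cl0 : 0 < Cl.
Hypothesis phi_lower : forall (x : X) (t r : R), 0 <= t -> 0 <= r -> r <= 1 ->
  phi x (r * t) <= Cl * r `^ p * phi x t.
Hypothesis K20 : 0 < K2.
Hypothesis phi_Ainf2 : forall t : R, 0 < t -> Ainf_cond mu (phi ^~ t) 2^-1 K2.
Hypothesis Kw1 : 1 <= Kw.
Hypothesis phi_AinfW : forall t : R, 0 < t -> Ainf_cond mu (phi ^~ t) (C1 ^+ 3)^-1 Kw.
Hypothesis KL0 : 0 < KL.
Hypothesis level_sum : forall (f : X * R -> R[i]) (l : R) (n N : nat),
  in_Tphi mu phi f -> 0 < l ->
  (\sum_(0 <= m < N) phi_int mu phi (level mu f (m%:Z - n%:Z)) (2 ^ (m%:Z - n%:Z) / l) <=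
   KL%:E * \int[mu]_x phi_ext phi x (`|area mu f x| * (l^-1)%:E))%E.

Let C10 : 0 < C1.
Proof. by apply: lt_le_trans (doubling_with_ge1 open_meas dbl). Qed.

Let pos1 x : 0 < phi x 1. Proof. exact: phi_gt0. Qed.

Let meas1 : measurable_fun setT (phi ^~ 1). Proof. exact: phi_meas. Qed.

Let norm_ball (x : X) (r : R) : 0 < r ->
  exists2 N : R, 0 < N & norm_ind mu phi (ball x r) = N%:E.
Proof.
move=> r0; apply: (norm_ind_gt0_fin phi_orlicz phi_meas p01 Cl0 phi_lower).
- exact: measurable_mball.
- exact: (wint_ball_gt0 open_meas dbl pos1 meas1).
- exact: (wint_ball_fin open_meas dbl pos1 meas1 K20 (phi_Ainf2 ltr01)).
Qed.

Let norm_setT : (mu setT < +oo)%E ->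
  exists2 N : R, 0 < N & norm_ind mu phi setT = N%:E.
Proof.
move=> muT; apply: (norm_ind_gt0_fin phi_orlicz phi_meas p01 Cl0 phi_lower) => //.
- apply: lt_le_trans (wint_ball_gt0 open_meas dbl pos1 meas1 point ltr01) _.
  by apply: le_wint => //; [move=> x; exact: ltW|exact: measurable_mball].
- exact: (wint_setT_fin open_meas dbl pos1 meas1 K20 (phi_Ainf2 ltr01)).
Qed.

Section Fixed.
Variable f : X * R -> R[i].
Hypothesis f_Tphi : in_Tphi mu phi f.

Local Notation lev := (level mu f).
Local Notation proper := (proper_level mu f).
Local Notation modular l :=
  (\int[mu]_x phi_ext phi x (`|area mu f x| * (l^-1)%:E))%E.

Let f_meas : measurable_upper f := proj1 f_Tphi.
Let f_Lphi := proj2 (proj2 f_Tphi).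

Lemma tent3_level_bounded_Tphi (z : X * R) : 0 < z.2 ->
  exists k : nat, ~ tent3 (lev k%:Z) z.
Proof.
apply: (tent3_level_bounded open_meas dbl s_dense phi_orlicz phi_meas f_meas KL0 _ f_Lphi).
by move=> l n N; exact: level_sum.
Qed.

Lemma exists_proper_level : exists k, proper k.
Proof.
have [k nk] := @tent3_level_bounded_Tphi (point, 1) ltr01.
by have [w nw _] := notin_tent3 (z := (point, 1)) ltr01 nk; exists k%:Z, w.
Qed.

Lemma proper_level_infty k : mu setT = +oo%E -> proper k.
Proof.
move=> muT; apply: contrapT => npk.
have levT : lev k = setT.
  by apply/seteqP; split=> // x _; apply: contrapT => nx; apply: npk; exists x.
have k0 : 0 < (2 : R) ^ k by rewrite exprz_gt0.
have := level_mass_fin phi_orlicz KL0 (f := f)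
  (fun l n N => level_sum n N f_Tphi) f_Lphi k.
rewrite levT /phi_int -/(wint mu (phi ^~ (2 ^ k)) setT).
rewrite (wint_setT_infty open_meas dbl _ _ K20 (phi_Ainf2 k0))//.
- by move=> x; exact: phi_gt0.
- by apply: phi_meas; exact: ltW.
Qed.

Lemma level_core_full (z : X * R) : 0 < z.2 -> (forall k, proper k) ->
  ~ level_core mu f z -> forall k, ~ tent3 (lev k) z.
Proof.
move=> z0 allp nz k tk; apply: nz.
have [k2 nk2] := tent3_level_bounded_Tphi z0.
have [k' [tk' ntk']] := @int_threshold (fun k => tent3 (lev k) z) k k2%:Z
  (fun a b ab => @tent3_levelS _ _ _ _ f a b ab z) tk nk2.
by exists k'.
Qed.

Lemma level_core_above (k0 : int) (z : X * R) : 0 < z.2 -> proper (k0 + 1) ->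
  tent3 (lev (k0 + 1)) z -> level_core mu f z.
Proof.
move=> z0 pk tk; have [k2 nk2] := tent3_level_bounded_Tphi z0.
have [k' [tk' ntk']] := @int_threshold (fun k => tent3 (lev k) z) (k0 + 1) k2%:Z
  (fun a b ab => @tent3_levelS _ _ _ _ f a b ab z) tk nk2.
exists k'; split => //; apply: proper_levelS pk.
rewrite leNgt; apply/negP => kk; apply: ntk'.
by apply: tent3_levelS tk; rewrite lezD1.
Qed.

Variable C' : R.
Hypothesis C'1 : 1 <= C'.
Hypothesis C'E : C'^-1 `^ p * (Cl * Kw * KL) <= 1.

Let C'0 : 0 < C'. Proof. exact: lt_le_trans C'1. Qed.

(** The factor [2 * C1] cancels that of the coefficients, so that [tau k l] is
    [C'^-1 * (2 ^ k / l)], and [C'] makes the total at most 1. *)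
Let C := 2 * C1 * C'.

Let C_gt0 : 0 < C. Proof. by rewrite !mulr_gt0. Qed.

Let tau (k : int) (l : R) := 2 * C1 * 2 ^ k / (C * l).

Let tau_ge0 k l : 0 < l -> 0 <= tau k l.
Proof. by move=> l0; rewrite divr_ge0// ?mulr_ge0 ?exprz_ge0// ltW. Qed.

Let phi_tau0 k l : 0 < l -> (0 <= phi_int mu phi (lev k) (tau k l))%E.
Proof. by move=> l0; apply: phi_int_ge0 => //; exact: tau_ge0. Qed.

Lemma modular_sum_le1 (l : R) (n N : nat) : 0 < l -> (modular l <= 1)%E ->
  (\sum_(0 <= m < N) (Kw%:E * phi_int mu phi (lev (m%:Z - n%:Z)) (tau (m%:Z - n%:Z) l))
   <= 1)%E.
Proof.
move=> l0 Ml.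
have Kw0 : 0 <= Kw by exact: le_trans ler01 Kw1.
have cp0 : 0 <= Cl * C'^-1 `^ p by rewrite mulr_ge0 ?powR_ge0// ltW.
pose F m := phi_int mu phi (lev (m%:Z - n%:Z)) (2 ^ (m%:Z - n%:Z) / l).
have F0 m : (0 <= F m)%E.
  by apply: phi_int_ge0 => //; rewrite divr_ge0 ?exprz_ge0// ltW.
apply: (@le_trans _ _ (\sum_(0 <= m < N) ((Kw * (Cl * C'^-1 `^ p))%:E * F m))%E).
  apply: lee_sum => m _; rewrite EFinM -muleA; apply: lee_wpmul2l; first by rewrite lee_fin.
  have -> : tau (m%:Z - n%:Z) l = C'^-1 * (2 ^ (m%:Z - n%:Z) / l).
    by rewrite /tau /C; field; rewrite !gt_eqF.
  apply: (phi_int_lower _ phi_orlicz phi_meas Cl0 phi_lower).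
  - exact: open_meas (level_open open_meas dbl s_dense f_meas _).
  - by rewrite divr_ge0 ?exprz_ge0// ltW.
  - by rewrite invr_ge0 ltW.
  - by rewrite invf_le1.
rewrite -ge0_sume_distrr//.
have Kc0 : 0 <= Kw * (Cl * C'^-1 `^ p) by rewrite mulr_ge0.
apply: (@le_trans _ _ ((Kw * (Cl * C'^-1 `^ p))%:E * (KL%:E * 1))%E).
  apply: lee_wpmul2l; first by rewrite lee_fin.
  apply: le_trans (level_sum n N f_Tphi l0) _.
  by apply: lee_wpmul2l => //; rewrite lee_fin ltW.
rewrite mule1 -EFinM lee_fin; apply: le_trans C'E.
by rewrite le_eqVlt; apply/orP; left; apply/eqP; ring.
Qed.

Let proper_term_le (l : R) (k : int) : 0 < l ->
  ((if `[< proper k >] then Kw%:E * phi_int mu phi (lev k) (tau k l) else 0) <=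
   Kw%:E * phi_int mu phi (lev k) (tau k l))%E.
Proof.
move=> l0; case: ifP => // _.
by rewrite mule_ge0 ?phi_tau0// lee_fin (le_trans ler01 Kw1).
Qed.

Let coef_term_ge0 (B : set X) (lam : R[i]) (l : R) : 0 < l ->
  (0 <= coef_term mu phi B lam l)%E.
Proof.
move=> l0; apply: phi_int_ge0 => //; rewrite divr_ge0//.
  by case: lam => a b; exact: sqrtr_ge0.
by rewrite mulr_ge0 ?(ltW l0)// fine_ge0// norm_ind_ge0.
Qed.

Lemma decomposition_all_proper (B0 : set X) : metric_ball B0 -> (forall k, proper k) ->
  exists (lam : nat -> R[i]) (A : nat -> X * R -> R[i]) (B : nat -> set X),
  [/\ forall j, [/\ metric_ball (B j), atom mu phi (B j) (A j) &
        B j <> setT \/ B j = B0 /\ lam j = 0],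
      {ae (mu \x lebesgue_measure)%E, forall z, upper_half z ->
         series (fun j => lam j * A j z : R[i]^o) @ \oo --> (f z : R[i]^o)} &
      (luxemburg (fun l => \sum_(0 <= j <oo) coef_term mu phi (B j) (lam j) l)
        <= C%:E * Tphi_norm mu phi f)%E].
Proof.
move=> hB0 allp; have Kw0 : 0 <= Kw by exact: le_trans ler01 Kw1.
have [lam [A [B [hB hcore hout hsum]]]] := atomic_decomposition open_meas dbl s_dense
  phi_orlicz phi_meas Kw0 phi_AinfW norm_ball f_meas hB0.
exists lam, A, B; split => //.
(* Convergence can fail only off the core, where the series is 0, at a point with [f] nonzero; when
   all levels are proper such a point lies in no tent. *)
- apply: negligibleS (negligible_below_levels open_meas dbl s_dense f_meas).
  move=> z /= /not_implyP[z0 nz].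
  have ncore : ~ level_core mu f z by move=> /hcore.
  split => //; first exact: level_core_full.
  by apply/eqP => fz; apply: nz; rewrite fz; exact: hout.
- apply: luxemburg_le => // l l0 Ml; have Cl_0 : 0 < C * l by rewrite mulr_gt0.
  apply: nneseries_le => [j|J]; first exact: coef_term_ge0.
  have [n [_ Jn]] := hsum (C * l) 0 J Cl_0.
  apply: le_trans Jn _; apply: le_trans (modular_sum_le1 n (n + n).+1 l0 Ml).
  by apply: lee_sum => m _; exact: proper_term_le.
Qed.

Lemma decomposition_single (B0 : set X) (k0 : int) : (mu setT < +oo)%E ->
  metric_ball B0 -> ~ proper k0 -> proper (k0 + 1) ->
  exists (lam0 : R[i]) (A0 : X * R -> R[i])
    (lam : nat -> R[i]) (A : nat -> X * R -> R[i]) (B : nat -> set X),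
  [/\ single_atom mu phi A0,
      forall j, [/\ metric_ball (B j), atom mu phi (B j) (A j) &
        B j <> setT \/ B j = B0 /\ lam j = 0],
      forall z, upper_half z ->
         series (fun j => lam j * A j z : R[i]^o) @ \oo -->
           (f z - lam0 * A0 z : R[i]^o) &
      (luxemburg (fun l => coef_term mu phi setT lam0 l +
          \sum_(0 <= j <oo) coef_term mu phi (B j) (lam j) l)
        <= C%:E * Tphi_norm mu phi f)%E].
Proof.
move=> muT hB0 npk0 pk1; have Kw0 : 0 <= Kw by exact: le_trans ler01 Kw1.
have levT : lev k0 = setT.
  by apply/seteqP; split=> // x _; apply: contrapT => nx; apply: npk0; exists x.
have [N N0 NE] := norm_setT muT.
have [lam [A [B [hB hcore hout hsum]]]] := atomic_decomposition open_meas dbl s_dense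
  phi_orlicz phi_meas Kw0 phi_AinfW norm_ball f_meas hB0.
pose r := C1 * 2 ^ (k0 + 1) * N.
have r0 : 0 < r by rewrite !mulr_gt0// exprz_gt0.
(* As [lev k0] is X, its tent is the upper half, so [S] is the whole layer between the levels [k0]
   and [k0 + 1]. No smaller level is proper, hence [S] misses the core. *)
pose S := @upper_half R d X `\` tent3 (lev (k0 + 1)).
have mS : measurable S.
  apply: measurableD; first exact: (measurable_upper_half open_meas s_dense).
  exact: (measurable_tent3 s_dense open_meas).
exists (r%:C)%C, (cut f r S), lam, A, B; split => //.
- by apply: (cut_single_atom open_meas dbl s_dense f_meas) => // z [].
- move=> z z0; have [tz|ntz] := pselect (tent3 (lev (k0 + 1)) z).
    rewrite cut0; last by case.
    by rewrite mulr0 subr0; apply: hcore; exact: level_core_above tz.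
  rewrite cutK ?gt_eqF// subrr; apply: hout => -[k [pk tk _]]; apply: ntz.
  apply: tent3_levelS tk; rewrite lezD1 ltNge; apply/negP => kk0.
  by apply: npk0; exact: proper_levelS pk.
- apply: luxemburg_le => // l l0 Ml; have Cl_0 : 0 < C * l by rewrite mulr_gt0.
  have coefE : coef_term mu phi setT (r%:C)%C (C * l) = phi_int mu phi (lev k0) (tau k0 l).
    rewrite /coef_term NE/= expr0n/= addr0 sqrtr_sqr gtr0_norm// levT; congr phi_int.
    by rewrite /tau /r expfzDr// expr1z; field; rewrite !gt_eqF.
  have partial J : (coef_term mu phi setT (r%:C)%C (C * l) +
      \sum_(0 <= j < J) coef_term mu phi (B j) (lam j) (C * l) <= 1)%E.
    have [n [k0n Jn]] := hsum (C * l) k0 J Cl_0.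
    apply: le_trans (leeD (lexx _) Jn) _.
    apply: le_trans (modular_sum_le1 n (n + n).+1 l0 Ml).
    have kn0 : (0 <= k0 + n%:Z)%R.
      rewrite -lerBlDr sub0r lerNl; apply: le_trans (ler_norm _) _.
      by rewrite normrN -abszE lez_nat.
    pose m0 := `|(k0 + n%:Z)%R|%N.
    have m0E : (m0%:Z - n%:Z = k0)%R by rewrite /m0 gez0_abs// addrK.
    have m0in : m0 \in index_iota 0 (n + n).+1.
      rewrite mem_index_iota/= ltnS -lez_nat /m0 gez0_abs// PoszD lerD2r.
      by apply: le_trans (ler_norm _) _; rewrite -abszE lez_nat.
    have uq : uniq (index_iota 0 (n + n).+1) by exact: iota_uniq.
    (* The slot of [k0] is empty in the sum over proper levels, so the term of the single atom takes
       its place; this uses [1 <= Kw]. *)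
    rewrite (bigD1_seq _ m0in uq)/= [leRHS](bigD1_seq _ m0in uq)/=.
    rewrite m0E asboolF// add0e coefE; apply: leeD.
      rewrite -[leLHS]mul1e; apply: lee_wpmul2r; first exact: phi_tau0.
      by rewrite lee_fin.
    by apply: lee_sum => m _; exact: proper_term_le.
  have coef0 := coef_term_ge0 setT (r%:C)%C Cl_0.
  have cfin : coef_term mu phi setT (r%:C)%C (C * l) \is a fin_num.
    rewrite ge0_fin_numE//; have := partial 0%N; rewrite big_nil adde0.
    by move=> /le_lt_trans; apply; exact: ltry.
  rewrite -leeBrDl//; apply: nneseries_le => [j|J]; first exact: coef_term_ge0.
  by rewrite leeBrDl.
Qed.

End Fixed.
End NonDegenerate.

Section ZeroMass.
Context {R : realType} {d : measure_display} {X : metricMeasurableType R d}.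
Variable mu : {sigma_finite_measure set X -> \bar R}.
Variable phi : X -> R -> R.
Hypothesis mu0 : mu setT = 0%E.

Let integral0 (D : set X) (g : X -> \bar R) : (\int[mu]_(x in D) g x = 0)%E.
Proof.
rewrite (@eq_measure_integral _ _ _ D mzero mu) ?integral_measure_zero// => E mE _.
apply: (_ : mu E = 0%E).
by apply/eqP; rewrite eq_le measure_ge0 andbT -mu0 le_measure ?inE.
Qed.

Let coef0 (B : set X) (lam : R[i]) (l : R) : coef_term mu phi B lam l = 0%E.
Proof. exact: integral0. Qed.

(** All integrals over X vanish, so [f] itself is a single atom, taken with coefficient 1. *)
Lemma decomposition_zero_mass (B0 : set X) (f : X * R -> R[i]) :
  metric_ball B0 -> in_Tphi mu phi f ->
  exists (lam0 : R[i]) (A0 : X * R -> R[i])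
    (lam : nat -> R[i]) (A : nat -> X * R -> R[i]) (B : nat -> set X),
  [/\ single_atom mu phi A0,
      forall j, [/\ metric_ball (B j), atom mu phi (B j) (A j) &
        B j <> setT \/ B j = B0 /\ lam j = 0],
      {ae (mu \x lebesgue_measure)%E, forall z, upper_half z ->
         series (fun j => lam j * A j z : R[i]^o) @ \oo -->
           (f z - lam0 * A0 z : R[i]^o)} &
      (luxemburg (fun l => coef_term mu phi setT lam0 l +
          \sum_(0 <= j <oo) coef_term mu phi (B j) (lam j) l)
        <= 1%:E * Tphi_norm mu phi f)%E].
Proof.
move=> hB0 [f_meas _].
exists 1, f, (fun=> 0), (fun=> fun=> 0), (fun=> B0); split.
- move=> p p1; split=> //; apply: (@le_trans _ _ 0%E).
    by rewrite /T2_norm unlock integral0 poweR0r// invr_eq0 gt_eqF// (lt_trans ltr01).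
  by rewrite mule_ge0 ?poweR_ge0// inve_ge0 norm_ind_ge0.
- by move=> j; split=> //; [exact: zero_atom|right].
- apply: aeW => z _; rewrite mul1r subrr.
  under eq_fun do rewrite mul0r.
  rewrite (_ : series _ = cst 0); first exact: cvg_cst.
  by apply/funext => n; rewrite /series/= big1.
- apply: luxemburg_le => // l l0 _; rewrite coef0 add0e.
  by rewrite eseries0// => j _ _; rewrite coef0.
Qed.

End ZeroMass.

Section PositiveMass.
Context {R : realType} {d : measure_display} {X : metricMeasurableType R d}.
Variable mu : {sigma_finite_measure set X -> \bar R}.
Variable phi : X -> R -> R.
Variable C1 : R.
Hypothesis open_meas : forall U : set X, open U -> measurable U.
Hypothesis dbl : doubling_with mu C1.
Hypothesis phi_growth : growth_function mu phi.

Lemma decomposition_positive_mass :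
  exists2 C : R, 0 < C & forall (f : X * R -> R[i]) (B0 : set X),
    in_Tphi mu phi f -> metric_ball B0 ->
  (mu setT = +oo%E ->
    exists (lam : nat -> R[i]) (A : nat -> X * R -> R[i]) (B : nat -> set X),
    [/\ forall j, [/\ metric_ball (B j), atom mu phi (B j) (A j) &
          B j <> setT \/ B j = B0 /\ lam j = 0],
        {ae (mu \x lebesgue_measure)%E, forall z, upper_half z ->
           series (fun j => lam j * A j z : R[i]^o) @ \oo --> (f z : R[i]^o)} &
        (luxemburg (fun l => \sum_(0 <= j <oo) coef_term mu phi (B j) (lam j) l)
          <= C%:E * Tphi_norm mu phi f)%E]) /\
  ((mu setT < +oo)%E ->
    exists (lam0 : R[i]) (A0 : X * R -> R[i])
      (lam : nat -> R[i]) (A : nat -> X * R -> R[i]) (B : nat -> set X),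
    [/\ single_atom mu phi A0,
        forall j, [/\ metric_ball (B j), atom mu phi (B j) (A j) &
          B j <> setT \/ B j = B0 /\ lam j = 0],
        {ae (mu \x lebesgue_measure)%E, forall z, upper_half z ->
           series (fun j => lam j * A j z : R[i]^o) @ \oo -->
             (f z - lam0 * A0 z : R[i]^o)} &
        (luxemburg (fun l => coef_term mu phi setT lam0 l +
            \sum_(0 <= j <oo) coef_term mu phi (B j) (lam j) l)
          <= C%:E * Tphi_norm mu phi f)%E]).
Proof.
have [phi_orlicz phi_meas phi_Ainf [p p01 [Cl Cl0 lower]] [Cu Cu0 upper]] := phi_growth.
have phi_pos (x : X) (t : R) : 0 < t -> 0 < phi x t by exact: phi_gt0.
have C11 := doubling_with_ge1 open_meas dbl.
have C10 : 0 < C1 := lt_le_trans ltr01 C11.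
have [s s_dense] := doubling_separable open_meas dbl.
have comparable (c : R) : 0 < c -> exists2 K : R, 0 < K &
    forall t : R, 0 < t -> Ainf_cond mu (phi ^~ t) c K.
  move=> c0; have [K K0 hK] := muckenhoupt_comparable open_meas dbl phi_pos phi_meas c0 phi_Ainf.
  by exists K => // t t0 x r E r0 mE Er cE; exact: hK.
have [K2 K20 hK2] : exists2 K : R, 0 < K &
    forall t : R, 0 < t -> Ainf_cond mu (phi ^~ t) 2^-1 K by apply: comparable; rewrite invr_gt0.
have [Kw Kw1 hKw] : exists2 K : R, 1 <= K &
    forall t : R, 0 < t -> Ainf_cond mu (phi ^~ t) (C1 ^+ 3)^-1 K.
  have [K K0 hK] : exists2 K : R, 0 < K &
    forall t : R, 0 < t -> Ainf_cond mu (phi ^~ t) (C1 ^+ 3)^-1 K.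
    by apply: comparable; rewrite invr_gt0 exprn_gt0.
  exists (Num.max 1 K) => [|t t0 x r E r0 mE Er cE]; first by rewrite le_max lexx.
  apply: le_trans (hK t t0 x r E r0 mE Er cE) _; apply: lee_wpmul2r.
    by apply: phi_int_ge0 => //; exact: ltW.
  by rewrite lee_fin le_max lexx orbT.
have [K K0 hK] : exists2 K : R, 0 < K &
    forall t : R, 0 < t -> Ainf_cond mu (phi ^~ t) ((2 * C1 ^+ 4)^-1 / C1 ^+ 2) K.
  by apply: comparable; rewrite divr_gt0 ?invr_gt0 ?mulr_gt0 ?exprn_gt0.
have p0 : 0 < p by case/andP: p01.
have p21 : 0 < 2 `^ p - 1 :> R by rewrite subr_gt0 powR2_gt1.
pose KL := K * C1 * ((Cl + Cu) * (6 / (2 `^ p - 1))).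
have KL0 : 0 < KL by rewrite !mulr_gt0// ?addr_gt0 ?invr_gt0.
have level_sum (f : X * R -> R[i]) (l : R) (n N : nat) : in_Tphi mu phi f -> 0 < l ->
    (\sum_(0 <= m < N) phi_int mu phi (level mu f (m%:Z - n%:Z)) (2 ^ (m%:Z - n%:Z) / l) <=
   KL%:E * \int[mu]_x phi_ext phi x (`|area mu f x| * (l^-1)%:E))%E.
  move=> [f_meas [area_meas _]] l0.
  exact: (level_sum_le open_meas dbl s_dense phi_orlicz phi_meas p01 Cl0 Cu0 lower upper
    f_meas n N (ltW K0) l0 hK area_meas).
clearbody KL.
have [C' C'1 C'E] : exists2 C : R, 1 <= C & C^-1 `^ p * (Cl * Kw * KL) <= 1.
  by apply: exists_powR_scale => //; rewrite !mulr_gt0// (lt_le_trans ltr01).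
exists (2 * C1 * C'); first by rewrite !mulr_gt0// (lt_le_trans ltr01).
move=> f B0 f_Tphi hB0.
have all_proper := decomposition_all_proper open_meas dbl s_dense phi_orlicz phi_meas p01 Cl0
  lower K20 hK2 Kw1 hKw KL0 level_sum f_Tphi C'1 C'E hB0.
split=> [muT|muT].
  by apply: all_proper => k; exact: (proper_level_infty open_meas dbl phi_orlicz phi_meas
    K20 hK2 KL0 level_sum f_Tphi).
(* If no level is the whole space, the single atom is zero. *)
have [allp|] := pselect (forall k, proper_level mu f k).
  have [lam [A [B [hB hae hlux]]]] := all_proper allp.
  exists 0, (fun=> 0), lam, A, B; split.
  - exact: zero_single_atom.
  - exact: hB.
  - apply: negligibleS hae => z; apply: contra_not => hz z0.
    by rewrite mul0r subr0; exact: hz.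
  rewrite (_ : (fun l => _) = fun l => \sum_(0 <= j <oo) coef_term mu phi (B j) (lam j) l)%E.
    exact: hlux.
  apply/funext => l; rewrite [X in (X + _)%E](_ : _ = 0%E) ?add0e//.
  rewrite /coef_term /= expr0n/= addr0 sqrtr0 mul0r /phi_int.
  by apply: integral0_eq => x _; case: (phi_orlicz x) => ->.
move=> /existsNP[k1 nk1].
have [k2 pk2] := exists_proper_level open_meas dbl s_dense phi_orlicz phi_meas KL0 level_sum f_Tphi.
have [k0 [npk0 npk01]] := @int_threshold (fun k => ~ proper_level mu f k) k1 k2
  (fun k k' kk' => contra_not (proper_levelS kk')) nk1 (fun h => h pk2).
have [lam0 [A0 [lam [A [B [hA0 hB hcv hlux]]]]]] := decomposition_single open_meas dbl s_dense
  phi_orlicz phi_meas p01 Cl0 lower K20 hK2 Kw1 hKw KL0 level_sum f_Tphi C'1 C'E muT hB0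
  npk0 (contrapT npk01).
by exists lam0, A0, lam, A, B; split; [exact: hA0|exact: hB|exact: aeW|exact: hlux].
Qed.

End PositiveMass.

(** Provides the placeholder ball: two distinct points give a ball that misses one of them. *)
Lemma exists_ball_neq_setT (R : realType) (d : measure_display)
    (X : metricMeasurableType R d) :
  exists2 B : set X, metric_ball B & B <> setT \/ (forall x y : X, x = y).
Proof.
have [/existsNP[x /existsNP[y xy]]|h] := pselect (~ (forall x y : X, x = y)).
  have xy0 : 0 < mdist x y.
    by rewrite lt_def mdist_ge0 andbT; apply/eqP => /mdist_positivity.
  exists (ball x (mdist x y)); first by exists x, (mdist x y).
  left=> bT; have : ball x (mdist x y) y by rewrite bT.
  by move=> /in_mball; rewrite ltxx.
by exists (ball point 1); [exists point, 1|right; exact: contrapT h].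
Qed.
Section SigmaFinitePacking.
Context {R : realType} {d : measure_display} {X : measurableType d}.
Variable mu : {measure set X -> \bar R}.

(* A distinct constant, so that the sigma-finite structure is attached to it. *)
Definition sigma_finite_copy of sigma_finite setT mu : set X -> \bar R := mu.

HB.instance Definition _ (h : sigma_finite setT mu) :=
  Measure.copy (sigma_finite_copy h) mu.
HB.instance Definition _ (h : sigma_finite setT mu) :=
  @Measure_isSigmaFinite.Build _ _ _ (sigma_finite_copy h) h.
End SigmaFinitePacking.

(** An equality of measures rather than agreement on sets, so that [mu] can be substituted
    throughout. *)
Lemma sigma_finite_measure_of {R : realType} {d : measure_display} {X : measurableType d}
    (mu : {measure set X -> \bar R}) : sigma_finite setT mu ->
  exists nu : {sigma_finite_measure set X -> \bar R}, (nu : {measure set X -> \bar R}) = mu.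
Proof. by case: mu => m c h; exists (sigma_finite_copy h). Qed.

Theorem lemma2p7 (R : realType) (d : measure_display)
    (X : metricMeasurableType R d) (mu : {measure set X -> \bar R})
    (phi : X -> R -> R)
    (hX : homogeneous_type mu) (hphi : growth_function mu phi) :
  (mu setT = +oo%E ->
   exists2 C : R, 0 < C & forall f : X * R -> R[i], in_Tphi mu phi f ->
   exists (lam : nat -> R[i]) (A : nat -> X * R -> R[i]) (B : nat -> set X),
   [/\ (forall j, metric_ball (B j) /\ atom mu phi (B j) (A j)),
       {ae (mu \x lebesgue_measure)%E, forall z, upper_half z ->
          series (fun j => lam j * A j z : R[i]^o) @ \oo --> (f z : R[i]^o)} &
       (luxemburg (fun l => \sum_(0 <= j <oo) coef_term mu phi (B j) (lam j) l)
        <= C%:E * Tphi_norm mu phi f)%E])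
  /\
  ((mu setT < +oo)%E ->
   exists2 C : R, 0 < C & forall f : X * R -> R[i], in_Tphi mu phi f ->
   exists (lam0 : R[i]) (A0 : X * R -> R[i])
     (lam : nat -> R[i]) (A : nat -> X * R -> R[i]) (B : nat -> set X),
   [/\ single_atom mu phi A0,
       (* when X has at most one point there is no ball other than X, and the
          sequence of atoms is read as void *)
       (forall j, [/\ metric_ball (B j), B j <> setT & atom mu phi (B j) (A j)] \/
                  ((forall x y : X, x = y) /\ lam j = 0)),
       {ae (mu \x lebesgue_measure)%E, forall z, upper_half z ->
          series (fun j => lam j * A j z : R[i]^o) @ \oo
            --> (f z - lam0 * A0 z : R[i]^o)} &
       (luxemburg (fun l => coef_term mu phi setT lam0 l +
                            \sum_(0 <= j <oo) coef_term mu phi (B j) (lam j) l)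
        <= C%:E * Tphi_norm mu phi f)%E]).
Proof.
have [[open_meas _] dbl] := hX.
have [B0 hB0 hB0T] := exists_ball_neq_setT X.
have side (lam : nat -> R[i]) (A : nat -> X * R -> R[i]) (B : nat -> set X) :
    (forall j, [/\ metric_ball (B j), atom mu phi (B j) (A j) &
       B j <> setT \/ B j = B0 /\ lam j = 0]) ->
    forall j, [/\ metric_ball (B j), B j <> setT & atom mu phi (B j) (A j)] \/
              ((forall x y : X, x = y) /\ lam j = 0).
  move=> hB j; case: (hB j) => b a [bT|[bB0 l0]]; first by left.
  by case: hB0T => [B0T|X1]; [left; split=> //; rewrite bB0|right].
(* Doubling permits the zero measure, for which balls have no positive volume; only the second part
   then applies. *)
have [muT0|muT0] := eqVneq (mu setT) 0%E.
  have mu_fin : sigma_finite setT mu.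
    by exists (fun=> setT) => [|_]; [rewrite bigcup_const|rewrite muT0].
  have [nu nuE] := sigma_finite_measure_of mu_fin; subst mu.
  split=> [|_]; first by rewrite muT0.
  exists 1 => [|f f_Tphi]; first exact: ltr01.
  have [lam0 [A0 [lam [A [B [hA0 hB hae hlux]]]]]] :=
    decomposition_zero_mass muT0 hB0 f_Tphi.
  by exists lam0, A0, lam, A, B; split; [exact: hA0|exact: side|exact: hae|exact: hlux].
have [C1 C11 dblC] := doubling_nondegenerate open_meas dbl muT0.
have [nu nuE] := sigma_finite_measure_of (doubling_sigma_finite open_meas dblC); subst mu.
have [C C0 hC] := decomposition_positive_mass open_meas dblC hphi.
split=> muT; exists C => [|f f_Tphi]; first exact: C0.
- have [lam [A [B [hB hae hlux]]]] := (hC f B0 f_Tphi hB0).1 muT.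
  exists lam, A, B; split; [|exact: hae|exact: hlux].
  by move=> j; case: (hB j).
- exact: C0.
- have [lam0 [A0 [lam [A [B [hA0 hB hae hlux]]]]]] := (hC f B0 f_Tphi hB0).2 muT.
  by exists lam0, A0, lam, A, B; split; [exact: hA0|exact: side|exact: hae|exact: hlux].
Qed.
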